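(* (1) Every uplifting cardinal $\kappa$ has an ordinal-anticipating uplifting Laver function $\ell:\kappa\to\kappa$ definable in $H_\kappa$. (2) Every uplifting cardinal $\kappa$ has a ${\rm HOD}$-anticipating uplifting Laver function $\ell:\kappa\to H_\kappa$ definable in $H_\kappa$. (3) If $V={\rm HOD}$, then every uplifting cardinal $\kappa$ has an uplifting Laver function $\ell:\kappa\to H_\kappa$ definable in $H_\kappa$.
   Context: An inaccessible cardinal $\kappa$ is uplifting if for every ordinal $\theta$ there is an inaccessible $\gamma\ge\theta$ with $V_\kappa\prec V_\gamma$ a proper elementary extension. For uplifting $\kappa$, a (partial) function $\ell:\kappa\to H_\kappa$ is an uplifting Laver function for $\kappa$ if for every set $x$ there are unboundedly many inaccessible cardinals $\gamma$ with a function $\ell^*:\gamma\to H_\gamma$ such that $\langle H_\kappa,\in,\ell\rangle\prec\langle H_\gamma,\in,\ell^*\rangle$ and $\ell^*(\kappa)=x$. It is ordinal-anticipating (with $\ell:\kappa\to\kappa$, $\ell^*:\gamma\to\gamma$) if this is required only for ordinals $x$, and ${\rm HOD}$-anticipating if required only for $x\in{\rm HOD}$. *)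

(* Defs.v *)
(* Only the Rocq prelude is used: set theory is developed over an arbitrary
   first-order model (V, mem) of ZFC.  All notions below are first-order over
   (V, mem), relational (is_foo y x reads "y = foo(x)"), and internal to the
   model: in particular omega, formulas, assignments and the satisfaction
   relation of a set structure are elements of V, so that nothing is assumed
   about well-foundedness of mem or standardness of omega. *)

Set Implicit Arguments.
Unset Strict Implicit.

(* Metatheoretic formulas, used only for the two axiom schemes.  Variables are
   de Bruijn indices: the quantifier binds variable 0. *)
Inductive form : Type :=
| FMem (i j : nat)
| FEq (i j : nat)
| FNeg (p : form)
| FAnd (p q : form)
| FEx (p : form).

Definition scons {V : Type} (x : V) (e : nat -> V) : nat -> V :=
  fun n => match n with O => x | S m => e m end.

Section SetTheory.

Context {V : Type} (mem : V -> V -> Prop).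

Local Notation "x ∈ y" := (mem x y) (at level 70, no associativity).

Fixpoint fsat (e : nat -> V) (p : form) : Prop :=
  match p with
  | FMem i j => e i ∈ e j
  | FEq i j => e i = e j
  | FNeg q => ~ fsat e q
  | FAnd q r => fsat e q /\ fsat e r
  | FEx q => exists x, fsat (scons x e) q
  end.

Definition sub (x y : V) : Prop := forall z, z ∈ x -> z ∈ y.
Definition is_empty (x : V) : Prop := forall z, ~ z ∈ x.
Definition is_upair (p x y : V) : Prop := forall z, z ∈ p <-> z = x \/ z = y.
Definition is_pow (p x : V) : Prop := forall z, z ∈ p <-> sub z x.
Definition is_succ (y x : V) : Prop := forall z, z ∈ y <-> z ∈ x \/ z = x.

Record ZFC : Prop := {
  zfc_ext : forall x y, (forall z, z ∈ x <-> z ∈ y) -> x = y;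
  zfc_found : forall x, (exists y, y ∈ x) ->
    exists y, y ∈ x /\ forall z, z ∈ x -> ~ z ∈ y;
  zfc_pair : forall x y, exists p, is_upair p x y;
  zfc_union : forall x, exists u, forall z, z ∈ u <-> exists y, y ∈ x /\ z ∈ y;
  zfc_pow : forall x, exists p, is_pow p x;
  zfc_inf : exists w, (exists z, is_empty z /\ z ∈ w) /\
    forall x, x ∈ w -> exists y, is_succ y x /\ y ∈ w;
  zfc_sep : forall (p : form) (e : nat -> V) (a : V),
    exists b, forall x, x ∈ b <-> x ∈ a /\ fsat (scons x e) p;
  zfc_repl : forall (p : form) (e : nat -> V) (a : V),
    (forall x y y', x ∈ a -> fsat (scons x (scons y e)) p ->
       fsat (scons x (scons y' e)) p -> y = y') ->
    exists b, forall y, y ∈ b <->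
      exists x, x ∈ a /\ fsat (scons x (scons y e)) p;
  zfc_choice : forall a,
    (forall x, x ∈ a -> exists z, z ∈ x) ->
    (forall x y z, x ∈ a -> y ∈ a -> z ∈ x -> z ∈ y -> x = y) ->
    exists c, forall x, x ∈ a ->
      exists z, (z ∈ c /\ z ∈ x) /\ forall z', z' ∈ c /\ z' ∈ x -> z' = z
}.

(* Kuratowski pairs; gr r x y reads "⟨x, y⟩ ∈ r". *)
Definition is_pair (p x y : V) : Prop :=
  exists a b, is_upair a x x /\ is_upair b x y /\ is_upair p a b.
Definition gr (r x y : V) : Prop := exists p, is_pair p x y /\ p ∈ r.

(* Partial, total, and total injective functions from a to b. *)
Definition is_pfun (f a b : V) : Prop :=
  (forall p, p ∈ f -> exists x y, x ∈ a /\ y ∈ b /\ is_pair p x y) /\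
  (forall x y y', gr f x y -> gr f x y' -> y = y').
Definition is_fun (f a b : V) : Prop :=
  is_pfun f a b /\ forall x, x ∈ a -> exists y, gr f x y.
Definition is_inj (f a b : V) : Prop :=
  is_fun f a b /\ forall x x' y, gr f x y -> gr f x' y -> x = x'.
Definition injects (a b : V) : Prop := exists f, is_inj f a b.

Definition transitive (x : V) : Prop := forall y, y ∈ x -> sub y x.
Definition is_tc (t x : V) : Prop :=
  transitive t /\ sub x t /\ forall u, transitive u -> sub x u -> sub t u.

Definition ord (x : V) : Prop :=
  transitive x /\ forall y, y ∈ x -> transitive y.
Definition ole (a b : V) : Prop := a ∈ b \/ a = b.
Definition limit (x : V) : Prop :=
  ord x /\ ~ is_empty x /\ forall y, y ∈ x -> exists z, z ∈ x /\ y ∈ z.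
Definition is_omega (w : V) : Prop :=
  limit w /\ forall n, n ∈ w -> ~ limit n.
Definition is_nat (n : V) : Prop := exists w, is_omega w /\ n ∈ w.

(* card_lt a k reads "|a| < k", for k a cardinal. *)
Definition card_lt (a k : V) : Prop := exists b, b ∈ k /\ injects a b.
Definition cardinal (k : V) : Prop := ord k /\ ~ card_lt k k.
Definition regular (k : V) : Prop :=
  limit k /\ forall a f, a ∈ k -> is_fun f a k ->
    exists b, b ∈ k /\ forall x y, gr f x y -> y ∈ b.
Definition strong_limit (k : V) : Prop :=
  forall a p, a ∈ k -> is_pow p a -> card_lt p k.
Definition inaccessible (k : V) : Prop :=
  cardinal k /\ (exists w, is_omega w /\ w ∈ k) /\ regular k /\ strong_limit k.

Definition is_H (h k : V) : Prop :=
  forall x, x ∈ h <-> exists t, is_tc t x /\ card_lt t k.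

(* v = V_a: v is the value at a of the function f on a + 1 determined by
   f(b) = union of the power sets of the f(c), c < b. *)
Definition is_Vlevel (v a : V) : Prop :=
  ord a /\ exists f,
    (forall b, ole b a <-> exists u, gr f b u) /\
    (forall b u u', gr f b u -> gr f b u' -> u = u') /\
    (forall b u, gr f b u -> forall x,
       x ∈ u <-> exists c w, c ∈ b /\ gr f c w /\ sub x w) /\
    gr f a v.

(* Coded first-order syntax.  A structure ⟨M, ∈⟩ is given by M and F = None,
   a structure ⟨M, ∈, l⟩, with l a partial function, by M and F = Some l; in
   the second case the language has the further atomic formulas l(x_i) = x_j.
   The code of a formula is the tuple
     x_i ∈ x_j : ⟨0,⟨i,j⟩⟩    x_i = x_j : ⟨1,⟨i,j⟩⟩    l(x_i) = x_j : ⟨2,⟨i,j⟩⟩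
     ¬ f : ⟨3,f⟩              f ∧ g : ⟨4,⟨f,g⟩⟩        ∃ f : ⟨5,f⟩
   where variables are de Bruijn indices (elements of omega). *)
Fixpoint is_num (k : nat) (x : V) : Prop :=
  match k with
  | O => is_empty x
  | S m => exists y, is_num m y /\ is_succ x y
  end.

Definition code1 (k : nat) (p x : V) : Prop :=
  exists t, is_num k t /\ is_pair p t x.
Definition code2 (k : nat) (p x y : V) : Prop :=
  exists q, is_pair q x y /\ code1 k p q.

Definition is_cMem : V -> V -> V -> Prop := code2 0.
Definition is_cEq : V -> V -> V -> Prop := code2 1.
Definition is_cFun : V -> V -> V -> Prop := code2 2.
Definition is_cNeg : V -> V -> Prop := code1 3.
Definition is_cAnd : V -> V -> V -> Prop := code2 4.
Definition is_cEx : V -> V -> Prop := code1 5.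

Definition fml_closed (F : option V) (X : V) : Prop :=
  (forall p i j, is_nat i -> is_nat j -> is_cMem p i j -> p ∈ X) /\
  (forall p i j, is_nat i -> is_nat j -> is_cEq p i j -> p ∈ X) /\
  match F with
  | None => True
  | Some _ =>
      forall p i j, is_nat i -> is_nat j -> is_cFun p i j -> p ∈ X
  end /\
  (forall p f, f ∈ X -> is_cNeg p f -> p ∈ X) /\
  (forall p f g, f ∈ X -> g ∈ X -> is_cAnd p f g -> p ∈ X) /\
  (forall p f, f ∈ X -> is_cEx p f -> p ∈ X).

Definition is_fml (F : option V) (p : V) : Prop :=
  forall X, fml_closed F X -> p ∈ X.

Definition assign (M s : V) : Prop := exists w, is_omega w /\ is_fun s w M.

(* t(0) = a and t(i+1) = s(i). *)
Definition is_scons (t a s : V) : Prop :=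
  (forall z, is_empty z -> gr t z a) /\
  (forall i j b, is_succ j i -> gr s i b -> gr t j b).

(* The set S of pairs ⟨p, s⟩ obeys Tarski's clauses for the structure. *)
Definition is_truth (M : V) (F : option V) (S : V) : Prop :=
  forall p s, is_fml F p -> assign M s ->
  (forall i j, is_cMem p i j ->
     (gr S p s <-> exists a b, gr s i a /\ gr s j b /\ a ∈ b)) /\
  (forall i j, is_cEq p i j ->
     (gr S p s <-> exists a, gr s i a /\ gr s j a)) /\
  match F with
  | None => True
  | Some l =>
      forall i j, is_cFun p i j ->
        (gr S p s <-> exists a b, gr s i a /\ gr s j b /\ gr l a b)
  end /\
  (forall f, is_cNeg p f -> (gr S p s <-> ~ gr S f s)) /\
  (forall f g, is_cAnd p f g -> (gr S p s <-> gr S f s /\ gr S g s)) /\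
  (forall f, is_cEx p f ->
     (gr S p s <->
      exists a t, a ∈ M /\ assign M t /\ is_scons t a s /\ gr S f t)).

Definition sat (M : V) (F : option V) (p s : V) : Prop :=
  exists S, is_truth M F S /\ gr S p s.

Definition elem_sub (M : V) (F : option V) (N : V) (G : option V) : Prop :=
  sub M N /\
  forall p s, is_fml F p -> assign M s -> (sat M F p s <-> sat N G p s).

Definition uplifting (k : V) : Prop :=
  inaccessible k /\
  forall th, ord th ->
    exists g vk vg, inaccessible g /\ ole th g /\
      is_Vlevel vk k /\ is_Vlevel vg g /\
      elem_sub vk None vg None /\ vk <> vg.

(* x is the unique element u of some V_a with V_a ⊨ p[u, s(0), s(1), ...],
   where the parameters s(i) are ordinals below a, all but finitely many of
   them 0. *)
Definition OD (x : V) : Prop :=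
  exists a v p s, is_Vlevel v a /\ x ∈ v /\ is_fml None p /\
    (exists w, is_omega w /\ is_fun s w a) /\
    (exists n, is_nat n /\ forall i b, gr s i b -> ~ i ∈ n -> is_empty b) /\
    forall u t, u ∈ v -> assign v t -> is_scons t u s ->
      (sat v None p t <-> u = x).

Definition HOD (x : V) : Prop :=
  exists u t, is_upair u x x /\ is_tc t u /\ forall y, y ∈ t -> OD y.

(* Common form of the Laver function notions: P is the class of sets to be
   anticipated, and cod c k says that c is the codomain (k or H_k) required of
   functions on k. *)
Definition laver_for (P : V -> Prop) (cod : V -> V -> Prop) (k l : V) : Prop :=
  exists hk c, is_H hk k /\ cod c k /\ is_pfun l k c /\
  forall x, P x -> forall th, ord th ->
    exists g hg d l', inaccessible g /\ ole th g /\
      is_H hg g /\ cod d g /\ is_pfun l' g d /\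
      elem_sub hk (Some l) hg (Some l') /\ gr l' k x.

Definition uplifting_laver : V -> V -> Prop :=
  laver_for (fun _ => True) is_H.
Definition ord_anticipating_laver : V -> V -> Prop :=
  laver_for ord (fun c k => c = k).
Definition HOD_anticipating_laver : V -> V -> Prop :=
  laver_for HOD is_H.

(* Definability of the graph of l without parameters: p defines it through the
   variables 0 and 1, whatever the values of the other variables. *)
Definition definable_in (M l : V) : Prop :=
  exists p, is_fml None p /\
    forall s, assign M s ->
      (sat M None p s <->
       exists i j a b, is_num 0 i /\ is_num 1 j /\
         gr s i a /\ gr s j b /\ gr l a b).

End SetTheory.

(* Main.v *)
From Stdlib Require Import PeanoNat Classical ClassicalEpsilon.
Require Import Defs.

(* Let C_d be the class of inaccessible g > d with V_d ≺ V_g, and C0_d the class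
   of those g in C_d below which C_d is bounded; if d is uplifting, both are
   proper classes.  Fix a definable set-like well-order of codes, a code being
   obtained from ordinals by pairing.  Assign greedily to each g in C0_d the
   least code in V_g not assigned earlier.  Every code of an ordinal definable
   set x contains a dummy ordinal, so x has a proper class of codes; each code
   is assigned eventually, because the assignment is injective and C0_d is a
   proper class; hence codes of x are assigned at unboundedly many g.  All the
   notions involved are absolute between V_g and V, so V_g can compute from d
   the code assigned to g, as the first one not assigned below g.  Let l(d), as
   computed in V_k, be the set coded by that first unassigned code.  This l is
   definable in V_k = H_k, and the same definition in V_g yields l', so
   V_k ≺ V_g entails (V_k, l) ≺ (V_g, l'), while l'(k) = x when g is assigned a
   code of x. *)

(** The obstacle is that V_g must possess the enumeration below g as an element, not merely as a
    definable class. If its stages are bounded by some b in g, the enumeration is a subset of b ×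
    V_b and lies in V_g; this is why C0_d replaces C_d. Nothing is lost: the least member of C_d
    above a given ordinal belongs to C0_d. The dummy ordinal compensates for the injectivity of the
    greedy assignment, which gives every code away only once, whereas x has to be hit unboundedly
    often. Ordering the codes by rank first keeps the predecessors of a code inside one level, and
    makes the order the same in every limit level. The model is arbitrary, so its ω and its formulas
    may be nonstandard. Hence there are two kinds of formulas: those of type [form], used for the
    axiom schemes and for the definition of l, and the internal ones, over which ≺ quantifies. The
    former are translated into the latter by [code]; that elementarity survives the expansion by l
    has to be shown by induction inside the model. *)

Set Implicit Arguments.
Unset Strict Implicit.

(** * Definability *)

Section Renaming.

Context {V : Type} (m : V -> V -> Prop).

Lemma fsat_ext (p : form) : forall e e' : nat -> V,
  (forall i, e i = e' i) -> (fsat m e p <-> fsat m e' p).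
Proof.
  induction p as [i j|i j|p IH|p IHp q IHq|p IH]; intros e e' H; simpl.
  - rewrite !H; tauto.
  - rewrite !H; tauto.
  - rewrite (IH e e' H); tauto.
  - rewrite (IHp e e' H), (IHq e e' H); tauto.
  - split; intros [x Hx]; exists x; revert Hx; apply IH; intros [|i]; simpl; auto.
Qed.

Fixpoint ren (r : nat -> nat) (p : form) : form :=
  match p with
  | FMem i j => FMem (r i) (r j)
  | FEq i j => FEq (r i) (r j)
  | FNeg q => FNeg (ren r q)
  | FAnd q s => FAnd (ren r q) (ren r s)
  | FEx q => FEx (ren (fun n => match n with O => O | S k => S (r k) end) q)
  end.

Lemma fsat_ren (p : form) : forall r (e : nat -> V),
  fsat m e (ren r p) <-> fsat m (fun i => e (r i)) p.
Proof.
  induction p as [i j|i j|p IH|p IHp q IHq|p IH]; intros r e; simpl.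
  - tauto.
  - tauto.
  - rewrite IH; tauto.
  - rewrite IHp, IHq; tauto.
  - split; intros [x Hx]; exists x; revert Hx; rewrite IH; apply fsat_ext;
      intros [|i]; reflexivity.
Qed.

End Renaming.

(* Uniformity in the structure is what lets V_k and V_g share definitions. *)
Definition upred := forall W : Type, (W -> W -> Prop) -> (nat -> W) -> Prop.
Definition ufo (P : upred) : Prop :=
  exists p, forall W (m : W -> W -> Prop) e, fsat m e p <-> P W m e.

Lemma ufo_iff (P Q : upred) :
  (forall W m e, P W m e <-> Q W m e) -> ufo P -> ufo Q.
Proof. intros H [p Hp]; exists p; intros; rewrite Hp; apply H. Qed.

Lemma ufo_mem i j : ufo (fun W m e => m (e i) (e j)).
Proof. exists (FMem i j); simpl; tauto. Qed.
Lemma ufo_eq i j : ufo (fun W m e => e i = e j).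
Proof. exists (FEq i j); simpl; tauto. Qed.
Lemma ufo_not P : ufo P -> ufo (fun W m e => ~ P W m e).
Proof. intros [p Hp]; exists (FNeg p); intros; simpl; rewrite Hp; tauto. Qed.
Lemma ufo_and P Q : ufo P -> ufo Q -> ufo (fun W m e => P W m e /\ Q W m e).
Proof.
  intros [p Hp] [q Hq]; exists (FAnd p q); intros; simpl; rewrite Hp, Hq; tauto.
Qed.
Lemma ufo_ex (P : forall W, (W -> W -> Prop) -> W -> (nat -> W) -> Prop) :
  ufo (fun W m e => P W m (e 0) (fun n => e (S n))) ->
  ufo (fun W m e => exists x, P W m x e).
Proof.
  intros [p Hp]; exists (FEx p); intros; simpl.
  split; intros [x Hx]; exists x; [apply Hp in Hx|apply Hp]; exact Hx.
Qed.
(** [form] has only negation, conjunction and existence; the other connectives are reduced to these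
    by classical logic. *)
Lemma ufo_or P Q : ufo P -> ufo Q -> ufo (fun W m e => P W m e \/ Q W m e).
Proof.
  intros HP HQ; apply (@ufo_iff (fun W m e => ~ (~ P W m e /\ ~ Q W m e))).
  - intros; split; [intros H|tauto]; apply NNPP; tauto.
  - auto using ufo_not, ufo_and.
Qed.
Lemma ufo_imp P Q : ufo P -> ufo Q -> ufo (fun W m e => P W m e -> Q W m e).
Proof.
  intros HP HQ; apply (@ufo_iff (fun W m e => ~ (P W m e /\ ~ Q W m e))).
  - intros; split; [intros H H'; apply NNPP|]; tauto.
  - auto using ufo_not, ufo_and.
Qed.
Lemma ufo_bi P Q : ufo P -> ufo Q -> ufo (fun W m e => P W m e <-> Q W m e).
Proof. intros; apply ufo_and; apply ufo_imp; assumption. Qed.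
Lemma ufo_all (P : forall W, (W -> W -> Prop) -> W -> (nat -> W) -> Prop) :
  ufo (fun W m e => P W m (e 0) (fun n => e (S n))) ->
  ufo (fun W m e => forall x, P W m x e).
Proof.
  intros HP; apply (@ufo_iff (fun W m e => ~ exists x, ~ P W m x e)).
  - intros; split; [|intros H [x Hx]; auto].
    intros H x; apply NNPP; intros Hx; apply H; eauto.
  - apply ufo_not, (@ufo_ex (fun W m x e => ~ P W m x e)), ufo_not, HP.
Qed.
Lemma ufo_true : ufo (fun W m e => True).
Proof.
  apply (@ufo_iff (fun W m e => ~ (e 0 = e 0 /\ ~ e 0 = e 0))); [tauto|].
  auto using ufo_not, ufo_and, ufo_eq.
Qed.

Create HintDb ufo discriminated.

(** The formula is built by recursion on the shape of the predicate; at the leaves stand notions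
    already registered in the hint base, so each notion is unfolded only once. *)
Ltac ufo_tac := cbv beta;
  lazymatch goal with
  | |- ufo (fun W m e => True) => exact ufo_true
  | |- ufo (fun W m e => m (e ?i) (e ?j)) => exact (ufo_mem i j)
  | |- ufo (fun W m e => e ?i = e ?j) => exact (ufo_eq i j)
  | |- ufo (fun W m e => ~ @?P W m e) => apply (@ufo_not P); ufo_tac
  | |- ufo (fun W m e => @?P W m e /\ @?Q W m e) =>
      apply (@ufo_and P Q); ufo_tac
  | |- ufo (fun W m e => @?P W m e \/ @?Q W m e) =>
      apply (@ufo_or P Q); ufo_tac
  | |- ufo (fun W m e => @?P W m e <-> @?Q W m e) =>
      apply (@ufo_bi P Q); ufo_tac
  | |- ufo (fun W m e => exists x : W, @?P W m e x) =>
      apply (@ufo_ex (fun W m x e => P W m e x)); ufo_tac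
  | |- ufo (fun W m e => @?P W m e -> @?Q W m e) =>
      apply (@ufo_imp P Q); ufo_tac
  | |- ufo (fun W m e => forall x : W, @?P W m e x) =>
      apply (@ufo_all (fun W m x e => P W m e x)); ufo_tac
  | |- _ => solve [auto 1 with ufo nocore]
  end.

Existing Class ZFC.

(** * Definability with parameters in the model *)

Section Params.

Context {V : Type} {mem : V -> V -> Prop} {hZFC : ZFC mem}.

(* Even variables are the free ones, odd variables the parameters. *)
Definition mix (e c : nat -> V) (n : nat) : V :=
  if Nat.even n then e (Nat.div2 n) else c (Nat.div2 n).

Lemma mix_even n e c : mix e c (2 * n) = e n.
Proof.
  unfold mix; rewrite Nat.even_mul, Nat.div2_double; reflexivity.
Qed.
Lemma mix_odd n e c : mix e c (S (2 * n)) = c n.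
Proof.
  unfold mix; rewrite Nat.even_succ, Nat.odd_mul, Nat.div2_succ_double; reflexivity.
Qed.

(** The parameters fill an infinite sequence c, so they need not be counted when formulas are
    combined. *)
Definition fo (P : (nat -> V) -> Prop) : Prop :=
  exists p c, forall e, fsat mem (mix e c) p <-> P e.
(** A function of the assignment counts as a term when its graph is definable, the value being
    variable 0. Set operations can thus be nested although the language has no function symbols. *)
Definition tm (t : (nat -> V) -> V) : Prop :=
  fo (fun e => e 0 = t (fun n => e (S n))).

Lemma fo_iff P Q : (forall e, P e <-> Q e) -> fo P -> fo Q.
Proof. intros H [p [c Hp]]; exists p, c; intros; rewrite Hp; apply H. Qed.

(** [r] tells for each variable of p whether it is read from the assignment or from the parameters,
    and at which index. *)
Lemma fo_env p (E : (nat -> V) -> nat -> V) (r : nat -> bool * nat) (c : nat -> V) :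
  (forall e i, E e i = if fst (r i) then e (snd (r i)) else c (snd (r i))) ->
  fo (fun e => fsat mem (E e) p).
Proof.
  intros H.
  exists (ren (fun i => if fst (r i) then 2 * snd (r i) else S (2 * snd (r i))) p), c.
  intros e; rewrite fsat_ren; apply fsat_ext; intros i; rewrite H.
  destruct (r i) as [[|] k]; cbn [fst snd]; [apply mix_even|apply mix_odd].
Qed.

Lemma fo_of_ufo (P : upred) : ufo P -> fo (P V mem).
Proof.
  intros [p Hp]; destruct (zfc_inf hZFC) as [w _].
  apply (@fo_iff (fun e => fsat mem e p)); [intros; apply Hp|].
  apply (@fo_env p _ (fun i => (true, i)) (fun _ => w)); reflexivity.
Qed.

Lemma fo_not P : fo P -> fo (fun e => ~ P e).
Proof. intros [p [c Hp]]; exists (FNeg p), c; intros; simpl; rewrite Hp; tauto. Qed.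

(** The two formulas come with different parameter sequences, which are interleaved as [mix c d];
    the renamings move the odd variables to their new places. *)
Lemma fo_and P Q : fo P -> fo Q -> fo (fun e => P e /\ Q e).
Proof.
  intros [p [c Hp]] [q [d Hq]].
  exists (FAnd
    (ren (fun i => if Nat.even i then i else S (2 * (2 * Nat.div2 i))) p)
    (ren (fun i => if Nat.even i then i else S (2 * (S (2 * Nat.div2 i)))) q)), (mix c d).
  intros e; cbn [fsat]; rewrite !fsat_ren, <- Hp, <- Hq.
  rewrite (fsat_ext mem p (e' := mix e c)), (fsat_ext mem q (e' := mix e d)); [tauto| |];
    intros i; destruct (Nat.even i) eqn:E.
  - unfold mix; rewrite E; reflexivity.
  - rewrite mix_odd, mix_odd; unfold mix; rewrite E; reflexivity.
  - unfold mix; rewrite E; reflexivity.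
  - rewrite mix_odd, mix_even; unfold mix; rewrite E; reflexivity.
Qed.

Lemma fo_ex (P : V -> (nat -> V) -> Prop) :
  fo (fun e => P (e 0) (fun n => e (S n))) -> fo (fun e => exists x, P x e).
Proof.
  intros [p [c Hp]].
  (* Under the quantifier the bound variable is number 0 and all others move up by one, the
     parameters included; the renaming reconciles this with the even and odd numbering of [mix]. *)
  exists (FEx (ren (fun i => if Nat.even i then
      match Nat.div2 i with O => O | S k => S (2 * k) end
    else S (S (2 * Nat.div2 i))) p)), c.
  intros e; cbn [fsat].
  assert (H : forall x, fsat mem (scons x (mix e c)) (ren (fun i => if Nat.even i then
      match Nat.div2 i with O => O | S k => S (2 * k) end
    else S (S (2 * Nat.div2 i))) p) <-> P x e).
  { intros x; rewrite fsat_ren; rewrite <- (Hp (scons x e)); apply fsat_ext.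
    intros i; unfold mix at 2; destruct (Nat.even i) eqn:E.
    - destruct (Nat.div2 i) as [|k]; [reflexivity|]; exact (mix_even k e c).
    - exact (mix_odd (Nat.div2 i) e c). }
  split; intros [x Hx]; exists x; apply H; exact Hx.
Qed.

Lemma fo_or P Q : fo P -> fo Q -> fo (fun e => P e \/ Q e).
Proof.
  intros HP HQ; apply (@fo_iff (fun e => ~ (~ P e /\ ~ Q e))).
  - intros; split; [intros H|tauto]; apply NNPP; tauto.
  - auto using fo_not, fo_and.
Qed.
Lemma fo_imp P Q : fo P -> fo Q -> fo (fun e => P e -> Q e).
Proof.
  intros HP HQ; apply (@fo_iff (fun e => ~ (P e /\ ~ Q e))).
  - intros; split; [intros H H'; apply NNPP|]; tauto.
  - auto using fo_not, fo_and.
Qed.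
Lemma fo_bi P Q : fo P -> fo Q -> fo (fun e => P e <-> Q e).
Proof. intros; apply fo_and; apply fo_imp; assumption. Qed.
Lemma fo_all (P : V -> (nat -> V) -> Prop) :
  fo (fun e => P (e 0) (fun n => e (S n))) -> fo (fun e => forall x, P x e).
Proof.
  intros HP; apply (@fo_iff (fun e => ~ exists x, ~ P x e)).
  - intros; split; [|intros H [x Hx]; auto].
    intros H x; apply NNPP; intros Hx; apply H; eauto.
  - apply fo_not, (@fo_ex (fun x e => ~ P x e)), fo_not, HP.
Qed.

(** By excluded middle a proposition without variables is equivalent to True or to its negation, so
    facts of the metatheory may occur inside definable predicates. *)
Lemma fo_closed (P : Prop) : fo (fun _ => P).
Proof.
  destruct (classic P) as [H|H].
  - apply (@fo_iff (fun _ => True)); [tauto|].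
    exact (@fo_of_ufo (fun W m e => True) ufo_true).
  - apply (@fo_iff (fun _ => ~ True)); [tauto|].
    exact (fo_not (@fo_of_ufo (fun W m e => True) ufo_true)).
Qed.
Lemma tm_var i : tm (fun e => e i).
Proof. apply (@fo_of_ufo (fun W m e => e 0 = e (S i))), ufo_eq. Qed.
Lemma tm_const x : tm (fun _ => x).
Proof.
  apply (@fo_iff (fun e => fsat mem (fun i => match i with O => e 0 | _ => x end) (FEq 0 1))).
  - intros e; simpl; tauto.
  - apply (@fo_env (FEq 0 1) _ (fun i => (match i with O => true | _ => false end, 0))
      (fun _ => x)).
    intros e [|i]; reflexivity.
Qed.
Lemma tm_shift t : tm t -> tm (fun e => t (fun n => e (S n))).
Proof.
  unfold tm; intros [p [c Hp]].
  apply (@fo_iff (fun e => fsat mem (mix (fun n => match n with O => e 0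
    | S k => e (S (S k)) end) c) p)); [intros; rewrite Hp; tauto|].
  apply (@fo_env p _ (fun i => (Nat.even i, if Nat.even i then
    match Nat.div2 i with O => O | S k => S (S k) end else Nat.div2 i)) c).
  intros e i; unfold mix; simpl; destruct (Nat.even i); [destruct (Nat.div2 i)|]; reflexivity.
Qed.

(** Substituting a term means quantifying over its value, which avoids an operation of substitution
    on formulas. *)
Lemma fo_sub (P : V -> (nat -> V) -> Prop) t :
  fo (fun e => P (e 0) (fun n => e (S n))) -> tm t -> fo (fun e => P (t e) e).
Proof.
  intros HP Ht; apply (@fo_iff (fun e => exists x, x = t e /\ P x e)).
  - intros e; split; [intros [x [-> H]]; exact H|eauto].
  - apply (@fo_ex (fun x e => x = t e /\ P x e)), fo_and; [exact Ht|exact HP].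
Qed.

Lemma fo_app1 (P : V -> Prop) t : fo (fun e => P (e 0)) -> tm t -> fo (fun e => P (t e)).
Proof. intros HP; apply (@fo_sub (fun x e => P x)), HP. Qed.
Lemma fo_app2 (P : V -> V -> Prop) t u :
  fo (fun e => P (e 0) (e 1)) -> tm t -> tm u -> fo (fun e => P (t e) (u e)).
Proof.
  intros HP Ht Hu; apply (@fo_sub (fun y e => P (t e) y)); [|exact Hu].
  apply (@fo_sub (fun x e => P x (e 0))); [exact HP|exact (tm_shift Ht)].
Qed.
Lemma fo_app3 (P : V -> V -> V -> Prop) t u v :
  fo (fun e => P (e 0) (e 1) (e 2)) -> tm t -> tm u -> tm v ->
  fo (fun e => P (t e) (u e) (v e)).
Proof.
  intros HP Ht Hu Hv; apply (@fo_sub (fun z e => P (t e) (u e) z)); [|exact Hv].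
  apply (@fo_sub (fun y e => P (t (fun n => e (S n))) y (e 0))); [|exact (tm_shift Hu)].
  apply (@fo_sub (fun x e => P x (e 0) (e 1))); [exact HP|exact (tm_shift (tm_shift Ht))].
Qed.

Lemma fo_mem t u : tm t -> tm u -> fo (fun e => mem (t e) (u e)).
Proof.
  intros Ht Hu; apply (@fo_sub (fun x e => mem x (u e))); [|exact Ht].
  apply (@fo_sub (fun y e => mem (e 0) y)); [|apply tm_shift, Hu].
  apply (@fo_of_ufo (fun W m e => m (e 1) (e 0))), ufo_mem.
Qed.
Lemma fo_eq t u : tm t -> tm u -> fo (fun e => t e = u e).
Proof.
  intros Ht Hu; apply (@fo_sub (fun x e => x = u e)); [|exact Ht].
  apply (@fo_sub (fun y e => e 0 = y)); [|apply tm_shift, Hu].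
  apply (@fo_of_ufo (fun W m e => e 1 = e 0)), ufo_eq.
Qed.

Lemma fo_u1 (P : forall W, (W -> W -> Prop) -> W -> Prop) t :
  (forall i, ufo (fun W m e => P W m (e i))) -> tm t -> fo (fun e => P V mem (t e)).
Proof.
  intros HP Ht; apply (@fo_sub (fun x e => P V mem x)); [|exact Ht].
  apply (@fo_of_ufo (fun W m e => P W m (e 0))), HP.
Qed.
Lemma fo_u2 (P : forall W, (W -> W -> Prop) -> W -> W -> Prop) t u :
  (forall i j, ufo (fun W m e => P W m (e i) (e j))) -> tm t -> tm u ->
  fo (fun e => P V mem (t e) (u e)).
Proof.
  intros HP Ht Hu; apply (@fo_sub (fun x e => P V mem x (u e))); [|exact Ht].
  apply (@fo_sub (fun y e => P V mem (e 0) y)); [|apply tm_shift, Hu].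
  apply (@fo_of_ufo (fun W m e => P W m (e 1) (e 0))), HP.
Qed.
Lemma fo_u3 (P : forall W, (W -> W -> Prop) -> W -> W -> W -> Prop) t u v :
  (forall i j k, ufo (fun W m e => P W m (e i) (e j) (e k))) -> tm t -> tm u -> tm v ->
  fo (fun e => P V mem (t e) (u e) (v e)).
Proof.
  intros HP Ht Hu Hv; apply (@fo_sub (fun x e => P V mem x (u e) (v e))); [|exact Ht].
  apply (@fo_sub (fun y e => P V mem (e 0) y (v (fun n => e (S n))))); [|apply tm_shift, Hu].
  apply (@fo_sub (fun z e => P V mem (e 1) (e 0) z)); [|exact (tm_shift (tm_shift Hv))].
  apply (@fo_of_ufo (fun W m e => P W m (e 2) (e 1) (e 0))), HP.
Qed.

Lemma tm_spec (R : V -> (nat -> V) -> Prop) t :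
  (forall y e, y = t e <-> R y e) ->
  fo (fun e => R (e 0) (fun n => e (S n))) -> tm t.
Proof. intros H HR; eapply fo_iff; [|exact HR]; intros e; symmetry; apply H. Qed.

Lemma tm_comp1 (f : V -> V) t : tm (fun e => f (e 0)) -> tm t -> tm (fun e => f (t e)).
Proof.
  intros Hf Ht; apply (@fo_sub (fun x e => e 0 = f x)); [|apply tm_shift, Ht].
  apply (@fo_sub (fun x e => e 1 = x)); [|exact Hf].
  apply (@fo_of_ufo (fun W m e => e 2 = e 0)), ufo_eq.
Qed.
Lemma tm_comp2 (f : V -> V -> V) t u :
  tm (fun e => f (e 0) (e 1)) -> tm t -> tm u -> tm (fun e => f (t e) (u e)).
Proof.
  intros Hf Ht Hu.
  apply (@fo_sub (fun y e => e 0 = f (t (fun n => e (S n))) y)); [|apply tm_shift, Hu].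
  apply (@fo_sub (fun x e => e 1 = f x (e 0))); [|exact (tm_shift (tm_shift Ht))].
  apply (@fo_sub (fun x e => e 2 = x)); [|exact Hf].
  apply (@fo_of_ufo (fun W m e => e 3 = e 0)), ufo_eq.
Qed.

End Params.

Create HintDb tm discriminated.

Ltac tm_tac := cbv beta;
  lazymatch goal with
  | |- tm (fun e => e ?i) => exact (tm_var i)
  | |- tm (fun _ => ?c) => exact (tm_const c)
  | |- _ => match goal with
    | |- @tm ?V ?m (fun e => ?f (@?t e)) =>
        apply (@tm_comp1 V m _ f t); [solve [auto 1 with tm nocore]|tm_tac]
    | |- @tm ?V ?m (fun e => ?f (@?t e) (@?u e)) =>
        apply (@tm_comp2 V m _ f t u); [solve [auto 1 with tm nocore]|tm_tac|tm_tac]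
    end
  end.
(** Notions that take the type and the membership relation as arguments are passed to [ufo_tac];
    operations and predicates of the fixed model are looked up in the hint base [tm]. *)
Ltac fo_tac := cbv beta;
  lazymatch goal with
  | |- fo (fun _ => ?P) => exact (fo_closed P)
  | |- tm _ => tm_tac
  | |- fo (fun e => @?t e = @?u e) => apply (@fo_eq _ _ _ t u); fo_tac
  | |- fo (fun e => ~ @?P e) => apply (@fo_not _ _ P); fo_tac
  | |- fo (fun e => @?P e /\ @?Q e) => apply (@fo_and _ _ P Q); fo_tac
  | |- fo (fun e => @?P e \/ @?Q e) => apply (@fo_or _ _ P Q); fo_tac
  | |- fo (fun e => @?P e <-> @?Q e) => apply (@fo_bi _ _ P Q); fo_tac
  | |- fo (fun e => exists x, @?P e x) =>
      apply (@fo_ex _ _ (fun x e => P e x)); fo_tac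
  | |- fo (fun e => @?P e -> @?Q e) => apply (@fo_imp _ _ P Q); fo_tac
  | |- fo (fun e => forall x, @?P e x) =>
      apply (@fo_all _ _ (fun x e => P e x)); fo_tac
  | |- @fo ?V ?m (fun e => ?m (@?t e) (@?u e)) => apply (@fo_mem V m _ t u); fo_tac
  | |- @fo ?V ?m (fun e => is_num ?m ?n (@?t e)) =>
      apply (@fo_u1 V m _ (fun W m' x => is_num m' n x) t); [|fo_tac];
      intros; ufo_tac
  | |- @fo ?V ?m (fun e => is_fml ?m None (@?t e)) =>
      apply (@fo_u1 V m _ (fun W m' x => is_fml m' None x) t); [|fo_tac];
      intros; ufo_tac
  | |- @fo ?V ?m (fun e => sat ?m (@?t e) None (@?u e) (@?v e)) =>
      apply (@fo_u3 V m _ (fun W m' x y z => sat m' x None y z) t u v);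
      [|fo_tac|fo_tac|fo_tac]; intros; ufo_tac
  | |- @fo ?V ?m (fun e => elem_sub ?m (@?t e) None (@?u e) None) =>
      apply (@fo_u2 V m _ (fun W m' x y => elem_sub m' x None y None) t u);
      [|fo_tac|fo_tac]; intros; ufo_tac
  | |- @fo ?V ?m (fun e => ?P ?V ?m (@?t e) (@?u e) (@?v e)) =>
      apply (@fo_u3 V m _ P t u v); [|fo_tac|fo_tac|fo_tac]; intros; ufo_tac
  | |- @fo ?V ?m (fun e => ?P ?V ?m (@?t e) (@?u e)) =>
      apply (@fo_u2 V m _ P t u); [|fo_tac|fo_tac]; intros; ufo_tac
  | |- @fo ?V ?m (fun e => ?P ?V ?m (@?t e)) =>
      apply (@fo_u1 V m _ P t); [|fo_tac]; intros; ufo_tac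
  | |- _ => match goal with
    | |- @fo ?V ?m (fun e => ?P (@?t e)) =>
        apply (@fo_app1 V m P t); [solve [auto 1 with tm nocore]|fo_tac]
    | |- @fo ?V ?m (fun e => ?P (@?t e) (@?u e)) =>
        apply (@fo_app2 V m P t u); [solve [auto 1 with tm nocore]|fo_tac|fo_tac]
    | |- @fo ?V ?m (fun e => ?P (@?t e) (@?u e) (@?v e)) =>
        apply (@fo_app3 V m P t u v); [solve [auto 1 with tm nocore]|fo_tac|fo_tac|fo_tac]
    end
  end.

(** * Uniform definability of the set-theoretic notions *)

Lemma ufo_sub i j : ufo (fun W m e => sub m (e i) (e j)).
Proof. unfold sub; ufo_tac. Qed.
Lemma ufo_is_empty i : ufo (fun W m e => is_empty m (e i)).
Proof. unfold is_empty; ufo_tac. Qed.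
Lemma ufo_is_upair i j k : ufo (fun W m e => is_upair m (e i) (e j) (e k)).
Proof. unfold is_upair; ufo_tac. Qed.
Lemma ufo_is_succ i j : ufo (fun W m e => is_succ m (e i) (e j)).
Proof. unfold is_succ; ufo_tac. Qed.
Lemma ufo_ole i j : ufo (fun W m e => ole m (e i) (e j)).
Proof. unfold ole; ufo_tac. Qed.
#[local] Hint Resolve ufo_sub ufo_is_empty ufo_is_upair ufo_is_succ ufo_ole : ufo.
Lemma ufo_is_pow i j : ufo (fun W m e => is_pow m (e i) (e j)).
Proof. unfold is_pow; ufo_tac. Qed.
Lemma ufo_is_pair i j k : ufo (fun W m e => is_pair m (e i) (e j) (e k)).
Proof. unfold is_pair; ufo_tac. Qed.
Lemma ufo_transitive i : ufo (fun W m e => transitive m (e i)).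
Proof. unfold transitive; ufo_tac. Qed.
#[local] Hint Resolve ufo_is_pow ufo_is_pair ufo_transitive : ufo.
Lemma ufo_gr i j k : ufo (fun W m e => gr m (e i) (e j) (e k)).
Proof. unfold gr; ufo_tac. Qed.
Lemma ufo_ord i : ufo (fun W m e => ord m (e i)).
Proof. unfold ord; ufo_tac. Qed.
Lemma ufo_is_num n i : ufo (fun W m e => is_num m n (e i)).
Proof. revert i; induction n as [|n IH]; intros i; cbn [is_num];
  [ufo_tac|apply ufo_ex, ufo_and; [apply IH|ufo_tac]]. Qed.
#[local] Hint Resolve ufo_gr ufo_ord ufo_is_num : ufo.
Lemma ufo_is_pfun i j k : ufo (fun W m e => is_pfun m (e i) (e j) (e k)).
Proof. unfold is_pfun; ufo_tac. Qed.
Lemma ufo_limit i : ufo (fun W m e => limit m (e i)).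
Proof. unfold limit; ufo_tac. Qed.
Lemma ufo_is_Vlevel i j : ufo (fun W m e => is_Vlevel m (e i) (e j)).
Proof. unfold is_Vlevel; ufo_tac. Qed.
Lemma ufo_is_scons i j k : ufo (fun W m e => is_scons m (e i) (e j) (e k)).
Proof. unfold is_scons; ufo_tac. Qed.
Lemma ufo_code1 n i j : ufo (fun W m e => code1 m n (e i) (e j)).
Proof. unfold code1; ufo_tac. Qed.
#[local] Hint Resolve ufo_is_pfun ufo_limit ufo_is_Vlevel ufo_is_scons ufo_code1 : ufo.
Lemma ufo_is_fun i j k : ufo (fun W m e => is_fun m (e i) (e j) (e k)).
Proof. unfold is_fun; ufo_tac. Qed.
Lemma ufo_is_omega i : ufo (fun W m e => is_omega m (e i)).
Proof. unfold is_omega; ufo_tac. Qed.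
Lemma ufo_code2 n i j k : ufo (fun W m e => code2 m n (e i) (e j) (e k)).
Proof. unfold code2; ufo_tac. Qed.
#[local] Hint Resolve ufo_is_fun ufo_is_omega ufo_code2 : ufo.
Lemma ufo_is_inj i j k : ufo (fun W m e => is_inj m (e i) (e j) (e k)).
Proof. unfold is_inj; ufo_tac. Qed.
Lemma ufo_is_nat i : ufo (fun W m e => is_nat m (e i)).
Proof. unfold is_nat; ufo_tac. Qed.
Lemma ufo_assign i j : ufo (fun W m e => assign m (e i) (e j)).
Proof. unfold assign; ufo_tac. Qed.
Lemma ufo_regular i : ufo (fun W m e => regular m (e i)).
Proof. unfold regular; ufo_tac. Qed.
Lemma ufo_is_cMem i j k : ufo (fun W m e => is_cMem m (e i) (e j) (e k)).
Proof. unfold is_cMem; ufo_tac. Qed.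
Lemma ufo_is_cEq i j k : ufo (fun W m e => is_cEq m (e i) (e j) (e k)).
Proof. unfold is_cEq; ufo_tac. Qed.
Lemma ufo_is_cFun i j k : ufo (fun W m e => is_cFun m (e i) (e j) (e k)).
Proof. unfold is_cFun; ufo_tac. Qed.
Lemma ufo_is_cNeg i j : ufo (fun W m e => is_cNeg m (e i) (e j)).
Proof. unfold is_cNeg; ufo_tac. Qed.
Lemma ufo_is_cAnd i j k : ufo (fun W m e => is_cAnd m (e i) (e j) (e k)).
Proof. unfold is_cAnd; ufo_tac. Qed.
Lemma ufo_is_cEx i j : ufo (fun W m e => is_cEx m (e i) (e j)).
Proof. unfold is_cEx; ufo_tac. Qed.
#[local] Hint Resolve ufo_is_inj ufo_is_nat ufo_assign ufo_regular ufo_is_cMem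
  ufo_is_cEq ufo_is_cFun ufo_is_cNeg ufo_is_cAnd ufo_is_cEx : ufo.
Lemma ufo_injects i j : ufo (fun W m e => injects m (e i) (e j)).
Proof. unfold injects; ufo_tac. Qed.
Lemma ufo_is_fml i : ufo (fun W m e => is_fml m None (e i)).
Proof. unfold is_fml, fml_closed; ufo_tac. Qed.
#[local] Hint Resolve ufo_injects ufo_is_fml : ufo.
Lemma ufo_card_lt i j : ufo (fun W m e => card_lt m (e i) (e j)).
Proof. unfold card_lt; ufo_tac. Qed.
Lemma ufo_is_truth i j : ufo (fun W m e => is_truth m (e i) None (e j)).
Proof. unfold is_truth; ufo_tac. Qed.
#[local] Hint Resolve ufo_card_lt ufo_is_truth : ufo.
Lemma ufo_cardinal i : ufo (fun W m e => cardinal m (e i)).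
Proof. unfold cardinal; ufo_tac. Qed.
Lemma ufo_strong_limit i : ufo (fun W m e => strong_limit m (e i)).
Proof. unfold strong_limit; ufo_tac. Qed.
Lemma ufo_sat i j k : ufo (fun W m e => sat m (e i) None (e j) (e k)).
Proof. unfold sat; ufo_tac. Qed.
#[local] Hint Resolve ufo_cardinal ufo_strong_limit ufo_sat : ufo.
Lemma ufo_inaccessible i : ufo (fun W m e => inaccessible m (e i)).
Proof. unfold inaccessible; ufo_tac. Qed.
Lemma ufo_elem_sub i j : ufo (fun W m e => elem_sub m (e i) None (e j) None).
Proof. unfold elem_sub; ufo_tac. Qed.
#[local] Hint Resolve ufo_inaccessible ufo_elem_sub : ufo.

(** * The definition of the Laver function *)

Section LaverFormula.

Context {W : Type} (m : W -> W -> Prop).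

Definition inC (d g : W) : Prop :=
  inaccessible m g /\ m d g /\ exists vd vg,
    is_Vlevel m vd d /\ is_Vlevel m vg g /\ elem_sub m vd None vg None.
Definition inC0 (d g : W) : Prop :=
  inC d g /\ exists b, m b g /\ forall g', m g' g -> inC d g' -> m g' b.

(* The closure of the ordinals under pairing. *)
Definition is_cod (c : W) : Prop :=
  exists t, m c t /\ forall y, m y t ->
    ord m y \/ exists y1 y2, m y1 t /\ m y2 t /\ is_pair m y y1 y2.

(* Codes are compared by rank, then ordinals precede pairs, then pairs are
   compared lexicographically. *)
Definition rank_lt (x y : W) : Prop :=
  exists v a, is_Vlevel m v a /\ m x v /\ ~ m y v.
(** One unfolding of the recursion for the order, with A standing for the order on components. *)
Definition lt_clause (A x y : W) : Prop :=
  rank_lt x y \/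
  (~ rank_lt y x /\
   ((ord m x /\ ~ ord m y) \/
    exists x1 x2 y1 y2, is_pair m x x1 x2 /\ is_pair m y y1 y2 /\
      (gr m A x1 y1 \/ (x1 = y1 /\ gr m A x2 y2)))).
(** The clause consults A only at components, which have smaller rank, so this fixed-point equation
    determines A on v when v is a level. The order on all codes is then the union of its
    restrictions to levels. *)
Definition good_order (A v : W) : Prop :=
  forall x y, m x v -> m y v -> (gr m A x y <-> lt_clause A x y).
Definition cod_lt (x y : W) : Prop :=
  exists A v a, is_Vlevel m v a /\ m x v /\ m y v /\ good_order A v /\ gr m A x y.

Definition unused (f g c : W) : Prop := ~ exists g', m g' g /\ gr m f g' c.
Definition pick (f g c : W) : Prop :=
  exists v, is_Vlevel m v g /\ m c v /\ is_cod c /\ unused f g c /\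
    forall c', m c' v -> is_cod c' -> unused f g c' -> c' = c \/ cod_lt c c'.
(** Here g and c range over the whole structure, so f has to be the entire enumeration as a single
    set. This is possible in V_g when the stages below g are bounded in g. *)
Definition greedy (d f : W) : Prop :=
  forall g c, gr m f g c <-> inC0 d g /\ pick f g c.
Definition next_code (f c : W) : Prop :=
  is_cod c /\ ~ (exists g, gr m f g c) /\
  forall c', is_cod c' -> ~ (exists g, gr m f g c') -> c' = c \/ cod_lt c c'.

(* c = (s(0), (s(1), ... (s(n-1), 0))), where s vanishes from n on; g lists
   the tails of c. *)
Definition is_tails (s c g n : W) : Prop :=
  is_nat m n /\
    (forall i x x', gr m g i x -> gr m g i x' -> x = x') /\
    (forall z, is_empty m z -> gr m g z c) /\
    (forall i, m i n -> exists j y z q,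
       is_succ m j i /\ gr m s i y /\ gr m g j z /\ is_pair m q y z /\ gr m g i q) /\
    (forall z, is_empty m z -> gr m g n z) /\
    (forall i b, gr m s i b -> ~ m i n -> is_empty m b).
Definition list_of (s c : W) : Prop := exists g n, is_tails s c g n.

(* x is the set defined in V_a by the formula p from the ordinals listed by l,
   where c = ((a, (p, l)), eta); the ordinal eta only makes x have a proper
   class of codes. *)
Definition decode (c x : W) : Prop :=
  exists a p l eta q r v s, is_pair m q p l /\ is_pair m r a q /\ is_pair m c r eta /\
    list_of s l /\ is_Vlevel m v a /\ m x v /\ is_fml m None p /\
    (exists w, is_omega m w /\ is_fun m s w a) /\
    forall u t, m u v -> assign m v t -> is_scons m t u s ->
      (sat m v None p t <-> u = x).

Context (Q : W -> Prop).
Definition guess (d x : W) : Prop :=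
  exists f c, greedy d f /\ next_code f c /\ decode c x /\ Q x.
(** The default value makes the function total on the ordinals; the empty set is admissible both for
    ordinal values and for values in H_k. *)
Definition laver (d x : W) : Prop :=
  ord m d /\ (guess d x \/ (~ (exists y, guess d y) /\ is_empty m x)).

End LaverFormula.

Lemma ufo_inC i j : ufo (fun W m e => inC m (e i) (e j)).
Proof. unfold inC; ufo_tac. Qed.
#[local] Hint Resolve ufo_inC : ufo.
Lemma ufo_inC0 i j : ufo (fun W m e => inC0 m (e i) (e j)).
Proof. unfold inC0; ufo_tac. Qed.
Lemma ufo_is_cod i : ufo (fun W m e => is_cod m (e i)).
Proof. unfold is_cod; ufo_tac. Qed.
Lemma ufo_lt_clause i j k : ufo (fun W m e => lt_clause m (e i) (e j) (e k)).
Proof. unfold lt_clause, rank_lt; ufo_tac. Qed.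
#[local] Hint Resolve ufo_inC0 ufo_is_cod ufo_lt_clause : ufo.
Lemma ufo_good_order i j : ufo (fun W m e => good_order m (e i) (e j)).
Proof. unfold good_order; ufo_tac. Qed.
#[local] Hint Resolve ufo_good_order : ufo.
Lemma ufo_cod_lt i j : ufo (fun W m e => cod_lt m (e i) (e j)).
Proof. unfold cod_lt; ufo_tac. Qed.
#[local] Hint Resolve ufo_cod_lt : ufo.
Lemma ufo_pick i j k : ufo (fun W m e => pick m (e i) (e j) (e k)).
Proof. unfold pick, unused; ufo_tac. Qed.
#[local] Hint Resolve ufo_pick : ufo.
Lemma ufo_decode i j : ufo (fun W m e => decode m (e i) (e j)).
Proof. unfold decode, list_of, is_tails; ufo_tac. Qed.
#[local] Hint Resolve ufo_decode : ufo.
Lemma ufo_guess (Q : forall W, (W -> W -> Prop) -> W -> Prop) :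
  (forall i, ufo (fun W m e => Q W m (e i))) ->
  forall i j, ufo (fun W m e => guess m (Q W m) (e i) (e j)).
Proof. intros HQ i j; unfold guess, greedy, next_code; ufo_tac. Qed.
(** The resulting formula is the same for all structures, so it defines both l in V_k and l' in V_g,
    as [elem_sub_expand] requires. *)
Lemma ufo_laver (Q : forall W, (W -> W -> Prop) -> W -> Prop) :
  (forall i, ufo (fun W m e => Q W m (e i))) ->
  forall i j, ufo (fun W m e => laver m (Q W m) (e i) (e j)).
Proof. intros HQ i j; assert (H := ufo_guess HQ); unfold laver; ufo_tac. Qed.

(** * Basic set theory *)

Section SetTheoryBasics.

Context {V : Type} {mem : V -> V -> Prop} {hZFC : ZFC mem}.
Local Notation "x ∈ y" := (mem x y) (at level 70, no associativity).
Local Notation fo := (@fo V mem).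
Local Notation tm := (@tm V mem).

Lemma inhabited_model : inhabited V.
Proof. destruct (zfc_inf hZFC) as [w _]; exact (inhabits w). Qed.

(** Hilbert's epsilon names sets that the axioms only assert to exist. Definability of an operation
    introduced in this way is always proved from its specification, never from the epsilon. *)
Definition the (P : V -> Prop) : V := epsilon inhabited_model P.
Lemma the_spec (P : V -> Prop) : (exists x, P x) -> P (the P).
Proof. apply epsilon_spec. Qed.

Lemma ext x y : (forall z, z ∈ x <-> z ∈ y) -> x = y.
Proof. apply (zfc_ext hZFC). Qed.

Definition cmp (a : V) (P : V -> Prop) : V :=
  the (fun b => forall x, x ∈ b <-> x ∈ a /\ P x).
Lemma cmp_iff a P : fo (fun e => P (e 0)) ->
  forall x, x ∈ cmp a P <-> x ∈ a /\ P x.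
Proof.
  intros [p [c Hp]]; unfold cmp; apply the_spec.
  (* Separation evaluates at [scons x c]: all free variables collapse to x, and parameter number k
     becomes variable k + 1. *)
  set (r := fun i => if Nat.even i then O else S (Nat.div2 i)).
  destruct (zfc_sep hZFC (ren r p) c a) as [b Hb].
  exists b; intros x; rewrite Hb, fsat_ren, <- (Hp (fun _ => x)).
  rewrite (fsat_ext mem p (e' := mix (fun _ => x) c)); [tauto|].
  intros i; unfold r, mix; destruct (Nat.even i); reflexivity.
Qed.

Lemma replacement (Q : V -> V -> Prop) a :
  fo (fun e => Q (e 0) (e 1)) ->
  (forall x y y', x ∈ a -> Q x y -> Q x y' -> y = y') ->
  exists b, forall y, y ∈ b <-> exists x, x ∈ a /\ Q x y.
Proof.
  intros [p [c Hp]] HQ.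
  (* Replacement evaluates at [scons x (scons y c)]: the argument is variable 0, the value variable
     1, and parameter number k becomes variable k + 2. *)
  set (r := fun i => if Nat.even i then
    match Nat.div2 i with O => O | S _ => 1 end else S (S (Nat.div2 i))).
  assert (H : forall x y, fsat mem (scons x (scons y c)) (ren r p) <-> Q x y).
  { intros x y; rewrite fsat_ren.
    rewrite <- (Hp (fun i => match i with O => x | S _ => y end)); apply fsat_ext.
    intros i; unfold r, mix; destruct (Nat.even i); [destruct (Nat.div2 i)|]; reflexivity. }
  destruct (zfc_repl hZFC (p := ren r p) (e := c) (a := a)) as [b Hb].
  - intros x y y'; rewrite !H; apply HQ.
  - exists b; intros y; rewrite Hb; split; intros [x [Hx Hxy]]; exists x; split; auto;
      apply H; auto.
Qed.

Definition img (a : V) (F : V -> V) : V :=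
  the (fun b => forall y, y ∈ b <-> exists x, x ∈ a /\ y = F x).
Lemma img_iff a F : tm (fun e => F (e 0)) ->
  forall y, y ∈ img a F <-> exists x, x ∈ a /\ y = F x.
Proof.
  intros HF; unfold img; apply the_spec, replacement.
  - apply (@fo_sub _ _ (fun z e => e 1 = z)); [|exact HF].
    apply (@fo_of_ufo _ _ _ (fun W m e => e 2 = e 0)), ufo_eq.
  - intros x y y' _ -> ->; reflexivity.
Qed.

Definition emp : V := the (is_empty mem).
Lemma emp_spec : is_empty mem emp.
Proof.
  unfold emp; apply the_spec; destruct (zfc_inf hZFC) as [w [[z [Hz _]] _]]; eauto.
Qed.
Lemma mem_emp x : ~ x ∈ emp.
Proof. apply emp_spec. Qed.
Lemma is_empty_iff x : is_empty mem x <-> x = emp.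
Proof.
  split; [|intros ->; apply emp_spec].
  intros H; apply ext; intros z; split; intros Hz;
    [destruct (H z Hz)|destruct (mem_emp Hz)].
Qed.

Definition up (x y : V) : V := the (fun p => is_upair mem p x y).
Lemma mem_up x y z : z ∈ up x y <-> z = x \/ z = y.
Proof. unfold up; revert z; apply (the_spec (P := fun p => is_upair mem p x y)), (zfc_pair hZFC). Qed.
Lemma is_upair_iff p x y : is_upair mem p x y <-> p = up x y.
Proof.
  split; [|intros ->; intros z; apply mem_up].
  intros H; apply ext; intros z; rewrite mem_up; apply H.
Qed.

Definition un (x : V) : V := the (fun u => forall z, z ∈ u <-> exists y, y ∈ x /\ z ∈ y).
Lemma mem_un x z : z ∈ un x <-> exists y, y ∈ x /\ z ∈ y.
Proof. revert z; apply (the_spec (P := fun u => forall z, z ∈ u <-> _)), (zfc_union hZFC). Qed.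

Definition pw (x : V) : V := the (fun p => is_pow mem p x).
Lemma mem_pw x z : z ∈ pw x <-> sub mem z x.
Proof. revert z; apply (the_spec (P := fun p => is_pow mem p x)), (zfc_pow hZFC). Qed.
Lemma is_pow_iff p x : is_pow mem p x <-> p = pw x.
Proof.
  split; [|intros ->; intros z; apply mem_pw].
  intros H; apply ext; intros z; rewrite mem_pw; apply H.
Qed.

Definition cup (x y : V) : V := un (up x y).
Lemma mem_cup x y z : z ∈ cup x y <-> z ∈ x \/ z ∈ y.
Proof.
  unfold cup; rewrite mem_un; split.
  - intros [u [Hu Hz]]; apply mem_up in Hu; destruct Hu; subst; auto.
  - intros [H|H]; [exists x|exists y]; rewrite mem_up; auto.
Qed.

Definition sc (x : V) : V := cup x (up x x).
Lemma mem_sc x z : z ∈ sc x <-> z ∈ x \/ z = x.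
Proof. unfold sc; rewrite mem_cup, mem_up; tauto. Qed.
Lemma is_succ_iff y x : is_succ mem y x <-> y = sc x.
Proof.
  split; [|intros ->; intros z; apply mem_sc].
  intros H; apply ext; intros z; rewrite mem_sc; apply H.
Qed.

Definition pr (x y : V) : V := up (up x x) (up x y).
Lemma is_pair_iff p x y : is_pair mem p x y <-> p = pr x y.
Proof.
  split.
  - intros [a [b [Ha [Hb Hp]]]]; rewrite is_upair_iff in *; subst; reflexivity.
  - intros ->; exists (up x x), (up x y); rewrite !is_upair_iff; auto.
Qed.
Lemma gr_iff r x y : gr mem r x y <-> pr x y ∈ r.
Proof.
  unfold gr; split; [intros [p [Hp Hr]]; apply is_pair_iff in Hp; subst; auto|].
  intros H; exists (pr x y); rewrite is_pair_iff; auto.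
Qed.
Lemma up_inj x y z : up x y = up x z -> y = z.
Proof.
  intros E.
  assert (Hy : y ∈ up x z) by (rewrite <- E, mem_up; auto).
  assert (Hz : z ∈ up x y) by (rewrite E, mem_up; auto).
  rewrite mem_up in *; destruct Hy, Hz; congruence.
Qed.
Lemma pr_inj x y x' y' : pr x y = pr x' y' -> x = x' /\ y = y'.
Proof.
  unfold pr; intros E.
  assert (x = x').
  { assert (H : up x x ∈ up (up x' x') (up x' y')) by (rewrite <- E, mem_up; auto).
    assert (Hx : x' ∈ up x x)
      by (apply mem_up in H; destruct H as [-> | ->]; apply mem_up; auto).
    apply mem_up in Hx; destruct Hx; auto. }
  subst x'; split; [reflexivity|].
  apply up_inj in E; apply up_inj in E; exact E.
Qed.
Lemma up_l x y : x ∈ up x y.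
Proof. apply mem_up; auto. Qed.
Lemma up_r x y : y ∈ up x y.
Proof. apply mem_up; auto. Qed.
Lemma pr_not_emp x y : pr x y <> emp.
Proof. intros E; apply (@mem_emp (up x x)); rewrite <- E; apply up_l. Qed.
Lemma emp_not_in_pr x y : ~ emp ∈ pr x y.
Proof.
  intros H; apply mem_up in H; destruct H as [H|H]; apply (@mem_emp x); rewrite H;
    apply up_l.
Qed.

(** By extensionality a set is defined by a definition of its elements. Variable 0 is the element
    and variable 1 the set itself, over which R skips; hence the two successors. *)
Lemma tm_by_elements (t : (nat -> V) -> V) (R : V -> (nat -> V) -> Prop) :
  (forall z e, z ∈ t e <-> R z e) ->
  fo (fun e => R (e 0) (fun n => e (S (S n)))) -> tm t.
Proof.
  intros H HR; apply (@tm_spec _ _ (fun y e => forall z, z ∈ y <-> R z e)).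
  - intros y e; split; [intros ->; intros z; apply H|].
    intros E; apply ext; intros z; rewrite E; symmetry; apply H.
  - apply (@fo_all _ _ (fun z e => z ∈ e 0 <-> R z (fun n => e (S n)))), fo_bi; [|exact HR].
    apply (@fo_of_ufo _ _ _ (fun W m e => m (e 0) (e 1))), ufo_mem.
Qed.

Lemma tm_up : tm (fun e => up (e 0) (e 1)).
Proof.
  apply (@tm_by_elements _ (fun z e => z = e 0 \/ z = e 1)); [intros; apply mem_up|fo_tac].
Qed.
Lemma tm_un : tm (fun e => un (e 0)).
Proof.
  apply (@tm_by_elements _ (fun z e => exists y, y ∈ e 0 /\ z ∈ y)); [intros; apply mem_un|fo_tac].
Qed.
Lemma tm_pw : tm (fun e => pw (e 0)).
Proof.
  apply (@tm_by_elements _ (fun z e => sub mem z (e 0))); [intros; apply mem_pw|fo_tac].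
Qed.
#[local] Hint Resolve tm_up tm_un tm_pw : tm.
Lemma tm_cup : tm (fun e => cup (e 0) (e 1)).
Proof. unfold cup; fo_tac. Qed.
#[local] Hint Resolve tm_cup : tm.
Lemma tm_sc : tm (fun e => sc (e 0)).
Proof. unfold sc; fo_tac. Qed.
Lemma tm_pr : tm (fun e => pr (e 0) (e 1)).
Proof. unfold pr; fo_tac. Qed.
#[local] Hint Resolve tm_sc tm_pr : tm.

Lemma found P x : fo (fun e => P (e 0)) -> (exists y, y ∈ x /\ P y) ->
  exists y, y ∈ x /\ P y /\ forall z, z ∈ x -> P z -> ~ z ∈ y.
Proof.
  intros HP [y [Hy Py]].
  destruct (zfc_found hZFC (x := cmp x P)) as [z [Hz Hmin]].
  - exists y; apply (cmp_iff x HP); auto.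
  - apply (cmp_iff x HP) in Hz; destruct Hz as [Hz Pz].
    exists z; repeat split; auto; intros u Hu Pu; apply Hmin, (cmp_iff x HP); auto.
Qed.

Lemma mem_irrefl x : ~ x ∈ x.
Proof.
  intros H; destruct (zfc_found hZFC (x := up x x)) as [y [Hy N]].
  - exists x; apply up_l.
  - apply mem_up in Hy; assert (y = x) by tauto; subst; apply (N x); [apply up_l|exact H].
Qed.
Lemma mem_asym x y : x ∈ y -> ~ y ∈ x.
Proof.
  intros H H'; destruct (zfc_found hZFC (x := up x y)) as [z [Hz N]].
  - exists x; apply up_l.
  - apply mem_up in Hz; destruct Hz; subst; [apply (N y)|apply (N x)]; auto using up_l, up_r.
Qed.

(** * Ordinals *)

Lemma ord_mem a b : ord mem a -> b ∈ a -> ord mem b.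
Proof.
  intros [Ta Ha] Hb; split; [auto|]; intros y Hy; apply Ha; apply (Ta b); auto.
Qed.
Lemma ord_trans a b c : ord mem c -> a ∈ b -> b ∈ c -> a ∈ c.
Proof. intros [Tc _] H1 H2; exact (Tc b H2 a H1). Qed.

Lemma ord_trich a b : ord mem a -> ord mem b -> a ∈ b \/ a = b \/ b ∈ a.
Proof.
  intros Ha Hb; apply NNPP; intros N.
  set (inc := fun x y => ord mem y /\ ~ x ∈ y /\ x <> y /\ ~ y ∈ x).
  (* Let a0 be minimal among those incomparable with some ordinal, and b0 minimal among those
     incomparable with a0; then a0 and b0 have the same elements, a contradiction. *)
  destruct (@found (fun x => exists y, inc x y) (sc a)) as [a0 [Ha0 [[b1 Hb1] Hmin]]].
  { unfold inc; fo_tac. }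
  { exists a; split; [apply mem_sc; auto|]; exists b; unfold inc; tauto. }
  destruct (@found (fun y => inc a0 y) (sc b1)) as [b0 [Hb0 [Hinc Hmin']]].
  { unfold inc; fo_tac. }
  { exists b1; split; [apply mem_sc; auto|exact Hb1]. }
  assert (Oa : ord mem a0) by (apply mem_sc in Ha0; destruct Ha0; subst; eauto using ord_mem).
  destruct Hinc as [Ob [N1 [N2 N3]]]; apply N2, ext; intros z; split; intros Hz.
  - assert (Hz' : z ∈ sc a).
    { apply mem_sc; apply mem_sc in Ha0; left; destruct Ha0; subst; eauto using ord_trans. }
    apply NNPP; intros Nz; apply (Hmin z Hz'); [|exact Hz].
    exists b0; split; [exact Ob|]; split; [exact Nz|]; split; intros E; [subst; auto|].
    apply N3; eapply ord_trans; eauto.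
  - assert (Hz' : z ∈ sc b1).
    { apply mem_sc; apply mem_sc in Hb0; left; destruct Hb0; subst;
        [eapply ord_trans; [apply Hb1| |]; eauto|auto]. }
    apply NNPP; intros Nz; apply (Hmin' z Hz'); [|exact Hz].
    split; [exact (ord_mem Ob Hz)|]; split; [|split; [|exact Nz]]; intros E; [|subst; auto].
    apply N1; eapply ord_trans; eauto.
Qed.

Lemma ord_least P a : fo (fun e => P (e 0)) -> ord mem a -> P a ->
  exists b, ord mem b /\ ole mem b a /\ P b /\ forall c, c ∈ b -> ~ P c.
Proof.
  intros HP Ha Pa.
  destruct (@found P (sc a) HP) as [b [Hb [Pb Hmin]]].
  - exists a; split; [apply mem_sc|]; auto.
  - assert (Ob : ord mem b) by (apply mem_sc in Hb; destruct Hb; subst; eauto using ord_mem).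
    exists b; split; [exact Ob|]; split; [apply mem_sc, Hb|]; split; [exact Pb|].
    intros c Hc Pc; apply (Hmin c); auto.
    apply mem_sc; left; apply mem_sc in Hb; destruct Hb; subst; eauto using ord_trans.
Qed.

Lemma ord_ind (P : V -> Prop) : fo (fun e => P (e 0)) ->
  (forall a, ord mem a -> (forall b, b ∈ a -> P b) -> P a) ->
  forall a, ord mem a -> P a.
Proof.
  intros HP IH a Ha; apply NNPP; intros N.
  destruct (@ord_least (fun x => ~ P x) a) as [b [Ob [_ [Nb Hmin]]]]; auto.
  - apply fo_not, HP.
  - apply Nb, IH; auto; intros c Hc; apply NNPP; exact (Hmin c Hc).
Qed.

Lemma ord_emp : ord mem emp.
Proof. split; intros y Hy; destruct (mem_emp Hy). Qed.
Lemma ord_sc a : ord mem a -> ord mem (sc a).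
Proof.
  intros Ha; split.
  - intros y Hy z Hz; apply mem_sc; apply mem_sc in Hy; left; destruct Hy; subst;
      eauto using ord_trans.
  - intros y Hy; apply mem_sc in Hy; destruct Hy as [H|H]; subst;
      [exact (proj1 (ord_mem Ha H))|exact (proj1 Ha)].
Qed.
Lemma ord_un a : (forall x, x ∈ a -> ord mem x) -> ord mem (un a).
Proof.
  intros H; split.
  - intros y Hy z Hz; apply mem_un in Hy; destruct Hy as [x [Hx Hy]].
    apply mem_un; exists x; split; auto; exact (ord_trans (H x Hx) Hz Hy).
  - intros y Hy; apply mem_un in Hy; destruct Hy as [x [Hx Hy]].
    exact (proj1 (ord_mem (H x Hx) Hy)).
Qed.
Lemma ord_sub a b : ord mem a -> ord mem b -> (sub mem a b <-> ole mem a b).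
Proof.
  intros Ha Hb; split.
  - intros H; destruct (ord_trich Ha Hb) as [E|[E|E]]; [left|right|]; auto.
    destruct (@mem_irrefl b); auto.
  - intros [H|H]; [|subst; intros z; auto]; intros z Hz; eapply ord_trans; eauto.
Qed.
Lemma ord_bound a : (forall x, x ∈ a -> ord mem x) ->
  exists b, ord mem b /\ forall x, x ∈ a -> x ∈ b.
Proof.
  intros H; exists (sc (un a)); split; [apply ord_sc, ord_un, H|].
  intros x Hx; apply mem_sc, (ord_sub (H x Hx) (ord_un H)).
  intros z Hz; apply mem_un; eauto.
Qed.
(** The Burali-Forti argument, applied to the set of ordinals in a. *)
Lemma ord_not_set a : exists b, ord mem b /\ ~ b ∈ a.
Proof.
  assert (HP : fo (fun e => ord mem (e 0))) by fo_tac.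
  destruct (@ord_bound (cmp a (ord mem))) as [b [Hb H]].
  - intros x Hx; apply (cmp_iff a HP) in Hx; tauto.
  - exists b; split; auto; intros Hba; apply (@mem_irrefl b), H, (cmp_iff a HP); auto.
Qed.
Lemma ord_mem_or_le a b : ord mem a -> ord mem b -> a ∈ b \/ ole mem b a.
Proof.
  intros Ha Hb; destruct (ord_trich Ha Hb) as [H|[H|H]]; [left|right; right|right; left]; auto.
Qed.
Lemma ole_mem_trans a b c : ord mem c -> ole mem a b -> b ∈ c -> a ∈ c.
Proof. intros Hc [H|H] H'; subst; eauto using ord_trans. Qed.
Lemma mem_ole_trans a b c : ord mem c -> a ∈ b -> ole mem b c -> a ∈ c.
Proof. intros Hc H [H'|H']; subst; eauto using ord_trans. Qed.

Lemma limit_sc a b : limit mem a -> b ∈ a -> sc b ∈ a.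
Proof.
  intros [Oa [_ La]] Hb; destruct (La b Hb) as [c [Hc Hbc]].
  apply ole_mem_trans with c; auto.
  apply ord_sub; eauto using ord_mem, ord_sc.
  intros z Hz; apply mem_sc in Hz; destruct Hz; subst; eauto using ord_trans, ord_mem.
Qed.
Lemma limit_emp a : limit mem a -> emp ∈ a.
Proof.
  intros [Oa [Na _]]; destruct (ord_mem_or_le ord_emp Oa) as [H|[H|H]]; auto.
  - destruct (mem_emp H).
  - destruct Na; subst; apply emp_spec.
Qed.

Lemma limit_exists : exists a, limit mem a.
Proof.
  destruct (zfc_inf hZFC) as [w [[z [Hz Hzw]] Hw]].
  assert (HP : fo (fun e => ord mem (e 0))) by fo_tac.
  (* The inductive set w need not be transitive or consist of ordinals; the union of the ordinals in
     it is a limit. *)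
  set (o := cmp w (ord mem)).
  assert (Ho : forall x, x ∈ o <-> x ∈ w /\ ord mem x) by (apply (cmp_iff w HP)).
  assert (Hs : forall x, x ∈ o -> sc x ∈ o).
  { intros x Hx; apply Ho in Hx; destruct Hx as [Hx Ox].
    destruct (Hw x Hx) as [y [Hy Hyw]]; apply is_succ_iff in Hy; subst.
    apply Ho; auto using ord_sc. }
  apply is_empty_iff in Hz; subst z.
  assert (He : emp ∈ o) by (apply Ho; auto using ord_emp).
  exists (un o); repeat split.
  - apply ord_un; intros x Hx; apply Ho, Hx.
  - intros y Hy; apply (ord_un (a := o)); auto; intros x Hx; apply Ho, Hx.
  - intros E; apply (E emp), mem_un; exists (sc emp); split; auto; apply mem_sc; auto.
  - intros y Hy; apply mem_un in Hy; destruct Hy as [x [Hx Hy]].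
    exists x; split; auto; apply mem_un; exists (sc x); split; auto; apply mem_sc; auto.
Qed.

(** * The natural numbers of the model *)

Definition om : V := the (is_omega mem).
Lemma om_spec : is_omega mem om.
Proof.
  unfold om; apply the_spec; destruct limit_exists as [a La].
  destruct (@ord_least (limit mem) a) as [b [_ [_ [Lb Hb]]]]; auto; [fo_tac|apply La|].
  exists b; split; auto.
Qed.
Lemma is_omega_iff w : is_omega mem w <-> w = om.
Proof.
  split; [|intros ->; apply om_spec].
  intros [Lw Nw]; destruct om_spec as [L N].
  destruct (ord_trich (proj1 Lw) (proj1 L)) as [H|[H|H]]; auto; [destruct (N w)|destruct (Nw om)]; auto.
Qed.
Lemma limit_om : limit mem om.
Proof. apply om_spec. Qed.
Lemma ord_om : ord mem om.
Proof. apply limit_om. Qed.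
Lemma is_nat_iff n : is_nat mem n <-> n ∈ om.
Proof.
  split; [intros [w [Hw H]]; apply is_omega_iff in Hw; subst; auto|].
  intros H; exists om; split; auto; apply om_spec.
Qed.
Lemma nat_cases n : n ∈ om -> n = emp \/ exists k, k ∈ om /\ n = sc k.
Proof.
  intros Hn; destruct (classic (n = emp)) as [|Ne]; auto; right.
  assert (On : ord mem n) by (apply (ord_mem ord_om Hn)).
  assert (exists k, k ∈ n /\ ~ exists z, z ∈ n /\ k ∈ z) as [k [Hk Nk]].
  { apply NNPP; intros N; destruct om_spec as [_ NL]; apply (NL n Hn).
    split; [exact On|]; split; [rewrite is_empty_iff; auto|].
    intros y Hy; apply NNPP; intros N'; apply N; eauto. }
  exists k; split; [exact (ord_trans ord_om Hk Hn)|].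
  apply ext; intros z; rewrite mem_sc; split.
  - intros Hz; destruct (ord_trich (ord_mem On Hz) (ord_mem On Hk)) as [H|[H|H]]; auto.
    destruct Nk; eauto.
  - intros [H|H]; subst; eauto using ord_trans.
Qed.
Lemma om_ind (P : V -> Prop) : fo (fun e => P (e 0)) ->
  P emp -> (forall n, n ∈ om -> P n -> P (sc n)) -> forall n, n ∈ om -> P n.
Proof.
  intros HP H0 HS n Hn.
  assert (HQ : fo (fun e => e 0 ∈ om -> P (e 0))) by (apply fo_imp; [fo_tac|exact HP]).
  refine (@ord_ind (fun n => n ∈ om -> P n) HQ _ n (ord_mem ord_om Hn) Hn).
  clear n Hn; intros n _ IH Hn; destruct (nat_cases Hn) as [->|[k [Hk ->]]]; auto.
  apply HS; auto; apply IH; auto; apply mem_sc; auto.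
Qed.
Lemma sc_inj x y : sc x = sc y -> x = y.
Proof.
  intros E; assert (Hx : x ∈ sc y) by (rewrite <- E, mem_sc; auto).
  assert (Hy : y ∈ sc x) by (rewrite E, mem_sc; auto).
  rewrite mem_sc in *; destruct Hx as [Hx|], Hy as [Hy|]; auto; destruct (mem_asym Hx Hy).
Qed.

Lemma sc_mem_iff i n : ord mem n -> (sc i ∈ sc n <-> i ∈ n).
Proof.
  intros On; split; intros H.
  - assert (Hi : i ∈ sc i) by (apply mem_sc; auto).
    apply mem_sc in H; destruct H as [H| <-]; auto; exact (ord_trans On Hi H).
  - assert (Oi := ord_mem On H); assert (Osi := ord_sc Oi).
    destruct (ord_mem_or_le Osi (ord_sc On)) as [E|E]; auto; exfalso.
    assert (Hn : n ∈ sc i).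
    { refine (mem_ole_trans Osi (b := sc n) _ E); apply mem_sc; auto. }
    apply mem_sc in Hn; destruct Hn as [Hn| ->]; [exact (mem_asym H Hn)|exact (mem_irrefl H)].
Qed.

(** * Recursion on the ordinals *)

Definition rs (f c : V) : V := cmp f (fun p => exists d y, d ∈ c /\ p = pr d y).
Definition isrec (G : V -> V -> V) (b f : V) : Prop :=
  forall p, p ∈ f <-> exists c, c ∈ b /\ p = pr c (G c (rs f c)).
(** The value off the ordinals is fixed as [emp], so that the function is total with a definable
    graph, as [tm] demands. *)
Definition recf (G : V -> V -> V) (b : V) : V :=
  the (fun f => (ord mem b /\ isrec G b f) \/ (~ ord mem b /\ f = emp)).
Definition rec (G : V -> V -> V) (b : V) : V := G b (recf G b).

Lemma mem_rs f c p : p ∈ rs f c <-> p ∈ f /\ exists d y, d ∈ c /\ p = pr d y.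
Proof. apply (@cmp_iff f (fun p => exists d y, d ∈ c /\ p = pr d y)); fo_tac. Qed.
Lemma tm_rs : tm (fun e => rs (e 0) (e 1)).
Proof.
  apply (@tm_by_elements _ (fun p e => p ∈ e 0 /\ exists d y, d ∈ e 1 /\ p = pr d y));
    [intros; apply mem_rs|fo_tac].
Qed.
#[local] Hint Resolve tm_rs : tm.

Section Recursion.

Context (G : V -> V -> V).
Context (HG : tm (fun e => G (e 0) (e 1))).

Lemma isrec_rs b f c : ord mem b -> isrec G b f -> c ∈ b -> isrec G c (rs f c).
Proof.
  intros Ob Hf Hc p; rewrite mem_rs, (Hf p).
  assert (E : forall d, d ∈ c -> rs (rs f c) d = rs f d).
  { intros d Hd; apply ext; intros q; rewrite !mem_rs; split; [tauto|].
    intros [Hq [x [y [Hx ->]]]]; repeat split; eauto.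
    exists x, y; split; auto; exact (ord_trans (ord_mem Ob Hc) Hx Hd). }
  split.
  - intros [[d [Hd ->]] [d' [y [Hd' E']]]]; apply pr_inj in E'; destruct E' as [<- _].
    exists d; rewrite E; auto.
  - intros [d [Hd ->]]; rewrite E by auto; split; [exists d; split; eauto using ord_trans|].
    exists d; eauto.
Qed.

Lemma isrec_unique b f f' : ord mem b -> isrec G b f -> isrec G b f' -> f = f'.
Proof.
  intros Ob; revert f f'.
  apply (@ord_ind (fun b => forall f f', isrec G b f -> isrec G b f' -> f = f')); auto.
  - unfold isrec; fo_tac.
  - clear b Ob; intros b Ob IH f f' Hf Hf'.
    assert (E : forall c, c ∈ b -> rs f c = rs f' c) by eauto using isrec_rs.
    apply ext; intros p; rewrite (Hf p), (Hf' p).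
    split; intros [c [Hc ->]]; exists c; rewrite E; auto.
Qed.

Lemma recf_spec b : ord mem b -> (exists f, isrec G b f) -> isrec G b (recf G b).
Proof.
  intros Ob [f Hf].
  destruct (the_spec (P := fun f => (ord mem b /\ isrec G b f) \/ (~ ord mem b /\ f = emp)))
    as [H|H]; try tauto; eauto.
Qed.

Lemma recf_eq f b : ord mem b -> isrec G b f -> f = recf G b.
Proof. intros Ob Hf; apply (@isrec_unique b); auto; apply recf_spec; eauto. Qed.

Lemma tm_recf : (forall b, ord mem b -> exists f, isrec G b f) ->
  tm (fun e => recf G (e 0)).
Proof.
  intros Hex.
  apply (@tm_spec _ _ (fun f e => (ord mem (e 0) /\ isrec G (e 0) f) \/ (~ ord mem (e 0) /\ f = emp))).
  - intros f e; destruct (classic (ord mem (e 0))) as [O|O]; split.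
    + intros ->; left; split; auto using recf_spec.
    + intros [[_ H]|H]; [apply recf_eq; auto|tauto].
    + intros ->; right; split; auto; unfold recf.
      destruct (the_spec (P := fun f => (ord mem (e 0) /\ isrec G (e 0) f) \/
        (~ ord mem (e 0) /\ f = emp))) as [H|H]; try tauto; eauto.
    + intros [H|[_ ->]]; [tauto|]; unfold recf.
      destruct (the_spec (P := fun f => (ord mem (e 0) /\ isrec G (e 0) f) \/
        (~ ord mem (e 0) /\ f = emp))) as [H|H]; try tauto; eauto.
      symmetry; tauto.
  - unfold isrec; fo_tac.
Qed.

Lemma isrec_exists b : ord mem b -> exists f, isrec G b f.
Proof.
  apply (@ord_ind (fun b => exists f, isrec G b f)); [unfold isrec; fo_tac|].
  clear b; intros b Ob IH.
  (* Q relates c to the pair of c and the value at c; it is functional because the approximation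
     below c is unique. *)
  set (Q := fun c y => exists f, isrec G c f /\ y = pr c (G c f)).
  destruct (@replacement Q b) as [f Hf].
  - unfold Q, isrec; fo_tac.
  - intros c y y' Hc [f [Hf ->]] [f' [Hf' ->]].
    rewrite (isrec_unique (ord_mem Ob Hc) Hf Hf'); reflexivity.
  - exists f; intros p; rewrite Hf.
    assert (E : forall c fc, c ∈ b -> isrec G c fc -> rs f c = fc).
    { intros c fc Hc Hfc; apply ext; intros q; rewrite mem_rs, Hf, (Hfc q); split.
      - intros [[d [Hd [fd [Hfd ->]]]] [d' [y [Hd' E]]]]; apply pr_inj in E; destruct E as [<- _].
        exists d; split; auto; f_equal; f_equal.
        apply (@isrec_unique d); auto; [eauto using ord_mem|].
        apply (@isrec_rs c); eauto using ord_mem.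
      - intros [d [Hd ->]]; split; [|eauto].
        exists d; split; [eauto using ord_trans|].
        exists (rs fc d); split; auto; apply (@isrec_rs c); eauto using ord_mem. }
    split.
    + intros [c [Hc [fc [Hfc ->]]]]; exists c; rewrite (E c fc); auto.
    + intros [c [Hc ->]]; exists c; split; auto.
      destruct (IH c Hc) as [fc Hfc]; exists fc; rewrite (E c fc); auto.
Qed.

Lemma tm_rec : tm (fun e => rec G (e 0)).
Proof.
  unfold rec; assert (H := tm_recf isrec_exists).
  apply (@tm_comp2 _ _ _ G); [exact HG|apply tm_var|exact H].
Qed.

Lemma rec_eq b : ord mem b -> rec G b = G b (img b (fun c => pr c (rec G c))).
Proof.
  intros Ob; unfold rec at 1; f_equal.
  assert (HF : tm (fun e => pr (e 0) (rec G (e 0))))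
    by (apply (@tm_comp2 _ _ _ pr); [apply tm_pr|apply tm_var|apply tm_rec]).
  assert (Hb := recf_spec Ob (isrec_exists Ob)).
  apply ext; intros p; rewrite (img_iff b HF), (Hb p).
  split; intros [c [Hc ->]]; exists c; split; auto; unfold rec; do 2 f_equal;
    [|symmetry]; apply recf_eq; eauto using ord_mem, isrec_rs.
Qed.

End Recursion.

End SetTheoryBasics.
#[local] Hint Resolve tm_up tm_un tm_pw tm_cup tm_sc tm_pr tm_rs : tm.

Section Hierarchy.

Context {V : Type} {mem : V -> V -> Prop} {hZFC : ZFC mem}.
Local Notation "x ∈ y" := (mem x y) (at level 70, no associativity).
Local Notation fo := (@fo V mem).
Local Notation tm := (@tm V mem).

Lemma pr_in_un x y f : pr x y ∈ f -> x ∈ un (un f) /\ y ∈ un (un f).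
Proof.
  intros H; rewrite !mem_un; split; exists (up x y); (split; [apply mem_un; exists (pr x y);
    split; [exact H|apply up_r]|apply mem_up; auto]).
Qed.

(** Recursion along a measure m into the ordinals, for subsets of X: [Phi] decides x from the part U
    of A that has smaller measure. Truth, the order of codes and the enumeration below a bound are
    all obtained in this way. *)
Lemma set_recursion (X : V) (m : V -> V) (Phi : V -> V -> Prop) :
  tm (fun e => m (e 0)) -> fo (fun e => Phi (e 0) (e 1)) ->
  (forall x, x ∈ X -> ord mem (m x)) ->
  exists A, sub mem A X /\ forall x, x ∈ X ->
    exists U, (forall y, y ∈ U <-> y ∈ A /\ m y ∈ m x) /\ (x ∈ A <-> Phi U x).
Proof.
  intros Hm HPhi Hord.
  set (U := fun f => cmp X (fun y => exists c w, pr c w ∈ f /\ y ∈ w)).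
  assert (HU : forall f y, y ∈ U f <-> y ∈ X /\ exists c w, pr c w ∈ f /\ y ∈ w).
  { intros f; apply (@cmp_iff _ _ _ X (fun y => exists c w, pr c w ∈ f /\ y ∈ w)); fo_tac. }
  assert (tU : tm (fun e => U (e 0))).
  { apply (@tm_by_elements _ _ _ _ (fun y e => y ∈ X /\ exists c w, pr c w ∈ e 0 /\ y ∈ w));
      [intros; apply HU|fo_tac]. }
  (* Stage b of the ordinal recursion consists of the elements of A of measure exactly b, and [U f]
     is the union of the earlier stages. *)
  set (G := fun b f => cmp X (fun x => m x = b /\ Phi (U f) x)).
  assert (HG : forall b f x, x ∈ G b f <-> x ∈ X /\ m x = b /\ Phi (U f) x).
  { intros b f; apply (@cmp_iff _ _ _ X (fun x => m x = b /\ Phi (U f) x)).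
    fo_tac. }
  assert (tG : tm (fun e => G (e 0) (e 1))).
  { apply (@tm_by_elements _ _ _ _ (fun x e => x ∈ X /\ m x = e 0 /\ Phi (U (e 1)) x));
      [intros; apply HG|].
    fo_tac. }
  set (F := rec G).
  assert (tF : tm (fun e => F (e 0))) by (exact (tm_rec tG)).
  assert (tP : tm (fun e => pr (e 0) (F (e 0)))) by fo_tac.
  assert (HF : forall x b, ord mem b -> (x ∈ F b <-> x ∈ X /\ m x = b /\
      Phi (U (img b (fun c => pr c (F c)))) x)).
  { intros x b Ob; unfold F; rewrite (rec_eq tG Ob) at 1; apply HG. }
  set (A := cmp X (fun x => x ∈ F (m x))).
  assert (HA : forall x, x ∈ A <-> x ∈ X /\ x ∈ F (m x)).
  { apply (@cmp_iff _ _ _ X (fun x => x ∈ F (m x))); fo_tac. }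
  exists A; split; [intros x Hx; apply HA, Hx|].
  intros x Hx; exists (U (img (m x) (fun c => pr c (F c)))); split.
  - intros y; rewrite HU, HA; split.
    + intros [Hy [c [w [H Hyw]]]]; apply (img_iff (m x) tP) in H.
      destruct H as [d [Hd E]]; apply pr_inj in E; destruct E; subst c w.
      assert (Od : ord mem d) by (eapply ord_mem; [apply (Hord x)|]; eauto).
      assert (E : m y = d) by (apply HF in Hyw; tauto).
      subst d; auto.
    + intros [[Hy HyF] Hlt]; split; auto.
      exists (m y), (F (m y)); split; auto; apply (img_iff (m x) tP); eauto.
  - rewrite HA, (HF x (m x)) by auto; tauto.
Qed.

(** * The cumulative hierarchy *)

(** For f the graph of the levels below b this is the union of their power sets. Three unions lead
    from f to the elements of its values, which bounds the comprehension. *)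
Definition Vstep (b f : V) : V :=
  cmp (pw (un (un (un f)))) (fun x => exists c w, pr c w ∈ f /\ sub mem x w).
Lemma mem_Vstep b f x : x ∈ Vstep b f <-> exists c w, pr c w ∈ f /\ sub mem x w.
Proof.
  unfold Vstep; rewrite (@cmp_iff _ _ _ _ (fun x => exists c w, pr c w ∈ f /\ sub mem x w));
    [|fo_tac].
  split; [tauto|]; intros [c [w [H Hx]]]; split; [|eauto].
  apply mem_pw; intros z Hz; apply mem_un; exists w; split; auto; apply (pr_in_un H).
Qed.
Lemma tm_Vstep : tm (fun e => Vstep (e 0) (e 1)).
Proof.
  apply (@tm_by_elements _ _ _ _ (fun x e => exists c w, pr c w ∈ e 1 /\ sub mem x w));
    [intros; apply mem_Vstep|fo_tac].
Qed.

Definition Vl : V -> V := rec Vstep.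
Lemma tm_Vl : tm (fun e => Vl (e 0)).
Proof. exact (tm_rec tm_Vstep). Qed.
#[local] Hint Resolve tm_Vl : tm.
Lemma tm_pr_Vl : tm (fun e => pr (e 0) (Vl (e 0))).
Proof. fo_tac. Qed.
Lemma mem_Vl a x : ord mem a -> (x ∈ Vl a <-> exists c, c ∈ a /\ sub mem x (Vl c)).
Proof.
  intros Oa; unfold Vl; rewrite (rec_eq tm_Vstep Oa) at 1; rewrite mem_Vstep; split.
  - intros [c [w [H Hx]]]; apply (img_iff a tm_pr_Vl) in H; destruct H as [d [Hd E]].
    apply pr_inj in E; destruct E; subst; eauto.
  - intros [c [Hc Hx]]; exists c, (Vl c); split; auto; apply (img_iff a tm_pr_Vl); eauto.
Qed.

(** The condition on the witness in [is_Vlevel], isolated for an arbitrary structure because it is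
    absolute for each f, while the existence of f in a level needs a separate argument. *)
Definition Vfun {W : Type} (m : W -> W -> Prop) (f v a : W) : Prop :=
  (forall b, ole m b a <-> exists u, gr m f b u) /\
  (forall b u u', gr m f b u -> gr m f b u' -> u = u') /\
  (forall b u, gr m f b u -> forall x,
     m x u <-> exists c w, m c b /\ gr m f c w /\ sub m x w) /\
  gr m f a v.

Lemma Vfun_Vl a : ord mem a -> Vfun mem (img (sc a) (fun b => pr b (Vl b))) (Vl a) a.
Proof.
  intros Oa.
  assert (Hf : forall b u, gr mem (img (sc a) (fun b => pr b (Vl b))) b u <->
    ole mem b a /\ u = Vl b).
  { intros b u; rewrite gr_iff, (img_iff (sc a) tm_pr_Vl); split.
    - intros [c [Hc E]]; apply pr_inj in E; destruct E; subst; split; auto.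
      apply mem_sc, Hc.
    - intros [H ->]; exists b; split; auto; apply mem_sc, H. }
  split; [|split; [|split]].
  + intros b; split; [intros H; exists (Vl b); apply Hf; auto|].
    intros [u Hu]; apply Hf in Hu; tauto.
  + intros b u u' H H'; apply Hf in H, H'; destruct H, H'; congruence.
  + intros b u Hu x; apply Hf in Hu; destruct Hu as [Hb ->].
    assert (Ob : ord mem b) by (destruct Hb; subst; eauto using ord_mem).
    rewrite (mem_Vl x Ob); split.
    * intros [c [Hc Hx]]; exists c, (Vl c); split; auto; split; auto; apply Hf; split; auto.
      left; eapply mem_ole_trans; eauto.
    * intros [c [w [Hc [Hw Hx]]]]; apply Hf in Hw; destruct Hw as [_ ->]; eauto.
  + apply Hf; split; auto; right; reflexivity.
Qed.

Lemma is_Vlevel_iff v a : is_Vlevel mem v a <-> ord mem a /\ v = Vl a.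
Proof.
  split.
  - intros [Oa [f [Hdom [Hfun [Hval Hv]]]]]; split; auto.
    assert (H : forall b, ord mem b -> forall u, gr mem f b u -> u = Vl b).
    { apply (@ord_ind _ _ _ (fun b => forall u, gr mem f b u -> u = Vl b)); [fo_tac|].
      intros b Ob IH u Hu; apply ext; intros x; rewrite (Hval b u Hu x), (mem_Vl x Ob).
      split.
      - intros [c [w [Hc [Hw Hx]]]]; rewrite (IH c Hc w Hw) in Hx; eauto.
      - intros [c [Hc Hx]].
        assert (Hc' : ole mem c a).
        { left; apply mem_ole_trans with b; auto; apply Hdom; eauto. }
        apply Hdom in Hc'; destruct Hc' as [w Hw]; exists c, w.
        rewrite <- (IH c Hc w Hw) in Hx; auto. }
    apply H; auto.
  - intros [Oa ->]; split; auto; eexists; apply (Vfun_Vl Oa).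
Qed.

Lemma sub_refl x : sub mem x x.
Proof. intros z; auto. Qed.
Lemma sub_trans x y z : sub mem x y -> sub mem y z -> sub mem x z.
Proof. intros H H' u Hu; auto. Qed.

Lemma Vl_trans a : ord mem a -> transitive mem (Vl a).
Proof.
  apply (@ord_ind _ _ _ (fun a => transitive mem (Vl a))); [fo_tac|].
  clear a; intros a Oa IH x Hx y Hy; apply mem_Vl in Hx; auto; destruct Hx as [c [Hc Hx]].
  apply (mem_Vl _ Oa); exists c; split; auto; apply (IH c Hc), Hx, Hy.
Qed.
Lemma Vl_sub_closed a x y : ord mem a -> x ∈ Vl a -> sub mem y x -> y ∈ Vl a.
Proof.
  intros Oa Hx Hy; rewrite (mem_Vl x Oa) in Hx; rewrite (mem_Vl y Oa); destruct Hx as [c [Hc Hx]].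
  exists c; split; auto; eapply sub_trans; eauto.
Qed.
Lemma Vl_mono a b : ord mem b -> a ∈ b -> sub mem (Vl a) (Vl b).
Proof.
  intros Ob Ha x Hx; assert (Oa := ord_mem Ob Ha); rewrite (mem_Vl _ Oa) in Hx.
  rewrite (mem_Vl _ Ob); destruct Hx as [c [Hc Hx]].
  exists c; split; auto; exact (ord_trans Ob Hc Ha).
Qed.
Lemma Vl_in a b : ord mem b -> a ∈ b -> Vl a ∈ Vl b.
Proof. intros Ob Ha; apply (mem_Vl _ Ob); exists a; split; auto using sub_refl. Qed.

Lemma ord_in_Vl a b : ord mem a -> ord mem b -> (b ∈ Vl a <-> b ∈ a).
Proof.
  intros Oa; revert b.
  apply (@ord_ind _ _ _ (fun a => forall b, ord mem b -> (b ∈ Vl a <-> b ∈ a))); auto; [fo_tac|].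
  clear a Oa; intros a Oa IH b Ob; rewrite (mem_Vl _ Oa); split.
  - intros [c [Hc Hb]]; apply ole_mem_trans with c; auto.
    apply ord_sub; eauto using ord_mem; intros z Hz; apply (IH c Hc); eauto using ord_mem.
  - intros Hb; exists b; split; auto; intros z Hz; apply (IH b Hb); eauto using ord_mem.
Qed.

(** The union is iterated ω times: stage b adds to x the elements of elements of earlier stages. *)
Lemma transitive_superset x : exists t, transitive mem t /\ sub mem x t.
Proof.
  set (Q := fun f z => exists c w y, pr c w ∈ f /\ y ∈ w /\ z ∈ y).
  set (G := fun b f : V => cup x (cmp (un (un (un (un f)))) (Q f))).
  assert (HG : forall b f z, z ∈ G b f <-> z ∈ x \/ Q f z).
  { intros b f z; unfold G; rewrite mem_cup, (@cmp_iff _ _ _ _ (Q f)); [|unfold Q; fo_tac].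
    split; [tauto|]; intros [H|H]; [tauto|]; right; split; auto.
    destruct H as [c [w [y [H [Hy Hz]]]]].
    apply mem_un; exists y; split; auto; apply mem_un; exists w; split; auto; apply (pr_in_un H). }
  assert (tG : tm (fun e => G (e 0) (e 1))).
  { apply (@tm_by_elements _ _ _ _ (fun z e => z ∈ x \/ Q (e 1) z)); [intros; apply HG|].
    unfold Q; fo_tac. }
  set (F := rec G).
  assert (tF : tm (fun e => F (e 0))) by exact (tm_rec tG).
  assert (tP : tm (fun e => pr (e 0) (F (e 0)))) by fo_tac.
  assert (HF : forall b z, ord mem b -> (z ∈ F b <-> z ∈ x \/ exists c y, c ∈ b /\ y ∈ F c /\ z ∈ y)).
  { intros b z Ob; unfold F; rewrite (rec_eq tG Ob) at 1; rewrite HG; unfold Q.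
    apply or_iff_compat_l; split.
    - intros [c [w [y [H [Hy Hz]]]]]; apply (img_iff b tP) in H; destruct H as [d [Hd E]].
      apply pr_inj in E; destruct E; subst; eauto.
    - intros [c [y [Hc [Hy Hz]]]]; exists c, (F c), y; split; auto; apply (img_iff b tP); eauto. }
  exists (un (img om F)); split.
  - intros y Hy z Hz; apply mem_un in Hy; destruct Hy as [w [Hw Hy]].
    apply (img_iff om tF) in Hw; destruct Hw as [n [Hn ->]].
    apply mem_un; exists (F (sc n)); split.
    + apply (img_iff om tF); exists (sc n); split; auto; apply limit_sc; auto; apply limit_om.
    + apply HF; [apply ord_sc, (ord_mem ord_om Hn)|]; right; exists n, y; split; auto.
      apply mem_sc; auto.
  - intros z Hz; apply mem_un; exists (F emp); split.
    + apply (img_iff om tF); exists emp; split; auto; apply limit_emp, limit_om.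
    + apply HF; auto; apply ord_emp.
Qed.

(** Foundation speaks of sets, so a counterexample is minimised inside a transitive set that
    contains it. *)
Lemma mem_ind (P : V -> Prop) : fo (fun e => P (e 0)) ->
  (forall x, (forall y, y ∈ x -> P y) -> P x) -> forall x, P x.
Proof.
  intros HP IH x; apply NNPP; intros N.
  destruct (transitive_superset (up x x)) as [t [Tt Ht]].
  destruct (@found _ _ _ (fun y => ~ P y) t) as [y [Hy [Ny Hmin]]].
  - apply fo_not, HP.
  - exists x; split; auto; apply Ht, up_l.
  - apply Ny, IH; intros z Hz; apply NNPP; intros Nz; apply (Hmin z); auto; apply (Tt y); auto.
Qed.

Lemma sub_Vl_exists x : exists a, ord mem a /\ sub mem x (Vl a).
Proof.
  apply (@mem_ind (fun x => exists a, ord mem a /\ sub mem x (Vl a))); [fo_tac|].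
  clear x; intros x IH.
  (* The least level is taken to make the relation functional for replacement. *)
  set (Q := fun y a => ord mem a /\ sub mem y (Vl a) /\ forall b, b ∈ a -> ~ sub mem y (Vl b)).
  destruct (@replacement _ _ _ Q x) as [A HA].
  - unfold Q; fo_tac.
  - intros y a b _ [Oa [Ha Na]] [Ob [Hb Nb]].
    destruct (ord_trich Oa Ob) as [H|[H|H]]; auto; [destruct (Nb a H Ha)|destruct (Na b H Hb)].
  - destruct (@ord_bound _ _ _ A) as [b [Ob Hb]].
    + intros a Ha; apply HA in Ha; destruct Ha as [y [_ Ha]]; apply Ha.
    + exists b; split; auto; intros y Hy.
      destruct (IH y Hy) as [a [Oa Ha]].
      destruct (@ord_least _ _ _ (fun a => sub mem y (Vl a)) a) as [a' [Oa' [_ [Ha' Na']]]]; auto.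
      { fo_tac. }
      apply (mem_Vl _ Ob); exists a'; split; auto; apply Hb, HA; exists y; split; auto.
      split; auto.
Qed.

(** * Rank *)

Definition rk (x : V) : V := the (fun a =>
  ord mem a /\ sub mem x (Vl a) /\ forall b, b ∈ a -> ~ sub mem x (Vl b)).
Lemma rk_spec x : ord mem (rk x) /\ sub mem x (Vl (rk x)) /\
  forall b, b ∈ rk x -> ~ sub mem x (Vl b).
Proof.
  unfold rk; apply (the_spec (P := fun a =>
    ord mem a /\ sub mem x (Vl a) /\ forall b, b ∈ a -> ~ sub mem x (Vl b))).
  destruct (sub_Vl_exists x) as [a [Oa Ha]].
  destruct (@ord_least _ _ _ (fun a => sub mem x (Vl a)) a) as [b [Ob [_ [Hb Nb]]]]; auto; [fo_tac|].
  exists b; auto.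
Qed.
Lemma ord_rk x : ord mem (rk x).
Proof. apply rk_spec. Qed.
Lemma rk_sub x : sub mem x (Vl (rk x)).
Proof. apply rk_spec. Qed.
Lemma rk_eq x a : a = rk x <-> ord mem a /\ sub mem x (Vl a) /\
  forall b, b ∈ a -> ~ sub mem x (Vl b).
Proof.
  split; [intros ->; apply rk_spec|].
  intros [Oa [Ha Na]]; destruct (rk_spec x) as [O [H N]].
  destruct (ord_trich Oa O) as [E|[E|E]]; auto; [destruct (N a E Ha)|destruct (Na _ E H)].
Qed.
Lemma tm_rk : tm (fun e => rk (e 0)).
Proof.
  apply (@tm_spec _ _ (fun a e => ord mem a /\ sub mem (e 0) (Vl a) /\
    forall b, b ∈ a -> ~ sub mem (e 0) (Vl b))); [intros; apply rk_eq|fo_tac].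
Qed.
Lemma mem_Vl_rk x a : ord mem a -> (x ∈ Vl a <-> rk x ∈ a).
Proof.
  intros Oa; rewrite (mem_Vl _ Oa); split.
  - intros [c [Hc H]]; destruct (ord_mem_or_le (ord_rk x) (ord_mem Oa Hc)) as [E|[E|E]].
    + exact (ord_trans Oa E Hc).
    + destruct (rk_spec x) as [_ [_ N]]; destruct (N c E H).
    + subst; auto.
  - intros H; exists (rk x); split; auto using rk_sub.
Qed.
Lemma rk_mem x y : y ∈ x -> rk y ∈ rk x.
Proof. intros H; apply (mem_Vl_rk y (ord_rk x)), rk_sub, H. Qed.
Lemma in_Vl_exists x : exists a, ord mem a /\ x ∈ Vl a.
Proof.
  exists (sc (rk x)); assert (O := ord_sc (ord_rk x)); split; auto.
  apply mem_Vl_rk; auto; apply mem_sc; auto.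
Qed.

Lemma rk_ord a : ord mem a -> rk a = a.
Proof.
  intros Oa; symmetry; apply rk_eq; split; auto; split.
  - intros z Hz; apply ord_in_Vl; eauto using ord_mem.
  - intros b Hb H; apply (@mem_irrefl _ _ _ b); apply (ord_in_Vl (ord_mem Oa Hb) (ord_mem Oa Hb)), H, Hb.
Qed.

Lemma pr_rk x y : rk x ∈ rk (pr x y) /\ rk y ∈ rk (pr x y).
Proof.
  assert (H : rk (up x y) ∈ rk (pr x y)) by apply rk_mem, up_r.
  split; eapply ord_trans; try apply ord_rk; try exact H; apply rk_mem, mem_up; auto.
Qed.

(** * Closure properties of limit levels *)

Section LimitLevel.
Context (lam : V) (Ll : limit mem lam).
Let Ol : ord mem lam := proj1 Ll.

Lemma Vl_pw x : x ∈ Vl lam -> pw x ∈ Vl lam.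
Proof.
  intros Hx; apply (mem_Vl _ Ol) in Hx; destruct Hx as [c [Hc Hx]].
  apply (mem_Vl _ Ol); exists (sc c); split; [apply limit_sc; auto|].
  intros z Hz; apply mem_pw in Hz; apply (mem_Vl _ (ord_sc (ord_mem Ol Hc))).
  exists c; split; [apply mem_sc; auto|]; eapply sub_trans; eauto.
Qed.
Lemma Vl_up x y : x ∈ Vl lam -> y ∈ Vl lam -> up x y ∈ Vl lam.
Proof.
  intros Hx Hy; apply (mem_Vl_rk _ Ol) in Hx, Hy.
  assert (exists c, c ∈ lam /\ rk x ∈ c /\ rk y ∈ c) as [c [Hc [Hxc Hyc]]].
  { destruct (ord_mem_or_le (ord_rk x) (ord_rk y)) as [H|H].
    - exists (sc (rk y)); split; [apply limit_sc; auto|]; rewrite !mem_sc; auto.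
    - exists (sc (rk x)); split; [apply limit_sc; auto|]; rewrite !mem_sc.
      destruct H; auto. }
  apply (mem_Vl _ Ol); exists c; split; auto; intros z Hz; apply mem_up in Hz.
  destruct Hz; subst; apply mem_Vl_rk; eauto using ord_mem.
Qed.
Lemma Vl_pr x y : x ∈ Vl lam -> y ∈ Vl lam -> pr x y ∈ Vl lam.
Proof. unfold pr; auto using Vl_up. Qed.
Lemma Vl_un x : x ∈ Vl lam -> un x ∈ Vl lam.
Proof.
  intros Hx; apply (mem_Vl _ Ol) in Hx; destruct Hx as [c [Hc Hx]].
  apply (mem_Vl _ Ol); exists c; split; auto; intros z Hz.
  apply mem_un in Hz; destruct Hz as [y [Hy Hz]]; apply (Vl_trans (ord_mem Ol Hc) (y := y)); auto.
Qed.
Lemma Vl_cup x y : x ∈ Vl lam -> y ∈ Vl lam -> cup x y ∈ Vl lam.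
Proof. unfold cup; auto using Vl_un, Vl_up. Qed.
Lemma Vl_sc x : x ∈ Vl lam -> sc x ∈ Vl lam.
Proof. unfold sc; auto using Vl_cup, Vl_up. Qed.
Lemma Vl_el x y : x ∈ Vl lam -> y ∈ x -> y ∈ Vl lam.
Proof. intros Hx Hy; exact (Vl_trans Ol Hx Hy). Qed.
Lemma Vl_emp : emp ∈ Vl lam.
Proof. apply (ord_in_Vl Ol ord_emp), limit_emp, Ll. Qed.
Lemma Vl_sub x y : x ∈ Vl lam -> sub mem y x -> y ∈ Vl lam.
Proof. apply Vl_sub_closed, Ol. Qed.
Lemma Vl_pr_inv x y : pr x y ∈ Vl lam -> x ∈ Vl lam /\ y ∈ Vl lam.
Proof.
  intros H; split; apply (Vl_el (x := up x y)); try (apply mem_up; auto); apply (Vl_el H), up_r.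
Qed.
Lemma Vl_gr f x y : f ∈ Vl lam -> pr x y ∈ f -> x ∈ Vl lam /\ y ∈ Vl lam.
Proof. intros Hf H; apply Vl_pr_inv, (Vl_el Hf), H. Qed.
Lemma Vl_rel f a b : a ∈ Vl lam -> b ∈ Vl lam ->
  (forall p, p ∈ f -> exists x y, x ∈ a /\ y ∈ b /\ p = pr x y) -> f ∈ Vl lam.
Proof.
  intros Ha Hb Hf; apply Vl_sub with (pw (pw (cup a b))); auto using Vl_pw, Vl_cup.
  intros p Hp; destruct (Hf p Hp) as [x [y [Hx [Hy ->]]]].
  apply mem_pw; intros u Hu; apply mem_pw; intros z Hz; apply mem_cup.
  apply mem_up in Hu; destruct Hu; subst; apply mem_up in Hz; destruct Hz; subst; auto.
Qed.
End LimitLevel.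

Lemma om_sub_Vl_om : sub mem om (Vl om).
Proof. intros n Hn; apply ord_in_Vl; eauto using ord_mem, ord_om. Qed.

Lemma tc_exists x : exists t, is_tc mem t x.
Proof.
  destruct (transitive_superset x) as [t [Tt Ht]].
  set (P := fun z => forall u, transitive mem u -> sub mem x u -> z ∈ u).
  assert (HP : fo (fun e => P (e 0))) by (unfold P; fo_tac).
  exists (cmp t P); split; [|split].
  - intros y Hy z Hz; apply (cmp_iff t HP) in Hy; destruct Hy as [Hy Py].
    apply (cmp_iff t HP); split; [exact (Tt y Hy z Hz)|].
    intros u Tu Hu; exact (Tu y (Py u Tu Hu) z Hz).
  - intros z Hz; apply (cmp_iff t HP); split; auto; intros u _ Hu; auto.
  - intros u Tu Hu z Hz; apply (cmp_iff t HP) in Hz; destruct Hz as [_ Pz]; auto.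
Qed.

End Hierarchy.
#[local] Hint Resolve tm_Vl tm_rk : tm.

(** * Functions, and inaccessible levels *)

Section Functions.

Context {V : Type} {mem : V -> V -> Prop} {hZFC : ZFC mem}.
Local Notation "x ∈ y" := (mem x y) (at level 70, no associativity).
Local Notation fo := (@fo V mem).
Local Notation tm := (@tm V mem).

Definition cart (a b : V) : V :=
  cmp (pw (pw (cup a b))) (fun p => exists x y, x ∈ a /\ y ∈ b /\ p = pr x y).
Lemma mem_cart a b p : p ∈ cart a b <-> exists x y, x ∈ a /\ y ∈ b /\ p = pr x y.
Proof.
  unfold cart; rewrite (@cmp_iff _ _ _ _ (fun p => exists x y, x ∈ a /\ y ∈ b /\ p = pr x y));
    [|fo_tac].
  split; [tauto|]; intros [x [y [Hx [Hy ->]]]]; split; [|eauto 6].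
  apply mem_pw; intros u Hu; apply mem_pw; intros z Hz; apply mem_cup.
  apply mem_up in Hu; destruct Hu; subst; apply mem_up in Hz; destruct Hz; subst; auto.
Qed.
Lemma tm_cart : tm (fun e => cart (e 0) (e 1)).
Proof.
  apply (@tm_by_elements _ _ _ _ (fun p e => exists x y, x ∈ e 0 /\ y ∈ e 1 /\ p = pr x y));
    [intros; apply mem_cart|fo_tac].
Qed.
#[local] Hint Resolve tm_cart : tm.
Lemma pr_in_cart a b x y : pr x y ∈ cart a b <-> x ∈ a /\ y ∈ b.
Proof.
  rewrite mem_cart; split; [|intros []; eauto 6].
  intros [x' [y' [Hx [Hy E]]]]; apply pr_inj in E; destruct E; subst; auto.
Qed.

Lemma is_pfun_iff f a b : is_pfun mem f a b <-> sub mem f (cart a b) /\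
  forall x y y', pr x y ∈ f -> pr x y' ∈ f -> y = y'.
Proof.
  unfold is_pfun; split; intros [H1 H2]; split.
  - intros p Hp; apply mem_cart; destruct (H1 p Hp) as [x [y [Hx [Hy E]]]].
    apply is_pair_iff in E; eauto 6.
  - intros x y y' H H'; apply (H2 x); apply gr_iff; auto.
  - intros p Hp; apply H1, mem_cart in Hp; destruct Hp as [x [y [Hx [Hy E]]]].
    exists x, y; rewrite is_pair_iff; auto.
  - intros x y y' H H'; apply (H2 x); apply gr_iff; auto.
Qed.
Lemma is_fun_iff f a b : is_fun mem f a b <-> sub mem f (cart a b) /\
  (forall x y y', pr x y ∈ f -> pr x y' ∈ f -> y = y') /\
  forall x, x ∈ a -> exists y, y ∈ b /\ pr x y ∈ f.
Proof.
  unfold is_fun; rewrite is_pfun_iff; split.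
  - intros [[H1 H2] H3]; split; auto; split; auto; intros x Hx.
    destruct (H3 x Hx) as [y Hy]; apply gr_iff in Hy; exists y; split; auto.
    apply H1, pr_in_cart in Hy; tauto.
  - intros [H1 [H2 H3]]; split; auto; intros x Hx; destruct (H3 x Hx) as [y [_ Hy]].
    exists y; apply gr_iff; auto.
Qed.
Lemma is_inj_iff f a b : is_inj mem f a b <-> is_fun mem f a b /\
  forall x x' y, pr x y ∈ f -> pr x' y ∈ f -> x = x'.
Proof.
  unfold is_inj; split; intros [H1 H2]; split; auto; intros x x' y H H'; apply (H2 x x' y);
    apply gr_iff; auto.
Qed.

Lemma graph_exists a b (R : V -> V -> Prop) : fo (fun e => R (e 0) (e 1)) ->
  exists f, sub mem f (cart a b) /\ forall x y, pr x y ∈ f <-> x ∈ a /\ y ∈ b /\ R x y.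
Proof.
  intros HR.
  assert (HQ : fo (fun e => exists x y, e 0 = pr x y /\ R x y)) by fo_tac.
  exists (cmp (cart a b) (fun p => exists x y, p = pr x y /\ R x y)); split.
  - intros p Hp; apply (cmp_iff (cart a b) HQ) in Hp; tauto.
  - intros x y; rewrite (cmp_iff (cart a b) HQ), pr_in_cart; split.
    + intros [H [x' [y' [E H']]]]; apply pr_inj in E; destruct E; subst; tauto.
    + intros [Hx [Hy H]]; split; eauto.
Qed.
Lemma fun_exists a b (R : V -> V -> Prop) : fo (fun e => R (e 0) (e 1)) ->
  (forall x, x ∈ a -> exists y, y ∈ b /\ R x y) ->
  (forall x y y', x ∈ a -> R x y -> R x y' -> y = y') ->
  exists f, is_fun mem f a b /\ forall x y, pr x y ∈ f <-> x ∈ a /\ y ∈ b /\ R x y.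
Proof.
  intros HR Htot Hfun; destruct (graph_exists a b HR) as [f [Hf Hpr]].
  exists f; split; auto; apply is_fun_iff; split; auto; split.
  - intros x y y' H H'; apply Hpr in H, H'; apply (Hfun x); tauto.
  - intros x Hx; destruct (Htot x Hx) as [y [Hy H]]; exists y; split; auto; apply Hpr; auto.
Qed.
Lemma injects_by a b (R : V -> V -> Prop) : fo (fun e => R (e 0) (e 1)) ->
  (forall x, x ∈ a -> exists y, y ∈ b /\ R x y) ->
  (forall x y y', x ∈ a -> R x y -> R x y' -> y = y') ->
  (forall x x' y, x ∈ a -> x' ∈ a -> R x y -> R x' y -> x = x') -> injects mem a b.
Proof.
  intros HR Htot Hfun Hinj; destruct (fun_exists HR Htot Hfun) as [f [Hf Hpr]].
  exists f; apply is_inj_iff; split; auto.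
  intros x x' y H H'; apply Hpr in H, H'; apply (Hinj x x' y); tauto.
Qed.
Lemma injects_sub a b : sub mem a b -> injects mem a b.
Proof.
  intros H; apply (@injects_by a b (fun x y => x = y)); [fo_tac| | |]; try congruence; eauto.
Qed.
Lemma injects_trans a b c : injects mem a b -> injects mem b c -> injects mem a c.
Proof.
  intros [f Hf] [g Hg]; rewrite is_inj_iff, is_fun_iff in Hf, Hg.
  destruct Hf as [[Hf1 [Hf2 Hf3]] Hf4], Hg as [[Hg1 [Hg2 Hg3]] Hg4].
  apply (@injects_by a c (fun x z => exists y, pr x y ∈ f /\ pr y z ∈ g)); [fo_tac| | |].
  - intros x Hx; destruct (Hf3 x Hx) as [y [Hy H]]; destruct (Hg3 y Hy) as [z [Hz H']]; eauto.
  - intros x z z' _ [y [H1 H2]] [y' [H3 H4]]; assert (y = y') by eauto; subst; eauto.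
  - intros x x' z _ _ [y [H1 H2]] [y' [H3 H4]]; assert (y = y') by eauto; subst; eauto.
Qed.
Lemma injects_pw a b : injects mem a b -> injects mem (pw a) (pw b).
Proof.
  intros [f Hf]; rewrite is_inj_iff, is_fun_iff in Hf; destruct Hf as [[Hf1 [Hf2 Hf3]] Hf4].
  apply (@injects_by _ _ (fun X Y => forall y, y ∈ Y <-> exists x, x ∈ X /\ pr x y ∈ f));
    [fo_tac| | |].
  - intros X HX; assert (HP : fo (fun e => exists x, x ∈ X /\ pr x (e 0) ∈ f))
      by fo_tac.
    exists (cmp b (fun y => exists x, x ∈ X /\ pr x y ∈ f)); split.
    + apply mem_pw; intros y Hy; apply (cmp_iff b HP) in Hy; tauto.
    + intros y; rewrite (cmp_iff b HP); split; [tauto|]; intros [x [Hx H]]; split; eauto.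
      apply Hf1, pr_in_cart in H; tauto.
  - intros X Y Y' _ H H'; apply ext; intros y; rewrite H, H'; tauto.
  - assert (H : forall X X' Y, X ∈ pw a -> X' ∈ pw a ->
      (forall y, y ∈ Y <-> exists x, x ∈ X /\ pr x y ∈ f) ->
      (forall y, y ∈ Y <-> exists x, x ∈ X' /\ pr x y ∈ f) -> sub mem X X').
    { intros X X' Y HX HX' H H' x Hx; rewrite mem_pw in HX; destruct (Hf3 x (HX x Hx)) as [y [_ Hy]].
      assert (HyY : y ∈ Y) by (apply H; eauto); apply H' in HyY; destruct HyY as [x' [Hx' Hy']].
      rewrite (Hf4 x x' y Hy Hy'); auto. }
    intros X X' Y HX HX' E E'; apply ext; intros z; split; [apply (H X X' Y)|apply (H X' X Y)]; auto.
Qed.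

Lemma ord_cup a b : ord mem a -> ord mem b -> cup a b = a \/ cup a b = b.
Proof.
  intros Oa Ob; destruct (ord_mem_or_le Oa Ob) as [H|H].
  - right; apply ext; intros z; rewrite mem_cup; split; auto; intros [Hz|Hz]; auto.
    exact (ord_trans Ob Hz H).
  - left; apply ext; intros z; rewrite mem_cup; split; auto; intros [Hz|Hz]; auto.
    exact (mem_ole_trans Oa Hz H).
Qed.

(** * V_k and H_k for inaccessible k *)

Section Inaccessible.
Context (k : V) (Ik : inaccessible mem k).

Lemma inacc_ord : ord mem k.
Proof. apply Ik. Qed.
Lemma inacc_limit : limit mem k.
Proof. apply Ik. Qed.
Lemma inacc_om : om ∈ k.
Proof. destruct Ik as [_ [[w [Hw H]] _]]; apply is_omega_iff in Hw; subst; auto. Qed.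

Lemma inacc_bound a f : a ∈ k -> is_fun mem f a k ->
  exists b, b ∈ k /\ forall x y, pr x y ∈ f -> y ∈ b.
Proof.
  intros Ha Hf; destruct Ik as [_ [_ [[_ R] _]]]; destruct (R a f Ha Hf) as [b [Hb H]].
  exists b; split; auto; intros x y Hxy; apply (H x); apply gr_iff; auto.
Qed.

Lemma card_lt_injects a b : injects mem a b -> card_lt mem b k -> card_lt mem a k.
Proof. intros H [c [Hc H']]; exists c; split; auto; eapply injects_trans; eauto. Qed.
Lemma card_lt_pw a : card_lt mem a k -> card_lt mem (pw a) k.
Proof.
  intros [b [Hb H]]; apply card_lt_injects with (pw b); [apply injects_pw, H|].
  destruct Ik as [_ [_ [_ S]]]; apply (S b); auto; apply is_pow_iff; reflexivity.
Qed.

(** Induction on b. Regularity yields one mu in k into which all power sets of earlier levels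
    inject; choosing injections embeds V_b in b × mu, whose size is below k by the strong limit
    property. *)
Lemma card_lt_Vl b : b ∈ k -> card_lt mem (Vl b) k.
Proof.
  intros Hb; assert (Ob := ord_mem inacc_ord Hb); revert Hb.
  apply (@ord_ind _ _ _ (fun b => b ∈ k -> card_lt mem (Vl b) k)); auto; [fo_tac|].
  clear b Ob; intros b Ob IH Hb.
  assert (Hn : forall c, c ∈ b -> exists n, n ∈ k /\ injects mem (pw (Vl c)) n).
  { intros c Hc; apply card_lt_pw, IH; auto; exact (ord_trans inacc_ord Hc Hb). }
  (* The least n is definable from c, so the n form a function to which regularity applies. *)
  set (R := fun c n => injects mem (pw (Vl c)) n /\ forall m, m ∈ n -> ~ injects mem (pw (Vl c)) m).
  assert (HR : fo (fun e => R (e 0) (e 1))) by (unfold R; fo_tac).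
  assert (HRtot : forall c, c ∈ b -> exists n, n ∈ k /\ R c n).
  { intros c Hc; destruct (Hn c Hc) as [n [Hnk H]].
    destruct (@ord_least _ _ _ (fun n => injects mem (pw (Vl c)) n) n) as [n' [On' [Hle [H' N]]]];
      auto; [fo_tac|apply (ord_mem inacc_ord Hnk)|].
    exists n'; split; [exact (ole_mem_trans inacc_ord Hle Hnk)|split; auto]. }
  set (Rk := fun c n => n ∈ k /\ R c n).
  destruct (@fun_exists b k Rk) as [f [Hf Hpr]].
  { unfold Rk; fo_tac. }
  { intros c Hc; destruct (HRtot c Hc) as [n [H1 H2]]; exists n; unfold Rk; auto. }
  { intros c n n' Hc [Hk [H1 H2]] [Hk' [H3 H4]].
    destruct (ord_trich (ord_mem inacc_ord Hk) (ord_mem inacc_ord Hk')) as [E|[E|E]]; auto;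
      [destruct (H4 n E H1)|destruct (H2 n' E H3)]. }
  destruct (inacc_bound Hb Hf) as [mu [Hmu Hbd]]; assert (Omu := ord_mem inacc_ord Hmu).
  assert (Hinj : forall c, c ∈ b -> injects mem (pw (Vl c)) mu).
  { intros c Hc; destruct (HRtot c Hc) as [n [Hnk HRn]].
    apply injects_trans with n; [apply HRn|]; apply injects_sub.
    intros z Hz; apply (ord_trans Omu Hz), (Hbd c), Hpr; unfold Rk; auto. }
  set (I := fun c p => exists g, is_inj mem g (pw (Vl c)) mu /\ p = pr c g).
  (* Each injection is tagged with c to make the family disjoint, as the axiom of choice is stated
     for disjoint families. *)
  set (J := fun c => cmp (cart (up c c) (pw (cart (pw (Vl c)) mu))) (I c)).
  assert (HJ : forall c p, p ∈ J c <-> I c p).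
  { intros c p; unfold J; rewrite (@cmp_iff _ _ _ _ (I c)); [|unfold I; fo_tac].
    split; [tauto|]; intros H; split; auto; destruct H as [g [Hg ->]].
    apply pr_in_cart; split; [apply up_l|]; apply mem_pw.
    rewrite is_inj_iff, is_fun_iff in Hg; tauto. }
  assert (tJ : tm (fun e => J (e 0))).
  { apply (@tm_by_elements _ _ _ _ (fun p e => I (e 0) p)); [intros; apply HJ|unfold I; fo_tac]. }
  destruct (zfc_choice hZFC (a := img b J)) as [ch Hch].
  { intros x Hx; apply (img_iff b tJ) in Hx; destruct Hx as [c [Hc ->]].
    destruct (Hinj c Hc) as [g Hg]; exists (pr c g); apply HJ; exists g; auto. }
  { intros x y z Hx Hy Hzx Hzy; apply (img_iff b tJ) in Hx, Hy.
    destruct Hx as [c [Hc ->]], Hy as [d [Hd ->]]; apply HJ in Hzx, Hzy.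
    destruct Hzx as [g [_ ->]], Hzy as [g' [_ E]]; apply pr_inj in E; destruct E; subst; auto. }
  assert (Hg : forall c, c ∈ b -> exists g, is_inj mem g (pw (Vl c)) mu /\ pr c g ∈ ch /\
    forall g', is_inj mem g' (pw (Vl c)) mu -> pr c g' ∈ ch -> g' = g).
  { intros c Hc; destruct (Hch (J c)) as [z [[Hz1 Hz2] Hz3]]; [apply (img_iff b tJ); eauto|].
    apply HJ in Hz2; destruct Hz2 as [g [Hg ->]]; exists g; split; auto; split; auto.
    intros g' Hg' Hin; assert (E : pr c g' = pr c g).
    { apply Hz3; split; auto; apply HJ; exists g'; auto. }
    apply pr_inj in E; tauto. }
  assert (Hrk : forall x, x ∈ Vl b -> rk x ∈ b /\ x ∈ pw (Vl (rk x))).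
  { intros x Hx; split; [apply mem_Vl_rk; auto|apply mem_pw, rk_sub]. }
  apply card_lt_injects with (cart b mu).
  (* x goes to its rank together with its value under the injection chosen for that rank; the rank
     recovers which injection was applied. *)
  - apply (@injects_by _ _ (fun x p => exists g y, is_inj mem g (pw (Vl (rk x))) mu /\
      pr (rk x) g ∈ ch /\ pr x y ∈ g /\ p = pr (rk x) y)); [fo_tac| | |].
    + intros x Hx; destruct (Hrk x Hx) as [H1 H2]; destruct (Hg _ H1) as [g [Ig [Hgc _]]].
      assert (Ig' := Ig); rewrite is_inj_iff, is_fun_iff in Ig'; destruct Ig' as [[_ [_ T]] _].
      destruct (T x H2) as [y [Hy Hxy]]; exists (pr (rk x) y); split; [apply pr_in_cart; auto|].
      exists g, y; auto.
    + intros x p p' Hx [g [y [Ig [Hgc [Hxy ->]]]]] [g' [y' [Ig' [Hgc' [Hxy' ->]]]]].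
      destruct (Hrk x Hx) as [H1 H2]; destruct (Hg _ H1) as [h [Ih [Hhc U]]].
      rewrite (U g Ig Hgc) in *; rewrite (U g' Ig' Hgc') in *.
      rewrite is_inj_iff, is_fun_iff in Ih; destruct Ih as [[_ [F _]] _].
      rewrite (F x y y'); auto.
    + intros x x' p Hx Hx' [g [y [Ig [Hgc [Hxy ->]]]]] [g' [y' [Ig' [Hgc' [Hxy' E]]]]].
      apply pr_inj in E; destruct E as [E1 E2]; subst y'; rewrite <- E1 in *.
      destruct (Hrk x Hx) as [H1 H2]; destruct (Hg _ H1) as [h [Ih [Hhc U]]].
      rewrite (U g Ig Hgc) in *; rewrite (U g' Ig' Hgc') in *.
      rewrite is_inj_iff in Ih; destruct Ih as [_ F]; eauto.
  (* The product lies in a double power set, so the strong limit property replaces cardinal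
     arithmetic. *)
  - apply card_lt_injects with (pw (pw (cup b mu))).
    + apply injects_sub; intros p Hp; unfold cart in Hp.
      apply (@cmp_iff _ _ _ _ (fun p => exists x y, x ∈ b /\ y ∈ mu /\ p = pr x y)) in Hp;
        [tauto|fo_tac].
    + apply card_lt_pw, card_lt_pw; exists (cup b mu); split; [|apply injects_sub, sub_refl].
      destruct (ord_cup Ob Omu) as [-> | ->]; auto.
Qed.

(** By regularity the ranks of fewer than k elements of V_k are bounded below k. *)
Lemma card_lt_sub_Vl x : sub mem x (Vl k) -> card_lt mem x k -> x ∈ Vl k.
Proof.
  intros Hx [mu [Hmu [f Hf]]]; rewrite is_inj_iff, is_fun_iff in Hf.
  destruct Hf as [[Hf1 [Hf2 Hf3]] Hf4].
  (* Regularity is stated for total functions, so ordinals outside the range of the injection are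
     sent to [emp]. *)
  set (R := fun xi r => (exists z, pr z xi ∈ f /\ r = rk z) \/ ((~ exists z, pr z xi ∈ f) /\ r = emp)).
  destruct (@fun_exists mu k R) as [h [Hh Hpr]].
  - unfold R; fo_tac.
  - intros xi Hxi; destruct (classic (exists z, pr z xi ∈ f)) as [[z Hz]|N].
    + exists (rk z); split; [|left; eauto].
      apply (mem_Vl_rk z inacc_ord), Hx; apply Hf1, pr_in_cart in Hz; tauto.
    + exists emp; split; [apply limit_emp, inacc_limit|right; auto].
  - intros xi r r' _ [[z [Hz ->]]|[N ->]] [[z' [Hz' ->]]|[N' ->]]; auto.
    + rewrite (Hf4 z z' xi); auto.
    + destruct N'; eauto.
    + destruct N; eauto.
  - destruct (inacc_bound Hmu Hh) as [b [Hb Hbd]].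
    apply (mem_Vl _ inacc_ord); exists b; split; auto; intros z Hz.
    destruct (Hf3 z Hz) as [xi [Hxi Hzxi]].
    apply (mem_Vl_rk _ (ord_mem inacc_ord Hb)), (Hbd xi), Hpr; split; auto; split; [|left; eauto].
    apply (mem_Vl_rk z inacc_ord); auto.
Qed.

(** This connects the levels V_k of [uplifting] with the structures H_k in which Laver functions
    live. *)
Lemma is_H_Vl : is_H mem (Vl k) k.
Proof.
  intros x; split.
  - intros Hx; destruct (tc_exists x) as [t Ht]; exists t; split; auto.
    apply (mem_Vl _ inacc_ord) in Hx; destruct Hx as [c [Hc Hx]].
    apply card_lt_injects with (Vl c); [|apply card_lt_Vl; auto].
    apply injects_sub, Ht; auto; apply Vl_trans, (ord_mem inacc_ord Hc).
  - intros [t [[Tt [Hxt _]] Ct]].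
    assert (H : forall y, y ∈ t -> y ∈ Vl k).
    { apply (@mem_ind _ _ _ (fun y => y ∈ t -> y ∈ Vl k)); [fo_tac|].
      intros y IH Hy; apply card_lt_sub_Vl.
      - intros z Hz; apply IH; auto; apply (Tt y); auto.
      - apply card_lt_injects with t; auto; apply injects_sub, Tt, Hy. }
    apply card_lt_sub_Vl; [intros z Hz; auto|].
    apply card_lt_injects with t; auto; apply injects_sub, Hxt.
Qed.

End Inaccessible.

End Functions.
#[local] Hint Resolve tm_cart : tm.

(** * Internal syntax and satisfaction *)

Section Satisfaction.

Context {V : Type} {mem : V -> V -> Prop} {hZFC : ZFC mem}.
Local Notation "x ∈ y" := (mem x y) (at level 70, no associativity).
Local Notation fo := (@fo V mem).
Local Notation tm := (@tm V mem).

Fixpoint num (n : nat) : V := match n with O => emp | S k => sc (num k) end.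
Lemma is_num_iff n x : is_num mem n x <-> x = num n.
Proof.
  revert x; induction n as [|n IH]; intros x; simpl; [apply is_empty_iff|].
  split.
  - intros [y [Hy Hx]]; apply IH in Hy; apply is_succ_iff in Hx; subst; reflexivity.
  - intros ->; exists (num n); rewrite IH, is_succ_iff; auto.
Qed.
Lemma num_nat n : num n ∈ om.
Proof.
  induction n; simpl; [apply limit_emp, limit_om|apply limit_sc; auto; apply limit_om].
Qed.
Lemma sc_not_emp x : sc x <> emp.
Proof. intros E; apply (@mem_emp _ _ _ x); rewrite <- E; apply mem_sc; auto. Qed.
Lemma num_inj i j : num i = num j -> i = j.
Proof.
  revert j; induction i as [|i IH]; intros [|j]; simpl; intros E; auto.
  - destruct (sc_not_emp (eq_sym E)).
  - destruct (sc_not_emp E).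
  - f_equal; apply IH, sc_inj, E.
Qed.

Definition cMem (i j : V) : V := pr (num 0) (pr i j).
Definition cEq (i j : V) : V := pr (num 1) (pr i j).
Definition cFun (i j : V) : V := pr (num 2) (pr i j).
Definition cNeg (f : V) : V := pr (num 3) f.
Definition cAnd (f g : V) : V := pr (num 4) (pr f g).
Definition cEx (f : V) : V := pr (num 5) f.

Lemma code1_iff n p x : code1 mem n p x <-> p = pr (num n) x.
Proof.
  unfold code1; split.
  - intros [t [Ht Hp]]; apply is_num_iff in Ht; apply is_pair_iff in Hp; subst; auto.
  - intros ->; exists (num n); rewrite is_num_iff, is_pair_iff; auto.
Qed.
Lemma code2_iff n p x y : code2 mem n p x y <-> p = pr (num n) (pr x y).
Proof.
  unfold code2; split.
  - intros [q [Hq Hp]]; apply is_pair_iff in Hq; apply code1_iff in Hp; subst; auto.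
  - intros ->; exists (pr x y); rewrite is_pair_iff, code1_iff; auto.
Qed.

Lemma tm_cMem : tm (fun e => cMem (e 0) (e 1)).
Proof. unfold cMem; fo_tac. Qed.
Lemma tm_cEq : tm (fun e => cEq (e 0) (e 1)).
Proof. unfold cEq; fo_tac. Qed.
Lemma tm_cFun : tm (fun e => cFun (e 0) (e 1)).
Proof. unfold cFun; fo_tac. Qed.
Lemma tm_cAnd : tm (fun e => cAnd (e 0) (e 1)).
Proof. unfold cAnd; fo_tac. Qed.
Lemma tm_cNeg : tm (fun e => cNeg (e 0)).
Proof. unfold cNeg; fo_tac. Qed.
Lemma tm_cEx : tm (fun e => cEx (e 0)).
Proof. unfold cEx; fo_tac. Qed.
#[local] Hint Resolve tm_cMem tm_cEq tm_cFun tm_cAnd tm_cNeg tm_cEx : tm.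

Lemma fml_closed_iff F X : fml_closed mem F X <->
  (forall i j, i ∈ om -> j ∈ om -> cMem i j ∈ X /\ cEq i j ∈ X /\ (F <> None -> cFun i j ∈ X)) /\
  (forall f, f ∈ X -> cNeg f ∈ X /\ cEx f ∈ X) /\
  (forall f g, f ∈ X -> g ∈ X -> cAnd f g ∈ X).
Proof.
  unfold fml_closed, is_cMem, is_cEq, is_cFun, is_cNeg, is_cAnd, is_cEx; split.
  - intros [H1 [H2 [H3 [H4 [H5 H6]]]]]; split; [|split].
    + intros i j Hi Hj; rewrite <- is_nat_iff in Hi, Hj; split; [|split].
      * apply (H1 _ i j); auto; apply code2_iff; reflexivity.
      * apply (H2 _ i j); auto; apply code2_iff; reflexivity.
      * destruct F; [intros _|tauto]; apply (H3 _ i j); auto; apply code2_iff; reflexivity.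
    + intros f Hf; split; [apply (H4 _ f)|apply (H6 _ f)]; auto; apply code1_iff; reflexivity.
    + intros f g Hf Hg; apply (H5 _ f g); auto; apply code2_iff; reflexivity.
  - intros [H1 [H2 H3]]; repeat split.
    + intros p i j Hi Hj E; rewrite is_nat_iff in Hi, Hj; apply code2_iff in E; subst.
      apply (H1 i j); auto.
    + intros p i j Hi Hj E; rewrite is_nat_iff in Hi, Hj; apply code2_iff in E; subst.
      apply (H1 i j); auto.
    + destruct F; auto.
      intros p i j Hi Hj E; rewrite is_nat_iff in Hi, Hj; apply code2_iff in E; subst.
      apply (H1 i j); auto; discriminate.
    + intros p f Hf E; apply code1_iff in E; subst; apply (H2 f Hf).
    + intros p f g Hf Hg E; apply code2_iff in E; subst; apply (H3 f g); auto.
    + intros p f Hf E; apply code1_iff in E; subst; apply (H2 f Hf).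
Qed.

(** * Internal formulas *)

Section Formulas.
Context (F : option V).

Lemma fml_cMem i j : i ∈ om -> j ∈ om -> is_fml mem F (cMem i j).
Proof. intros Hi Hj X HX; apply fml_closed_iff in HX; apply HX; auto. Qed.
Lemma fml_cEq i j : i ∈ om -> j ∈ om -> is_fml mem F (cEq i j).
Proof. intros Hi Hj X HX; apply fml_closed_iff in HX; apply HX; auto. Qed.
Lemma fml_cFun i j : F <> None -> i ∈ om -> j ∈ om -> is_fml mem F (cFun i j).
Proof. intros HF Hi Hj X HX; apply fml_closed_iff in HX; apply (proj1 HX i j); auto. Qed.
Lemma fml_cNeg f : is_fml mem F f -> is_fml mem F (cNeg f).
Proof. intros Hf X HX; exact (proj1 (proj1 (proj2 (proj1 (fml_closed_iff F X) HX)) f (Hf X HX))). Qed.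
Lemma fml_cEx f : is_fml mem F f -> is_fml mem F (cEx f).
Proof. intros Hf X HX; exact (proj2 (proj1 (proj2 (proj1 (fml_closed_iff F X) HX)) f (Hf X HX))). Qed.
Lemma fml_cAnd f g : is_fml mem F f -> is_fml mem F g -> is_fml mem F (cAnd f g).
Proof. intros Hf Hg X HX; assert (HX' := HX); apply fml_closed_iff in HX; apply HX; auto. Qed.

Lemma num_Vom n : num n ∈ Vl om.
Proof. apply om_sub_Vl_om, num_nat. Qed.

(** V_ω is a set that contains all formulas; this allows induction on formulas by separation, and
    puts all formulas into the levels above ω. *)
Lemma Vom_closed : fml_closed mem F (Vl om).
Proof.
  apply fml_closed_iff; unfold cMem, cEq, cFun, cNeg, cAnd, cEx.
  repeat split; intros; repeat (apply (Vl_pr limit_om)); auto using num_Vom; apply om_sub_Vl_om; auto.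
Qed.
Lemma fml_Vom p : is_fml mem F p -> p ∈ Vl om.
Proof. intros H; apply H, Vom_closed. Qed.

Lemma fo_is_fml : fo (fun e => is_fml mem F (e 0)).
Proof. destruct F; [unfold is_fml, fml_closed; cbv iota|]; fo_tac. Qed.

(** The induction also reaches nonstandard formulas, which is why P has to be definable: the
    formulas with P form a closed set. *)
Lemma fml_ind (P : V -> Prop) : fo (fun e => P (e 0)) ->
  (forall i j, i ∈ om -> j ∈ om -> P (cMem i j)) ->
  (forall i j, i ∈ om -> j ∈ om -> P (cEq i j)) ->
  (F <> None -> forall i j, i ∈ om -> j ∈ om -> P (cFun i j)) ->
  (forall f, is_fml mem F f -> P f -> P (cNeg f)) ->
  (forall f g, is_fml mem F f -> P f -> is_fml mem F g -> P g -> P (cAnd f g)) ->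
  (forall f, is_fml mem F f -> P f -> P (cEx f)) ->
  forall p, is_fml mem F p -> P p.
Proof.
  intros HP H1 H2 H3 H4 H5 H6 p Hp.
  assert (HQ : fo (fun e => is_fml mem F (e 0) /\ P (e 0)))
    by (apply fo_and; [apply fo_is_fml|exact HP]).
  assert (HX : p ∈ cmp (Vl om) (fun p => is_fml mem F p /\ P p)).
  { apply Hp, fml_closed_iff.
    assert (E : forall p, is_fml mem F p -> P p -> p ∈ cmp (Vl om) (fun p => is_fml mem F p /\ P p)).
    { intros q Hq Pq; apply (cmp_iff (Vl om) HQ); split; auto; apply fml_Vom, Hq. }
    split; [|split].
    - intros i j Hi Hj; split; [|split].
      + apply E; auto using fml_cMem.
      + apply E; auto using fml_cEq.
      + intros HF; apply E; auto using fml_cFun.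
    - intros f Hf; apply (cmp_iff (Vl om) HQ) in Hf; destruct Hf as [_ [Ff Pf]].
      split; apply E; auto using fml_cNeg, fml_cEx.
    - intros f g Hf Hg; apply (cmp_iff (Vl om) HQ) in Hf, Hg; destruct Hf as [_ [Ff Pf]],
        Hg as [_ [Fg Pg]]; apply E; auto using fml_cAnd. }
  apply (cmp_iff (Vl om) HQ) in HX; tauto.
Qed.
End Formulas.

Lemma fml_none_some l p : is_fml mem None p -> is_fml mem (Some l) p.
Proof.
  intros Hp X HX; apply Hp; rewrite fml_closed_iff in HX |- *.
  destruct HX as [H1 H2]; split; auto; intros i j Hi Hj; destruct (H1 i j Hi Hj) as [A [B C]].
  split; auto; split; auto; tauto.
Qed.

(** * Assignments and truth predicates *)

Lemma assign_iff M s : assign mem M s <-> is_fun mem s om M.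
Proof.
  unfold assign; split; [intros [w [Hw H]]; apply is_omega_iff in Hw; subst; auto|].
  intros H; exists om; split; auto; apply om_spec.
Qed.
Lemma assign_val M s i : assign mem M s -> i ∈ om -> exists a, a ∈ M /\ pr i a ∈ s.
Proof. intros H Hi; apply assign_iff, is_fun_iff in H; destruct H as [_ [_ H]]; auto. Qed.
Lemma assign_fun M s i a b : assign mem M s -> pr i a ∈ s -> pr i b ∈ s -> a = b.
Proof. intros H; apply assign_iff, is_fun_iff in H; destruct H as [_ [H _]]; eauto. Qed.
Lemma assign_in M s i a : assign mem M s -> pr i a ∈ s -> i ∈ om /\ a ∈ M.
Proof.
  intros H Hi; apply assign_iff, is_fun_iff in H; destruct H as [H _].
  apply pr_in_cart, H, Hi.
Qed.
Lemma assign_sub M N s : sub mem M N -> assign mem M s -> assign mem N s.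
Proof.
  intros HMN; rewrite !assign_iff, !is_fun_iff; intros [H1 [H2 H3]]; split; [|split; auto].
  - intros p Hp; apply H1 in Hp; rewrite mem_cart in *; destruct Hp as [x [y [Hx [Hy ->]]]]; eauto 6.
  - intros x Hx; destruct (H3 x Hx) as [y [Hy H]]; eauto.
Qed.
Lemma assign_cart M s : assign mem M s -> sub mem s (cart om M).
Proof. intros H; apply assign_iff, is_fun_iff in H; apply H. Qed.

Lemma is_scons_iff t a s : is_scons mem t a s <->
  pr emp a ∈ t /\ forall i b, pr i b ∈ s -> pr (sc i) b ∈ t.
Proof.
  unfold is_scons; split; intros [H1 H2]; split.
  - apply gr_iff, H1, emp_spec.
  - intros i b H; apply gr_iff, (H2 i (sc i) b); [apply is_succ_iff; auto|apply gr_iff; auto].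
  - intros z Hz; apply is_empty_iff in Hz; subst; apply gr_iff; auto.
  - intros i j b Hj Hi; apply is_succ_iff in Hj; subst; apply gr_iff, H2, gr_iff, Hi.
Qed.
Lemma scons_exists M s a : assign mem M s -> a ∈ M ->
  exists t, assign mem M t /\ is_scons mem t a s.
Proof.
  intros Hs Ha.
  set (R := fun i b => (i = emp /\ b = a) \/ exists k, i = sc k /\ pr k b ∈ s).
  destruct (@fun_exists _ _ _ om M R) as [t [Ht Hpr]].
  - unfold R; fo_tac.
  - intros i Hi; destruct (nat_cases Hi) as [->|[k [Hk ->]]].
    + exists a; split; auto; left; auto.
    + destruct (assign_val Hs Hk) as [b [Hb H]]; exists b; split; auto; right; eauto.
  - intros i b b' _ [[Hi ->]|[k [Hi Hb]]] [[Hi' ->]|[k' [Hi' Hb']]]; auto; subst.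
    + destruct (sc_not_emp (eq_sym Hi')).
    + destruct (sc_not_emp Hi').
    + apply sc_inj in Hi'; subst; eapply assign_fun; eauto.
  - exists t; split; [apply assign_iff, Ht|]; apply is_scons_iff; split.
    + apply Hpr; split; [apply limit_emp, limit_om|]; split; auto; left; auto.
    + intros i b Hi; destruct (assign_in Hs Hi) as [Hi' Hb]; apply Hpr; split;
        [apply limit_sc; auto; apply limit_om|]; split; auto; right; eauto.
Qed.

Definition proj_fst (x : V) : V := un (cmp (un x) (fun p => exists y, x = pr p y)).
Lemma fst_pr x y : proj_fst (pr x y) = x.
Proof.
  assert (HP : fo (fun e => exists z, pr x y = pr (e 0) z)) by fo_tac.
  apply ext; intros z; unfold proj_fst; rewrite mem_un; split.
  - intros [p [Hp Hz]]; apply (cmp_iff _ HP) in Hp; destruct Hp as [_ [w E]].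
    apply pr_inj in E; destruct E; subst; auto.
  - intros Hz; exists x; split; auto; apply (cmp_iff _ HP); split; eauto.
    apply mem_un; exists (up x x); split; [apply up_l|apply up_l].
Qed.
Lemma tm_fst : tm (fun e => proj_fst (e 0)).
Proof.
  apply (@tm_by_elements _ _ _ _ (fun z e => exists p, p ∈ un (e 0) /\ (exists y, e 0 = pr p y) /\ z ∈ p));
    [|fo_tac].
  intros z e; unfold proj_fst; rewrite mem_un.
  assert (HP : fo (fun e' => exists z, e 0 = pr (e' 0) z)) by fo_tac.
  split; intros [p H]; exists p; rewrite (cmp_iff _ HP) in *; tauto.
Qed.
#[local] Hint Resolve tm_fst : tm.

Ltac code_ineq :=
  match goal with
  | H : pr (num ?i) _ = pr (num ?j) _ |- _ =>
      exfalso; apply pr_inj in H; destruct H as [H _]; apply num_inj in H; discriminate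
  end.

(** Recursion on the rank of the formula, since a subformula is a component of its code. The bound
    on S matters later: it places S in every limit level above ω that contains M. *)
Lemma truth_exists_some M l : exists S,
  sub mem S (cart (Vl om) (pw (cart om M))) /\ is_truth mem M (Some l) S.
Proof.
  set (Asg := cmp (pw (cart om M)) (assign mem M)).
  assert (HA : forall s, s ∈ Asg <-> assign mem M s).
  { intros s; unfold Asg; rewrite (@cmp_iff _ _ _ _ (assign mem M)); [|fo_tac].
    split; [tauto|]; intros H; split; auto; apply mem_pw, assign_cart, H. }
  set (Phi := fun U x => exists p s, x = pr p s /\
    ((exists i j a b, p = cMem i j /\ pr i a ∈ s /\ pr j b ∈ s /\ a ∈ b) \/
     (exists i j a, p = cEq i j /\ pr i a ∈ s /\ pr j a ∈ s) \/
     (exists i j a b, p = cFun i j /\ pr i a ∈ s /\ pr j b ∈ s /\ pr a b ∈ l) \/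
     (exists f, p = cNeg f /\ ~ pr f s ∈ U) \/
     (exists f g, p = cAnd f g /\ pr f s ∈ U /\ pr g s ∈ U) \/
     (exists f a t, p = cEx f /\ a ∈ M /\ t ∈ Asg /\ is_scons mem t a s /\ pr f t ∈ U))).
  destruct (@set_recursion _ _ _ (cart (Vl om) Asg) (fun x => rk (proj_fst x)) Phi) as [A [HAX HAr]].
  - fo_tac.
  - unfold Phi; fo_tac.
  - intros; apply ord_rk.
  - exists A; split.
    { intros x Hx; apply HAX, mem_cart in Hx; destruct Hx as [p [s [Hp [Hs ->]]]].
      apply pr_in_cart; split; auto; apply mem_pw, assign_cart, HA, Hs. }
    intros p s Hp Hs.
    assert (HpV := fml_Vom Hp).
    destruct (HAr (pr p s)) as [U [HU HAp]]; [apply pr_in_cart; split; auto; apply HA, Hs|].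
    (* At formulas of smaller rank the recursive approximation U already agrees with A. *)
    assert (Hlow : forall f t, f ∈ Vl om -> rk f ∈ rk p -> (pr f t ∈ U <-> pr f t ∈ A)).
    { intros f t Hf Hr; rewrite HU, !fst_pr; tauto. }
    unfold is_cMem, is_cEq, is_cFun, is_cNeg, is_cAnd, is_cEx.
    assert (HApp : pr p s ∈ A <-> exists q s', pr p s = pr q s' /\ _) by exact HAp.
    clear HAp; unfold cMem, cEq, cFun, cNeg, cAnd, cEx in HApp.
    split; [|split; [|split; [|split; [|split]]]].
    + intros i j E; apply code2_iff in E; subst p; rewrite gr_iff, HApp; split.
      * intros [q [s' [E H]]]; apply pr_inj in E; destruct E as [<- <-].
        destruct H as [[i' [j' [a [b [E H]]]]]|H].
        -- apply pr_inj in E; destruct E as [_ E]; apply pr_inj in E; destruct E; subst.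
           exists a, b; rewrite !gr_iff; tauto.
        -- repeat (let H' := fresh in destruct H as [H'|H]; [decompose record H'; code_ineq|]).
           decompose record H; code_ineq.
      * intros [a [b H]]; rewrite !gr_iff in H; exists (pr (num 0) (pr i j)), s; split; auto.
        left; eauto 10.
    + intros i j E; apply code2_iff in E; subst p; rewrite gr_iff, HApp; split.
      * intros [q [s' [E H]]]; apply pr_inj in E; destruct E as [<- <-].
        destruct H as [H|[[i' [j' [a [E H]]]]|H]].
        -- decompose record H; code_ineq.
        -- apply pr_inj in E; destruct E as [_ E]; apply pr_inj in E; destruct E; subst.
           exists a; rewrite !gr_iff; tauto.
        -- repeat (let H' := fresh in destruct H as [H'|H]; [decompose record H'; code_ineq|]).
           decompose record H; code_ineq.
      * intros [a H]; rewrite !gr_iff in H; exists (pr (num 1) (pr i j)), s; split; auto.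
        right; left; eauto 10.
    + intros i j E; apply code2_iff in E; subst p; rewrite gr_iff, HApp; split.
      * intros [q [s' [E H]]]; apply pr_inj in E; destruct E as [<- <-].
        destruct H as [H|[H|[[i' [j' [a [b [E H]]]]]|H]]].
        -- decompose record H; code_ineq.
        -- decompose record H; code_ineq.
        -- apply pr_inj in E; destruct E as [_ E]; apply pr_inj in E; destruct E; subst.
           exists a, b; rewrite !gr_iff; tauto.
        -- repeat (let H' := fresh in destruct H as [H'|H]; [decompose record H'; code_ineq|]).
           decompose record H; code_ineq.
      * intros [a [b H]]; rewrite !gr_iff in H; exists (pr (num 2) (pr i j)), s; split; auto.
        right; right; left; eauto 10.
    + intros f E; apply code1_iff in E; subst p; rewrite !gr_iff, HApp.
      destruct (Vl_pr_inv limit_om HpV) as [_ Hf]; destruct (pr_rk (num 3) f) as [_ Hr].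
      rewrite <- (Hlow f s Hf Hr); split.
      * intros [q [s' [E H]]]; apply pr_inj in E; destruct E as [<- <-].
        destruct H as [H|[H|[H|[[f' [E H]]|[H|H]]]]]; try (decompose record H; code_ineq).
        apply pr_inj in E; destruct E as [_ ->]; auto.
      * intros H; exists (pr (num 3) f), s; split; auto; right; right; right; left; eauto.
    + intros f g E; apply code2_iff in E; subst p; rewrite !gr_iff, HApp.
      destruct (Vl_pr_inv limit_om HpV) as [_ Hfg]; destruct (Vl_pr_inv limit_om Hfg) as [Hf Hg].
      destruct (pr_rk (num 4) (pr f g)) as [_ Hr]; destruct (pr_rk f g) as [Hr1 Hr2].
      rewrite <- (Hlow f s Hf (ord_trans (ord_rk _) Hr1 Hr)).
      rewrite <- (Hlow g s Hg (ord_trans (ord_rk _) Hr2 Hr)); split.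
      * intros [q [s' [E H]]]; apply pr_inj in E; destruct E as [<- <-].
        destruct H as [H|[H|[H|[H|[[f' [g' [E H]]]|H]]]]]; try (decompose record H; code_ineq).
        apply pr_inj in E; destruct E as [_ E]; apply pr_inj in E; destruct E; subst; auto.
      * intros H; exists (pr (num 4) (pr f g)), s; split; auto; right; right; right; right; left; eauto.
    + intros f E; apply code1_iff in E; subst p; rewrite !gr_iff, HApp.
      destruct (Vl_pr_inv limit_om HpV) as [_ Hf]; destruct (pr_rk (num 5) f) as [_ Hr]; split.
      * intros [q [s' [E H]]]; apply pr_inj in E; destruct E as [<- <-].
        destruct H as [H|[H|[H|[H|[H|[f' [a [t [E [Ha [Ht [Hts H]]]]]]]]]]]];
          try (decompose record H; code_ineq).
        apply pr_inj in E; destruct E as [_ <-]; exists a, t; rewrite gr_iff, <- HA.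
        rewrite (Hlow f t Hf Hr) in H; auto.
      * intros [a [t H]]; rewrite gr_iff, <- HA, <- (Hlow f t Hf Hr) in H.
        exists (pr (num 5) f), s; split; auto; do 5 right; exists f, a, t; tauto.
Qed.

Lemma is_truth_none M l S : is_truth mem M (Some l) S -> is_truth mem M None S.
Proof.
  intros H p s Hp Hs; destruct (H p s (fml_none_some (l := l) Hp) Hs) as [H1 [H2 [_ H4]]].
  split; auto; split; auto; split; auto.
Qed.
Lemma truth_exists_bounded M F : exists S,
  sub mem S (cart (Vl om) (pw (cart om M))) /\ is_truth mem M F S.
Proof.
  destruct F as [l|]; [apply truth_exists_some|].
  (* A truth set for an expanded structure is also one for its reduct, so the empty function may be
     added. *)
  destruct (truth_exists_some M emp) as [S [HS HT]]; exists S; split; auto.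
  eapply is_truth_none, HT.
Qed.
Lemma truth_exists M F : exists S, is_truth mem M F S.
Proof. destruct (truth_exists_bounded M F) as [S [_ HS]]; eauto. Qed.

Section Truth.
Context (M : V) (F : option V) (S : V) (HS : is_truth mem M F S).

Lemma truth_cMem i j s : i ∈ om -> j ∈ om -> assign mem M s ->
  (pr (cMem i j) s ∈ S <-> exists a b, pr i a ∈ s /\ pr j b ∈ s /\ a ∈ b).
Proof.
  intros Hi Hj Hs; destruct (HS (fml_cMem (F := F) Hi Hj) Hs) as [H _].
  rewrite <- gr_iff, (H i j) by (apply code2_iff; reflexivity).
  split; intros [a [b E]]; exists a, b; rewrite !gr_iff in *; auto.
Qed.
Lemma truth_cEq i j s : i ∈ om -> j ∈ om -> assign mem M s ->
  (pr (cEq i j) s ∈ S <-> exists a, pr i a ∈ s /\ pr j a ∈ s).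
Proof.
  intros Hi Hj Hs; destruct (HS (fml_cEq (F := F) Hi Hj) Hs) as [_ [H _]].
  rewrite <- gr_iff, (H i j) by (apply code2_iff; reflexivity).
  split; intros [a E]; exists a; rewrite !gr_iff in *; auto.
Qed.
Lemma truth_cNeg f s : is_fml mem F f -> assign mem M s ->
  (pr (cNeg f) s ∈ S <-> ~ pr f s ∈ S).
Proof.
  intros Hf Hs; destruct (HS (fml_cNeg Hf) Hs) as [_ [_ [_ [H _]]]].
  rewrite <- !gr_iff; apply H, code1_iff; reflexivity.
Qed.
Lemma truth_cAnd f g s : is_fml mem F f -> is_fml mem F g -> assign mem M s ->
  (pr (cAnd f g) s ∈ S <-> pr f s ∈ S /\ pr g s ∈ S).
Proof.
  intros Hf Hg Hs; destruct (HS (fml_cAnd Hf Hg) Hs) as [_ [_ [_ [_ [H _]]]]].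
  rewrite <- !gr_iff; apply H, code2_iff; reflexivity.
Qed.
Lemma truth_cEx f s : is_fml mem F f -> assign mem M s ->
  (pr (cEx f) s ∈ S <->
   exists a t, a ∈ M /\ assign mem M t /\ is_scons mem t a s /\ pr f t ∈ S).
Proof.
  intros Hf Hs; destruct (HS (fml_cEx Hf) Hs) as [_ [_ [_ [_ [_ H]]]]].
  rewrite <- gr_iff, (H f) by (apply code1_iff; reflexivity).
  split; intros [a [t E]]; exists a, t; rewrite gr_iff in *; auto.
Qed.

End Truth.

Lemma truth_cFun M l S : is_truth mem M (Some l) S ->
  forall i j s, i ∈ om -> j ∈ om -> assign mem M s ->
  (pr (cFun i j) s ∈ S <-> exists a b, pr i a ∈ s /\ pr j b ∈ s /\ pr a b ∈ l).
Proof.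
  intros HS i j s Hi Hj Hs.
  assert (Hf : is_fml mem (Some l) (cFun i j)) by (apply fml_cFun; auto; discriminate).
  destruct (HS _ _ Hf Hs) as [_ [_ [H _]]].
  rewrite <- gr_iff, (H i j) by (apply code2_iff; reflexivity).
  split; intros [a [b E]]; exists a, b; rewrite !gr_iff in *; auto.
Qed.

(** [sat] asks for some truth set; by this agreement any one of them can be used to compute it. *)
Lemma truth_unique M F S S' : is_truth mem M F S -> is_truth mem M F S' ->
  forall p, is_fml mem F p -> forall s, assign mem M s -> (pr p s ∈ S <-> pr p s ∈ S').
Proof.
  intros HS HS'.
  apply (@fml_ind F (fun p => forall s, assign mem M s -> (pr p s ∈ S <-> pr p s ∈ S'))); [fo_tac| | | | | |].
  - intros i j Hi Hj s Hs; rewrite (truth_cMem HS Hi Hj Hs), (truth_cMem HS' Hi Hj Hs); tauto.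
  - intros i j Hi Hj s Hs; rewrite (truth_cEq HS Hi Hj Hs), (truth_cEq HS' Hi Hj Hs); tauto.
  - destruct F as [l|]; [|congruence].
    intros _ i j Hi Hj s Hs; rewrite (truth_cFun HS Hi Hj Hs), (truth_cFun HS' Hi Hj Hs); tauto.
  - intros f Hf IH s Hs; rewrite (truth_cNeg HS Hf Hs), (truth_cNeg HS' Hf Hs), (IH s Hs); tauto.
  - intros f g Hf IHf Hg IHg s Hs.
    rewrite (truth_cAnd HS Hf Hg Hs), (truth_cAnd HS' Hf Hg Hs), (IHf s Hs), (IHg s Hs); tauto.
  - intros f Hf IH s Hs; rewrite (truth_cEx HS Hf Hs), (truth_cEx HS' Hf Hs).
    split; intros [a [t [Ha [Ht [Hts H]]]]]; exists a, t; rewrite (IH t Ht) in *; auto.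
Qed.

Lemma sat_iff M F S : is_truth mem M F S ->
  forall p s, is_fml mem F p -> assign mem M s -> (sat mem M F p s <-> pr p s ∈ S).
Proof.
  intros HS p s Hp Hs; unfold sat; split.
  - intros [S' [HS' H]]; apply gr_iff in H; apply (truth_unique HS' HS Hp Hs), H.
  - intros H; exists S; rewrite gr_iff; auto.
Qed.

(** * Translation of metatheoretic formulas into internal ones *)

Fixpoint code (p : form) : V :=
  match p with
  | FMem i j => cMem (num i) (num j)
  | FEq i j => cEq (num i) (num j)
  | FNeg q => cNeg (code q)
  | FAnd q r => cAnd (code q) (code r)
  | FEx q => cEx (code q)
  end.
Lemma fml_code F p : is_fml mem F (code p).
Proof. induction p; simpl; auto using fml_cMem, fml_cEq, fml_cNeg, fml_cAnd, fml_cEx, num_nat. Qed.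

(** A set of the model as a structure of the metatheory, in which the uniformly given formulas can
    be evaluated. *)
Definition carrier (M : V) : Type := {x : V | x ∈ M}.
Definition cmem (M : V) (x y : carrier M) : Prop := proj1_sig x ∈ proj1_sig y.

(** A code of a metatheoretic formula mentions only numerals as variables, so only the values of s
    at standard numbers count, and these form e. *)
Lemma truth_code M F S : is_truth mem M F S ->
  forall p s (e : nat -> carrier M), assign mem M s ->
  (forall i, pr (num i) (proj1_sig (e i)) ∈ s) ->
  (pr (code p) s ∈ S <-> fsat (@cmem M) e p).
Proof.
  intros HS p; induction p as [i j|i j|p IH|p IHp q IHq|p IH]; intros s e Hs He; simpl.
  - rewrite (truth_cMem HS (num_nat i) (num_nat j) Hs); unfold cmem; split; [|eauto].
    intros [a [b [Ha [Hb H]]]].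
    rewrite (assign_fun Hs (He i) Ha), (assign_fun Hs (He j) Hb); auto.
  - rewrite (truth_cEq HS (num_nat i) (num_nat j) Hs); split.
    + intros [a [Ha Hb]]; apply eq_sig_hprop.
      { intros; apply proof_irrelevance. }
      rewrite (assign_fun Hs (He i) Ha), (assign_fun Hs (He j) Hb); auto.
    + intros E; exists (proj1_sig (e i)); split; auto; rewrite E; auto.
  - rewrite (truth_cNeg HS (fml_code (F := F) p) Hs), (IH s e Hs He); tauto.
  - rewrite (truth_cAnd HS (fml_code (F := F) p) (fml_code (F := F) q) Hs), (IHp s e Hs He), (IHq s e Hs He); tauto.
  - rewrite (truth_cEx HS (fml_code (F := F) p) Hs); split.
    + intros [a [t [Ha [Ht [Hts H]]]]]; exists (exist _ a Ha).
      apply (IH t); auto; apply is_scons_iff in Hts; 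
        intros [|i]; [apply Hts|apply (proj2 Hts), He].
    + intros [[a Ha] H]; destruct (scons_exists Hs Ha) as [t [Ht Hts]].
      exists a, t; repeat split; auto; try apply Hts.
      apply (IH t) in H; auto; apply is_scons_iff in Hts; 
        intros [|i]; [apply Hts|apply (proj2 Hts), He].
Qed.

Lemma sat_code M F p s : assign mem M s ->
  exists e : nat -> carrier M, (forall i, pr (num i) (proj1_sig (e i)) ∈ s) /\
  (sat mem M F (code p) s <-> fsat (@cmem M) e p).
Proof.
  intros Hs.
  (* The internal assignment s is turned into a function of the metatheory by choosing its values at
     the numerals. *)
  assert (H : forall i, {x : carrier M | pr (num i) (proj1_sig x) ∈ s}).
  { intros i; apply constructive_indefinite_description.
    destruct (assign_val Hs (num_nat i)) as [a [Ha H]]; exists (exist _ a Ha); exact H. }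
  exists (fun i => proj1_sig (H i)); split; [intros i; apply (proj2_sig (H i))|].
  destruct (truth_exists M F) as [S HS].
  rewrite (sat_iff HS (fml_code (F := F) p) Hs); apply (truth_code HS); auto.
  intros i; apply (proj2_sig (H i)).
Qed.

(* If l and l' are defined in M and N by the same formula P, elementarity
   extends to the expanded structures: the atoms l(x_i) = x_j are replaced by
   ∃v ∃u (u = x_i ∧ v = x_j ∧ P(u, v)). *)
Definition defines (M l P : V) : Prop :=
  forall s, assign mem M s -> forall a b, pr (num 0) a ∈ s -> pr (num 1) b ∈ s ->
  (sat mem M None P s <-> pr a b ∈ l).

Lemma atom_translation M l P S i j : defines M l P -> is_fml mem None P ->
  is_truth mem M None S -> i ∈ om -> j ∈ om ->
  forall s, assign mem M s ->
  (pr (cEx (cEx (cAnd (cEq (num 0) (sc (sc i))) (cAnd (cEq (num 1) (sc (sc j))) P)))) s ∈ S <->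
   exists a b, pr i a ∈ s /\ pr j b ∈ s /\ pr a b ∈ l).
Proof.
  intros HD HP HS Hi Hj s Hs.
  assert (Hsc : forall i, i ∈ om -> sc i ∈ om) by (intros; apply limit_sc; auto; apply limit_om).
  assert (F1 : is_fml mem None (cEq (num 0) (sc (sc i)))) by auto using fml_cEq, num_nat.
  assert (F2 : is_fml mem None (cEq (num 1) (sc (sc j)))) by auto using fml_cEq, num_nat.
  assert (F3 := fml_cAnd F1 (fml_cAnd F2 HP)).
  rewrite (truth_cEx HS (fml_cEx F3) Hs); split.
  - intros [a [t [Ha [Ht [Hts H]]]]]; apply (truth_cEx HS F3 Ht) in H.
    destruct H as [b [u [Hb [Hu [Hut H]]]]].
    apply (truth_cAnd HS F1 (fml_cAnd F2 HP) Hu) in H; destruct H as [H1 H2].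
    apply (truth_cAnd HS F2 HP Hu) in H2; destruct H2 as [H2 H3].
    apply (truth_cEq HS (num_nat 0) (Hsc _ (Hsc _ Hi)) Hu) in H1; destruct H1 as [a' [A1 A2]].
    apply (truth_cEq HS (num_nat 1) (Hsc _ (Hsc _ Hj)) Hu) in H2; destruct H2 as [b' [B1 B2]].
    apply is_scons_iff in Hts, Hut.
    destruct (assign_val Hs Hi) as [x [Hx Hix]], (assign_val Hs Hj) as [y [Hy Hjy]].
    assert (E1 : x = a') by (eapply assign_fun; [exact Hu| |exact A2]; apply Hut, Hts; auto).
    assert (E2 : y = b') by (eapply assign_fun; [exact Hu| |exact B2]; apply Hut, Hts; auto).
    subst; exists a', b'; split; auto; split; auto.
    apply (HD u Hu a' b' A1 B1), (sat_iff HS HP Hu), H3.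
  - intros [a [b [Ha [Hb H]]]].
    destruct (assign_in Hs Ha) as [_ HaM], (assign_in Hs Hb) as [_ HbM].
    destruct (scons_exists Hs HbM) as [t [Ht Hts]].
    destruct (scons_exists Ht HaM) as [u [Hu Hut]].
    (* The outer quantifier binds the value b and the inner one the argument a, so that P finds them
       as variables 1 and 0. *)
    exists b, t; repeat split; auto; try apply Hts.
    apply (truth_cEx HS F3 Ht); exists a, u; split; auto; split; auto; split; auto.
    apply is_scons_iff in Hts, Hut.
    assert (U1 : pr (num 1) b ∈ u) by (apply Hut, Hts).
    assert (U0 : pr (num 0) a ∈ u) by (apply Hut).
    apply (truth_cAnd HS F1 (fml_cAnd F2 HP) Hu); split; [|apply (truth_cAnd HS F2 HP Hu); split].
    + apply (truth_cEq HS (num_nat 0) (Hsc _ (Hsc _ Hi)) Hu); exists a; split; auto.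
      apply Hut, Hts; auto.
    + apply (truth_cEq HS (num_nat 1) (Hsc _ (Hsc _ Hj)) Hu); exists b; split; auto.
      apply Hut, Hts; auto.
    + apply (sat_iff HS HP Hu), (HD u Hu a b U0 U1), H.
Qed.

Lemma elem_sub_expand M N l l' P : is_fml mem None P -> defines M l P -> defines N l' P ->
  elem_sub mem M None N None -> elem_sub mem M (Some l) N (Some l').
Proof.
  intros HP HM HN [Hsub Hel]; split; auto.
  destruct (truth_exists M (Some l)) as [S HS], (truth_exists N (Some l')) as [T HT].
  destruct (truth_exists M None) as [S0 HS0], (truth_exists N None) as [T0 HT0].
  (* No translation function is defined: it suffices that some q works for M and N simultaneously,
     and this is proved by internal induction, for nonstandard p as well. *)
  assert (H : forall p, is_fml mem (Some l) p -> exists q, is_fml mem None q /\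
    (forall s, assign mem M s -> (pr p s ∈ S <-> pr q s ∈ S0)) /\
    (forall s, assign mem N s -> (pr p s ∈ T <-> pr q s ∈ T0))).
  { apply (@fml_ind (Some l) (fun p => exists q, is_fml mem None q /\
      (forall s, assign mem M s -> (pr p s ∈ S <-> pr q s ∈ S0)) /\
      (forall s, assign mem N s -> (pr p s ∈ T <-> pr q s ∈ T0)))); [fo_tac| | | | | |].
    - intros i j Hi Hj; exists (cMem i j); split; [apply fml_cMem; auto|].
      split; intros s Hs.
      + rewrite (truth_cMem HS Hi Hj Hs), (truth_cMem HS0 Hi Hj Hs); tauto.
      + rewrite (truth_cMem HT Hi Hj Hs), (truth_cMem HT0 Hi Hj Hs); tauto.
    - intros i j Hi Hj; exists (cEq i j); split; [apply fml_cEq; auto|].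
      split; intros s Hs.
      + rewrite (truth_cEq HS Hi Hj Hs), (truth_cEq HS0 Hi Hj Hs); tauto.
      + rewrite (truth_cEq HT Hi Hj Hs), (truth_cEq HT0 Hi Hj Hs); tauto.
    - intros _ i j Hi Hj.
      exists (cEx (cEx (cAnd (cEq (num 0) (sc (sc i))) (cAnd (cEq (num 1) (sc (sc j))) P)))).
      split.
      + assert (Hsc : forall i, i ∈ om -> sc i ∈ om) by (intros; apply limit_sc; auto; apply limit_om).
        auto 10 using fml_cEx, fml_cAnd, fml_cEq, num_nat.
      + split; intros s Hs.
        * rewrite (truth_cFun HS Hi Hj Hs), (atom_translation HM HP HS0 Hi Hj Hs); tauto.
        * rewrite (truth_cFun HT Hi Hj Hs), (atom_translation HN HP HT0 Hi Hj Hs); tauto.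
    - intros f Hf [q [Hq [H1 H2]]]; exists (cNeg q); split; [apply fml_cNeg; auto|].
      split; intros s Hs.
      + rewrite (truth_cNeg HS Hf Hs), (truth_cNeg HS0 Hq Hs), (H1 s Hs); tauto.
      + rewrite (truth_cNeg HT Hf Hs), (truth_cNeg HT0 Hq Hs), (H2 s Hs); tauto.
    - intros f g Hf [q [Hq [H1 H2]]] Hg [r [Hr [H3 H4]]]; exists (cAnd q r);
        split; [apply fml_cAnd; auto|]; split; intros s Hs.
      + rewrite (truth_cAnd HS Hf Hg Hs), (truth_cAnd HS0 Hq Hr Hs), (H1 s Hs), (H3 s Hs); tauto.
      + rewrite (truth_cAnd HT Hf Hg Hs), (truth_cAnd HT0 Hq Hr Hs), (H2 s Hs), (H4 s Hs); tauto.
    - intros f Hf [q [Hq [H1 H2]]]; exists (cEx q); split; [apply fml_cEx; auto|].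
      split; intros s Hs.
      + rewrite (truth_cEx HS Hf Hs), (truth_cEx HS0 Hq Hs).
        split; intros [a [t [Ha [Ht [Hts H]]]]]; exists a, t; rewrite (H1 t Ht) in *; auto.
      + rewrite (truth_cEx HT Hf Hs), (truth_cEx HT0 Hq Hs).
        split; intros [a [t [Ha [Ht [Hts H]]]]]; exists a, t; rewrite (H2 t Ht) in *; auto. }
  intros p s Hp Hs; destruct (H p Hp) as [q [Hq [H1 H2]]].
  assert (Hs' := assign_sub Hsub Hs).
  (* The formulas of the expanded language do not depend on the function, so [Hp] holds for l' by
     conversion. *)
  rewrite (sat_iff HS Hp Hs), (sat_iff HT (p := p) Hp Hs'), (H1 s Hs), (H2 s Hs').
  rewrite <- (sat_iff HS0 Hq Hs), <- (sat_iff HT0 Hq Hs'); apply Hel; auto.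
Qed.

End Satisfaction.
#[local] Hint Resolve tm_cMem tm_cEq tm_cFun tm_cAnd tm_cNeg tm_cEx tm_fst : tm.

(** * Codes and their well-order *)

Section Codes.

Context {V : Type} {mem : V -> V -> Prop} {hZFC : ZFC mem}.
Local Notation "x ∈ y" := (mem x y) (at level 70, no associativity).
Local Notation fo := (@fo V mem).
Local Notation tm := (@tm V mem).

Lemma rk_ind (P : V -> Prop) : fo (fun e => P (e 0)) ->
  (forall x, (forall y, rk y ∈ rk x -> P y) -> P x) -> forall x, P x.
Proof.
  intros HP IH.
  assert (H : forall r, ord mem r -> forall x, rk x = r -> P x).
  { apply (@ord_ind _ _ _ (fun r => forall x, rk x = r -> P x)); [fo_tac|].
    intros r Or IHr x <-; apply IH; intros y Hy; exact (IHr _ Hy y eq_refl). }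
  intros x; exact (H _ (ord_rk x) x eq_refl).
Qed.

(** This separates the two kinds of codes: a nonempty ordinal contains the empty set, while a
    Kuratowski pair is nonempty and has only nonempty elements. *)
Lemma pr_not_ord x y : ~ ord mem (pr x y).
Proof.
  intros O; destruct (ord_mem_or_le ord_emp O) as [H|[H|H]].
  - exact (emp_not_in_pr H).
  - exact (mem_emp H).
  - exact (pr_not_emp H).
Qed.

Lemma cod_ord a : ord mem a -> is_cod mem a.
Proof.
  intros Oa; exists (up a a); split; [apply up_l|].
  intros y Hy; apply mem_up in Hy; left; destruct Hy; subst; auto.
Qed.
Lemma cod_pr x y : is_cod mem x -> is_cod mem y -> is_cod mem (pr x y).
Proof.
  intros [t [Hx Ht]] [u [Hy Hu]].
  exists (cup (cup t u) (up (pr x y) (pr x y))); split.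
  - apply mem_cup; right; apply up_l.
  - intros z Hz; rewrite !mem_cup, mem_up in Hz; destruct Hz as [[Hz|Hz]|Hz].
    + destruct (Ht z Hz) as [O|[z1 [z2 [H1 [H2 E]]]]]; auto.
      right; exists z1, z2; rewrite !mem_cup; auto.
    + destruct (Hu z Hz) as [O|[z1 [z2 [H1 [H2 E]]]]]; auto.
      right; exists z1, z2; rewrite !mem_cup; auto.
    + right; exists x, y; rewrite !mem_cup, is_pair_iff; split; [auto|split; [auto|]].
      destruct Hz; auto.
Qed.
Lemma cod_inv c : is_cod mem c ->
  ord mem c \/ exists x y, c = pr x y /\ is_cod mem x /\ is_cod mem y.
Proof.
  intros [t [Hc Ht]]; destruct (Ht c Hc) as [O|[x [y [Hx [Hy E]]]]]; auto.
  apply is_pair_iff in E; right; exists x, y; split; auto; split; exists t; auto.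
Qed.
(** Formulas are pairs built up from natural numbers, so they are codes as they stand. *)
Lemma cod_fml p : is_fml mem None p -> is_cod mem p.
Proof.
  assert (Hn : forall i, i ∈ om -> is_cod mem i) by (intros i Hi; apply cod_ord, (ord_mem ord_om Hi)).
  apply (@fml_ind _ _ _ None (is_cod mem)); [fo_tac| | |congruence| | |];
    intros; repeat apply cod_pr; auto; apply Hn, num_nat.
Qed.

Lemma rank_lt_iff x y : rank_lt mem x y <-> rk x ∈ rk y.
Proof.
  split.
  - intros [v [a [Hv [Hx Hy]]]]; apply is_Vlevel_iff in Hv; destruct Hv as [Oa ->].
    rewrite mem_Vl_rk in Hx, Hy by auto.
    destruct (ord_mem_or_le (ord_rk y) Oa) as [H|H]; [tauto|].
    exact (mem_ole_trans (ord_rk y) Hx H).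
  - intros H; exists (Vl (rk y)), (rk y); rewrite is_Vlevel_iff; split; [auto using ord_rk|].
    rewrite !mem_Vl_rk by apply ord_rk; split; auto; apply mem_irrefl.
Qed.

(** The clause looks only at components of x and y. This locality gives existence and uniqueness of
    the order on each level by induction on rank. *)
Lemma lt_clause_cong A B x y :
  (forall x1 y1, rk x1 ∈ rk x -> rk y1 ∈ rk y -> (pr x1 y1 ∈ A <-> pr x1 y1 ∈ B)) ->
  (lt_clause mem A x y <-> lt_clause mem B x y).
Proof.
  intros H; unfold lt_clause.
  apply or_iff_compat_l, and_iff_compat_l, or_iff_compat_l.
  split; intros [x1 [x2 [y1 [y2 [Ex [Ey E]]]]]]; exists x1, x2, y1, y2; (split; [auto|split; [auto|]]);
    apply is_pair_iff in Ex, Ey; subst; rewrite !gr_iff in *;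
    destruct (pr_rk x1 x2), (pr_rk y1 y2);
    (destruct E as [E|[E1 E]]; [left|right; split; auto]; apply H; auto).
Qed.

Lemma good_order_exists a : ord mem a ->
  exists A, sub mem A (cart (Vl a) (Vl a)) /\ good_order mem A (Vl a).
Proof.
  intros Oa; set (Phi := fun U z => exists x y, z = pr x y /\ lt_clause mem U x y).
  destruct (@set_recursion _ _ _ (cart (Vl a) (Vl a)) (fun z => rk (proj_fst z)) Phi) as [A [HA HR]].
  - fo_tac.
  - unfold Phi; fo_tac.
  - intros; apply ord_rk.
  - exists A; split; auto; intros x y Hx Hy.
    destruct (HR (pr x y)) as [U [HU E]]; [apply pr_in_cart; auto|].
    rewrite gr_iff, E; rewrite (@lt_clause_cong A U).
    + unfold Phi; split; [|eauto].
      intros [x' [y' [E' H]]]; apply pr_inj in E'; destruct E'; subst; auto.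
    + intros x1 y1 H1 H2; rewrite HU, !fst_pr; tauto.
Qed.

Lemma good_order_agree a b A B : ord mem a -> ord mem b ->
  good_order mem A (Vl a) -> good_order mem B (Vl b) ->
  forall x y, x ∈ Vl a -> y ∈ Vl a -> x ∈ Vl b -> y ∈ Vl b -> (pr x y ∈ A <-> pr x y ∈ B).
Proof.
  intros Oa Ob HA HB.
  apply (@rk_ind (fun x => forall y, x ∈ Vl a -> y ∈ Vl a -> x ∈ Vl b -> y ∈ Vl b ->
    (pr x y ∈ A <-> pr x y ∈ B))); [fo_tac|].
  intros x IH y Hxa Hya Hxb Hyb; rewrite <- !gr_iff, (HA x y), (HB x y) by auto.
  apply lt_clause_cong; intros x1 y1 H1 H2.
  rewrite mem_Vl_rk in Hxa, Hya, Hxb, Hyb by auto.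
  apply IH; auto; apply mem_Vl_rk; auto; eapply ord_trans; eauto.
Qed.

Lemma common_level x y : exists a, ord mem a /\ x ∈ Vl a /\ y ∈ Vl a.
Proof.
  destruct (in_Vl_exists (up x y)) as [a [Oa H]]; exists a; split; auto.
  split; apply (Vl_trans Oa H); apply mem_up; auto.
Qed.

Lemma cod_lt_good a A x y : ord mem a -> good_order mem A (Vl a) ->
  x ∈ Vl a -> y ∈ Vl a -> (cod_lt mem x y <-> pr x y ∈ A).
Proof.
  intros Oa HA Hx Hy; split.
  - intros [B [v [b [Hv [Hx' [Hy' [HB H]]]]]]]; apply is_Vlevel_iff in Hv.
    destruct Hv as [Ob ->]; apply gr_iff in H.
    apply (good_order_agree Ob Oa HB HA); auto.
  - intros H; exists A, (Vl a), a; rewrite is_Vlevel_iff, gr_iff; auto 7.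
Qed.

Lemma cod_lt_iff x y : cod_lt mem x y <-> rk x ∈ rk y \/
  (~ rk y ∈ rk x /\ ((ord mem x /\ ~ ord mem y) \/
    exists x1 x2 y1 y2, x = pr x1 x2 /\ y = pr y1 y2 /\
      (cod_lt mem x1 y1 \/ (x1 = y1 /\ cod_lt mem x2 y2)))).
Proof.
  destruct (common_level x y) as [a [Oa [Hx Hy]]].
  destruct (good_order_exists Oa) as [A [_ HA]].
  rewrite (cod_lt_good Oa HA Hx Hy), <- gr_iff, (HA x y Hx Hy); unfold lt_clause.
  rewrite !rank_lt_iff; apply or_iff_compat_l, and_iff_compat_l, or_iff_compat_l.
  assert (Hlow : forall z w, rk z ∈ rk w -> w ∈ Vl a -> z ∈ Vl a).
  { intros z w H; rewrite !mem_Vl_rk by auto; intros H'; exact (ord_trans Oa H H'). }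
  split; intros [x1 [x2 [y1 [y2 [Ex [Ey E]]]]]]; exists x1, x2, y1, y2;
    rewrite !is_pair_iff, !gr_iff in *; subst; (split; [auto|split; [auto|]]);
    destruct (pr_rk x1 x2), (pr_rk y1 y2);
    (destruct E as [E|[E1 E]]; [left|right; split; auto]; apply (cod_lt_good Oa HA); eauto).
Qed.

Lemma cod_lt_asym x y : cod_lt mem x y -> ~ cod_lt mem y x.
Proof.
  revert x y.
  apply (@rk_ind (fun x => forall y, cod_lt mem x y -> ~ cod_lt mem y x)); [fo_tac|].
  intros x IH y H H'; apply cod_lt_iff in H, H'.
  destruct H as [H|[N H]]; destruct H' as [H'|[N' H']]; try tauto.
  - exact (mem_asym H H').
  - destruct H as [[O NO]|[x1 [x2 [y1 [y2 [Ex [Ey H]]]]]]].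
    + destruct H' as [[O' NO']|[z1 [z2 [w1 [w2 [Ez [Ew H']]]]]]]; [tauto|].
      subst x; exact (pr_not_ord O).
    + subst; destruct H' as [[O' NO']|[z1 [z2 [w1 [w2 [Ez [Ew H']]]]]]]; [exact (pr_not_ord O')|].
      apply pr_inj in Ez, Ew; destruct Ez, Ew; subst z1 z2 w1 w2.
      destruct (pr_rk x1 x2) as [R1 R2].
      destruct H as [H|[E H]], H' as [H'|[E' H']]; subst.
      * exact (IH x1 R1 y1 H H').
      * exact (IH x1 R1 x1 H H).
      * exact (IH y1 R1 y1 H' H').
      * exact (IH x2 R2 y2 H H').
Qed.

(** Among the members of least rank an ordinal comes first; if there is none, all of them are pairs,
    and one minimises the first component and then the second. *)
Lemma cod_least X : (forall c, c ∈ X -> is_cod mem c) -> (exists c, c ∈ X) ->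
  exists c, c ∈ X /\ forall c', c' ∈ X -> c' = c \/ cod_lt mem c c'.
Proof.
  intros HX [c0 Hc0].
  (* The statement is generalised to all X with a member of rank r, to be applied to the sets of
     first and of second components, which have members of smaller rank. *)
  assert (H : forall r, ord mem r -> forall X, (forall c, c ∈ X -> is_cod mem c) ->
    (exists c, c ∈ X /\ rk c = r) ->
    exists c, c ∈ X /\ forall c', c' ∈ X -> c' = c \/ cod_lt mem c c').
  2: { apply (H _ (ord_rk c0)); eauto. }
  clear X HX c0 Hc0.
  apply (@ord_ind _ _ _ (fun r => forall X, (forall c, c ∈ X -> is_cod mem c) ->
    (exists c, c ∈ X /\ rk c = r) ->
    exists c, c ∈ X /\ forall c', c' ∈ X -> c' = c \/ cod_lt mem c c')); [fo_tac|].
  intros r Or IH X HX Hr.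
  destruct (@ord_least _ _ _ (fun r => exists c, c ∈ X /\ rk c = r) r) as [s [Os [Hs [Hc Hmin]]]];
    auto; [fo_tac|].
  assert (Hrk : forall c, c ∈ X -> ~ rk c ∈ s).
  { intros c HcX Hc'; apply (Hmin (rk c)); eauto. }
  assert (Hlow : forall c c', c ∈ X -> rk c = s -> c' ∈ X -> ~ rk c' = s -> cod_lt mem c c').
  { intros c c' H1 H2 H3 H4; apply cod_lt_iff; left; rewrite H2.
    destruct (ord_trich (ord_rk c') Os) as [E|[E|E]]; auto; [destruct (Hrk c')|]; tauto. }
  (* An ordinal of rank s is s itself, so there is at most one. *)
  destruct (classic (exists o, o ∈ X /\ rk o = s /\ ord mem o)) as [[o [HoX [Ho Oo]]]|No].
  - exists o; split; auto; intros c' Hc'; destruct (classic (rk c' = s)) as [E|E]; [|eauto].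
    destruct (classic (ord mem c')) as [O|O].
    + left; rewrite (rk_ord O) in E; rewrite (rk_ord Oo) in Ho; congruence.
    + right; apply cod_lt_iff; right; split; [rewrite Ho, E; apply mem_irrefl|auto].
  - assert (Hpair : forall c, c ∈ X -> rk c = s -> exists x y, c = pr x y /\ is_cod mem x /\ is_cod mem y).
    { intros c HcX E; destruct (cod_inv (HX c HcX)) as [O|H]; auto; destruct No; eauto. }
    (* Only pairs of the least rank s count; other members of X are larger in any case. *)
    set (P1 := fun x => exists y, pr x y ∈ X /\ rk (pr x y) = s).
    assert (H1 : fo (fun e => P1 (e 0))) by (unfold P1; fo_tac).
    assert (E1 : forall x, x ∈ cmp (un (un X)) P1 <-> P1 x).
    { intros x; rewrite (cmp_iff _ H1); split; [tauto|]; intros H; split; auto.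
      destruct H as [y [Hy _]]; apply (pr_in_un Hy). }
    destruct Hc as [c [HcX Hcs]]; destruct (Hpair c HcX Hcs) as [x0 [y0 [-> [Cx0 Cy0]]]].
    assert (Rx : rk x0 ∈ r)
      by (refine (mem_ole_trans Or (b := s) _ Hs); rewrite <- Hcs; exact (proj1 (pr_rk x0 y0))).
    destruct (IH (rk x0) Rx (cmp (un (un X)) P1)) as [x [Hx Hxmin]].
    { intros x Hx; apply E1 in Hx; destruct Hx as [y [Hy E]].
      destruct (Hpair _ Hy E) as [x' [y' [E' [Cx Cy]]]]; apply pr_inj in E'; destruct E'; subst; auto. }
    { exists x0; split; auto; apply E1; exists y0; auto. }
    apply E1 in Hx; destruct Hx as [y1 [Hy1 Hy1s]].
    set (P2 := fun y => pr x y ∈ X /\ rk (pr x y) = s).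
    assert (H2 : fo (fun e => P2 (e 0))) by (unfold P2; fo_tac).
    assert (E2 : forall y, y ∈ cmp (un (un X)) P2 <-> P2 y).
    { intros y; rewrite (cmp_iff _ H2); split; [tauto|]; intros H; split; auto.
      destruct H as [Hy _]; apply (pr_in_un Hy). }
    assert (Ry : rk y1 ∈ r)
      by (refine (mem_ole_trans Or (b := s) _ Hs); rewrite <- Hy1s; exact (proj2 (pr_rk x y1))).
    destruct (IH (rk y1) Ry (cmp (un (un X)) P2)) as [y [Hy Hymin]].
    { intros y Hy; apply E2 in Hy; destruct Hy as [Hy E].
      destruct (Hpair _ Hy E) as [x' [y' [E' [Cx Cy]]]]; apply pr_inj in E'; destruct E'; subst; auto. }
    { exists y1; split; auto; apply E2; split; auto. }
    apply E2 in Hy; destruct Hy as [HyX Hys].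
    exists (pr x y); split; auto; intros c' Hc'.
    destruct (classic (rk c' = s)) as [E|E]; [|eauto].
    destruct (Hpair c' Hc' E) as [x' [y' [-> [Cx' Cy']]]].
    assert (R : ~ rk (pr x' y') ∈ rk (pr x y)) by (rewrite E, Hys; apply mem_irrefl).
    destruct (Hxmin x') as [->|Hlt]; [apply E1; exists y'; auto| |].
    + destruct (Hymin y') as [->|Hlt]; [apply E2; split; auto|auto|].
      right; apply cod_lt_iff; right; split; auto; right; exists x, y, x, y'; auto.
    + right; apply cod_lt_iff; right; split; auto; right; exists x, y, x', y'; auto.
Qed.

End Codes.

(** * Codes of ordinal definable sets *)

Section Decoding.

Context {V : Type} {mem : V -> V -> Prop} {hZFC : ZFC mem}.
Local Notation "x ∈ y" := (mem x y) (at level 70, no associativity).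
Local Notation fo := (@fo V mem).
Local Notation tm := (@tm V mem).

Definition tails (s c g n : V) : Prop :=
  (forall i x x', pr i x ∈ g -> pr i x' ∈ g -> x = x') /\ pr emp c ∈ g /\
  (forall i, i ∈ n -> exists y z, pr i y ∈ s /\ pr (sc i) z ∈ g /\ pr i (pr y z) ∈ g) /\
  pr n emp ∈ g /\ (forall i b, pr i b ∈ s -> ~ i ∈ n -> b = emp).

Lemma is_tails_iff s c g n : is_tails mem s c g n <-> n ∈ om /\ tails s c g n.
Proof.
  unfold is_tails, tails; rewrite is_nat_iff; apply and_iff_compat_l.
  split; intros [H1 [H2 [H3 [H4 H5]]]]; (split; [|split; [|split; [|split]]]).
  - intros i x x' H H'; apply (H1 i); apply gr_iff; auto.
  - apply gr_iff, H2, emp_spec.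
  - intros i Hi; destruct (H3 i Hi) as [j [y [z [q [A [B [C [D E]]]]]]]].
    apply is_succ_iff in A; apply is_pair_iff in D; rewrite gr_iff in *; subst; eauto.
  - apply gr_iff, H4, emp_spec.
  - intros i b H N; apply is_empty_iff, (H5 i); auto; apply gr_iff, H.
  - intros i x x' H H'; apply (H1 i); apply gr_iff; auto.
  - intros z Hz; apply is_empty_iff in Hz; subst; apply gr_iff, H2.
  - intros i Hi; destruct (H3 i Hi) as [y [z [A [B C]]]].
    exists (sc i), y, z, (pr y z); rewrite is_succ_iff, is_pair_iff, !gr_iff; auto.
  - intros z Hz; apply is_empty_iff in Hz; subst; apply gr_iff, H4.
  - intros i b H N; apply is_empty_iff, (H5 i); auto; apply gr_iff, H.
Qed.
Lemma list_of_iff s c : list_of mem s c <-> exists g n, n ∈ om /\ tails s c g n.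
Proof.
  unfold list_of; split; intros [g [n H]]; exists g, n; apply is_tails_iff, H.
Qed.

Lemma sc_om i : i ∈ om -> sc i ∈ om.
Proof. apply limit_sc, limit_om. Qed.

(** Induction on n: the shifted sequence is coded first, and then the head is paired with its
    code. *)
Lemma tails_exist a n : ord mem a -> n ∈ om -> forall s, is_fun mem s om a ->
  (forall i b, pr i b ∈ s -> ~ i ∈ n -> b = emp) ->
  exists c g, is_cod mem c /\ tails s c g n.
Proof.
  intros Oa Hn; revert n Hn.
  apply (@om_ind _ _ _ (fun n => forall s, is_fun mem s om a ->
    (forall i b, pr i b ∈ s -> ~ i ∈ n -> b = emp) -> exists c g, is_cod mem c /\ tails s c g n)).
  - unfold tails; fo_tac.
  - intros s Hs H0; exists emp, (up (pr emp emp) (pr emp emp)).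
    assert (E : forall i x, pr i x ∈ up (pr emp emp) (pr emp emp) -> i = emp /\ x = emp).
    { intros i x H; apply mem_up in H; destruct H as [H|H]; apply pr_inj in H; auto. }
    split; [apply cod_ord, ord_emp|split; [|split; [|split; [|split]]]].
    + intros i x x' H H'; apply E in H, H'; destruct H, H'; congruence.
    + apply up_l.
    + intros i Hi; destruct (mem_emp Hi).
    + apply up_l.
    + exact H0.
  - intros n Hn IH s Hs H0.
    assert (Hs' := Hs); apply is_fun_iff in Hs'; destruct Hs' as [S1 [S2 S3]].
    (* s' is s without its first entry. *)
    destruct (@fun_exists _ _ _ om a (fun i b => pr (sc i) b ∈ s)) as [s' [Fs' Hs']].
    { fo_tac. }
    { intros i Hi; apply S3, sc_om, Hi. }
    { intros i y y' _; apply S2. }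
    destruct (IH s' Fs') as [c [g [Cc [G1 [G2 [G3 [G4 G5]]]]]]].
    { intros i b H N; apply Hs' in H; destruct H as [_ [_ H]]; apply (H0 _ _ H).
      rewrite (sc_mem_iff _ (ord_mem ord_om Hn)); exact N. }
    destruct (S3 emp (limit_emp limit_om)) as [y [Hy Hsy]].
    destruct (@replacement _ _ _ (fun p q => exists i x, p = pr i x /\ q = pr (sc i) x) g) as [h Hh].
    { fo_tac. }
    { intros p q q' _ [i [x [E ->]]] [i' [x' [E' ->]]]; subst; apply pr_inj in E'.
      destruct E'; subst; auto. }
    assert (Hh0 : forall i x, pr i x ∈ h <-> exists k, i = sc k /\ pr k x ∈ g).
    { intros i x; rewrite Hh; split.
      - intros [p [Hp [k [x' [E E']]]]]; apply pr_inj in E'; destruct E'; subst; eauto.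
      - intros [k [-> H]]; eauto 6. }
    set (G := cup h (up (pr emp (pr y c)) (pr emp (pr y c)))).
    assert (HG : forall i x, pr i x ∈ G <-> (exists k, i = sc k /\ pr k x ∈ g) \/ (i = emp /\ x = pr y c)).
    { intros i x; unfold G; rewrite mem_cup, Hh0, mem_up; apply or_iff_compat_l; split.
      - intros [H|H]; apply pr_inj in H; auto.
      - intros [-> ->]; auto. }
    exists (pr y c), G; split; [apply cod_pr; auto; apply cod_ord, (ord_mem Oa Hy)|].
    split; [|split; [|split; [|split]]].
    + intros i x x' H H'; apply HG in H, H'; destruct H as [[k [-> H]]|[-> ->]].
      * destruct H' as [[k' [E H']]|[E _]]; [apply sc_inj in E; subst; eauto|].
        destruct (sc_not_emp E).
      * destruct H' as [[k' [E H']]|[E ->]]; auto; destruct (sc_not_emp (eq_sym E)).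
    + apply HG; auto.
    + intros i Hi.
      assert (Hio : i ∈ om) by (exact (ord_trans ord_om Hi (sc_om Hn))).
      destruct (nat_cases Hio) as [->|[k [Hk ->]]].
      * exists y, c; split; auto; split; apply HG; eauto.
      * assert (Hkn : k ∈ n) by (apply (sc_mem_iff _ (ord_mem ord_om Hn)), Hi).
        destruct (G3 k Hkn) as [y' [z [A [B C]]]]; apply Hs' in A.
        exists y', z; split; [apply A|]; split; apply HG; eauto.
    + apply HG; eauto.
    + exact H0.
Qed.

(** Both readings start from the same c, and injectivity of pairing carries the agreement from one
    tail to the next until either list ends. *)
Lemma tails_agree s s' c g g' n n' : n ∈ om -> n' ∈ om -> tails s c g n -> tails s' c g' n' ->
  forall i, i ∈ om -> i ∈ sc n -> i ∈ sc n' -> exists x, pr i x ∈ g /\ pr i x ∈ g'.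
Proof.
  intros Hn Hn' [G1 [G2 [G3 [G4 G5]]]] [K1 [K2 [K3 [K4 K5]]]].
  apply (@om_ind _ _ _ (fun i => i ∈ sc n -> i ∈ sc n' -> exists x, pr i x ∈ g /\ pr i x ∈ g'));
    [fo_tac|eauto|].
  intros k Hk IH H H'; rewrite sc_mem_iff in H, H' by (eapply ord_mem; [apply ord_om|]; auto).
  destruct IH as [x [Hx Hx']]; [apply mem_sc; auto|apply mem_sc; auto|].
  destruct (G3 k H) as [y [z [_ [B C]]]], (K3 k H') as [y' [z' [_ [B' C']]]].
  assert (E := G1 _ _ _ Hx C); assert (E' := K1 _ _ _ Hx' C'); subst x.
  apply pr_inj in E'; destruct E'; subst; eauto.
Qed.

(** A list ends with the empty set, which is not a pair; hence two readings of c have the same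
    length, and c determines s. *)
Lemma list_of_sub s s' c a a' : is_fun mem s om a -> is_fun mem s' om a' ->
  list_of mem s c -> list_of mem s' c -> sub mem s s'.
Proof.
  intros Hs Hs' H H'; apply list_of_iff in H, H'.
  destruct H as [g [n [Hn H]]], H' as [g' [n' [Hn' H']]].
  assert (Ag := tails_agree Hn Hn' H H').
  destruct H as [G1 [G2 [G3 [G4 G5]]]], H' as [K1 [K2 [K3 [K4 K5]]]].
  apply is_fun_iff in Hs, Hs'; destruct Hs as [S1 [S2 S3]], Hs' as [T1 [T2 T3]].
  assert (E : n = n').
  { destruct (ord_trich (ord_mem ord_om Hn) (ord_mem ord_om Hn')) as [L|[L|L]]; auto; exfalso.
    - destruct (Ag n Hn) as [x [Hx Hx']]; [apply mem_sc; auto|apply mem_sc; auto|].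
      destruct (K3 n L) as [y [z [_ [_ C]]]].
      rewrite (G1 _ _ _ Hx G4) in Hx'; exact (pr_not_emp (eq_sym (K1 _ _ _ Hx' C))).
    - destruct (Ag n' Hn') as [x [Hx Hx']]; [apply mem_sc; auto|apply mem_sc; auto|].
      destruct (G3 n' L) as [y [z [_ [_ C]]]].
      rewrite (K1 _ _ _ Hx' K4) in Hx; exact (pr_not_emp (eq_sym (G1 _ _ _ Hx C))). }
  subst n'; intros p Hp; assert (Hp' := Hp); apply S1, mem_cart in Hp'.
  destruct Hp' as [i [b [Hi [Hb ->]]]]; destruct (classic (i ∈ n)) as [L|L].
  - destruct (Ag i Hi) as [x [Hx Hx']]; [apply mem_sc; auto|apply mem_sc; auto|].
    destruct (G3 i L) as [y [z [A [_ C]]]], (K3 i L) as [y' [z' [A' [_ C']]]].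
    assert (E := G1 _ _ _ Hx C); assert (E' := K1 _ _ _ Hx' C'); subst x.
    apply pr_inj in E'; destruct E'; subst; rewrite (S2 _ _ _ Hp A); auto.
  - rewrite (G5 i b Hp L) in *; destruct (T3 i Hi) as [b' [Hb' H]].
    rewrite (K5 i b' H L) in H; exact H.
Qed.

Definition odcode (a p l eta : V) : V := pr (pr a (pr p l)) eta.

Lemma decode_iff c x : decode mem c x <-> exists a p l eta s, c = odcode a p l eta /\
  list_of mem s l /\ ord mem a /\ x ∈ Vl a /\ is_fml mem None p /\ is_fun mem s om a /\
  forall u t, u ∈ Vl a -> assign mem (Vl a) t -> is_scons mem t u s ->
    (sat mem (Vl a) None p t <-> u = x).
Proof.
  unfold decode, odcode; split.
  - intros [a [p [l [eta [q [r [v [s [Hq [Hr [Hc [Hl [Hv [Hx [Hp [Hs H]]]]]]]]]]]]]]]].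
    apply is_pair_iff in Hq, Hr, Hc; apply is_Vlevel_iff in Hv; destruct Hv as [Oa ->].
    destruct Hs as [w [Hw Hs]]; apply is_omega_iff in Hw; subst.
    exists a, p, l, eta, s; auto 10.
  - intros [a [p [l [eta [s [-> [Hl [Oa [Hx [Hp [Hs H]]]]]]]]]]].
    exists a, p, l, eta, (pr p l), (pr a (pr p l)), (Vl a), s.
    rewrite !is_pair_iff, is_Vlevel_iff; split; auto; split; auto; split; auto; split; auto.
    split; auto; split; auto; split; auto; split; auto; exists om; split; auto; apply om_spec.
Qed.

Lemma fun_assign s a : ord mem a -> is_fun mem s om a -> assign mem (Vl a) s.
Proof.
  intros Oa Hs; apply assign_sub with a; [|apply assign_iff, Hs].
  intros z Hz; apply ord_in_Vl; eauto using ord_mem.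
Qed.

Lemma decode_unique c x x' : decode mem c x -> decode mem c x' -> x = x'.
Proof.
  intros H H'; apply decode_iff in H, H'.
  destruct H as [a [p [l [eta [s [-> [Hl [Oa [Hx [Hp [Hs H]]]]]]]]]]].
  destruct H' as [a' [p' [l' [eta' [s' [E [Hl' [Oa' [Hx' [Hp' [Hs' H']]]]]]]]]]].
  unfold odcode in E; apply pr_inj in E; destruct E as [E _].
  apply pr_inj in E; destruct E as [<- E]; apply pr_inj in E; destruct E as [<- <-].
  assert (s = s') by (apply ext; intros z; split; eapply list_of_sub; eauto); subst s'.
  destruct (scons_exists (fun_assign Oa Hs) Hx) as [t [Ht Hts]].
  apply (H' x t Hx Ht Hts), (H x t Hx Ht Hts); reflexivity.
Qed.

(** The components a, p and l do not depend on eta, so letting eta vary gives a proper class of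
    codes of x. *)
Lemma OD_decode x : OD mem x -> exists a p l, forall eta, ord mem eta ->
  is_cod mem (odcode a p l eta) /\ decode mem (odcode a p l eta) x.
Proof.
  intros [a [v [p [s [Hv [Hx [Hp [[w [Hw Hs]] [[n [Hn H0]] H]]]]]]]]].
  apply is_Vlevel_iff in Hv; destruct Hv as [Oa ->]; apply is_omega_iff in Hw; subst w.
  apply is_nat_iff in Hn.
  destruct (tails_exist Oa Hn Hs) as [l [g [Cl Hl]]].
  { intros i b Hi N; apply is_empty_iff, (H0 i); auto; apply gr_iff, Hi. }
  exists a, p, l; intros eta Oeta; split.
  - repeat apply cod_pr; auto using cod_ord, cod_fml.
  - apply decode_iff; exists a, p, l, eta, s; split; auto; split; [apply list_of_iff; eauto|].
    auto.
Qed.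

Lemma HOD_OD x : HOD mem x -> OD mem x.
Proof.
  intros [u [t [Hu [[_ [Ht _]] H]]]]; apply H, Ht; apply is_upair_iff in Hu; subst; apply up_l.
Qed.

Lemma ord_OD x : ord mem x -> OD mem x.
Proof.
  intros Ox; assert (Oa := ord_sc Ox).
  assert (Hxa : x ∈ sc x) by (apply mem_sc; auto).
  assert (Hea : emp ∈ sc x).
  { apply mem_sc; destruct (ord_mem_or_le ord_emp Ox) as [E|[E|E]]; auto; destruct (mem_emp E). }
  destruct (@fun_exists _ _ _ om (sc x) (fun i b => (i = emp /\ b = x) \/ (i <> emp /\ b = emp)))
    as [s [Hs Hpr]].
  { fo_tac. }
  { intros i Hi; destruct (classic (i = emp)); [exists x|exists emp]; auto. }
  { intros i b b' _ [[]|[]] [[]|[]]; congruence. }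
  (* x is defined in the first level that contains it by the formula x_0 = x_1, with x itself as the
     first parameter and 0 as all the others. *)
  exists (sc x), (Vl (sc x)), (cEq (num 0) (num 1)), s.
  split; [apply is_Vlevel_iff; auto|]; split; [apply ord_in_Vl; auto|].
  split; [apply fml_cEq; apply num_nat|].
  split; [exists om; split; auto; apply om_spec|]; split.
  - exists (num 1); split; [apply is_nat_iff, num_nat|].
    intros i b Hi N; apply gr_iff, Hpr in Hi; apply is_empty_iff.
    destruct Hi as [_ [_ [[-> _]|[_ H]]]]; auto; destruct N; apply mem_sc; auto.
  - intros u t Hu Ht Hts; destruct (truth_exists (Vl (sc x)) None) as [S HS].
    rewrite (sat_iff HS (fml_cEq (F := None) (num_nat 0) (num_nat 1)) Ht).
    rewrite (truth_cEq HS (num_nat 0) (num_nat 1) Ht); apply is_scons_iff in Hts.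
    destruct Hts as [T0 T1].
    assert (T : pr (num 1) x ∈ t).
    { apply T1, Hpr; split; [apply limit_emp, limit_om|]; auto. }
    split.
    + intros [b [H1 H2]]; rewrite (assign_fun Ht T0 H1), (assign_fun Ht T H2); auto.
    + intros ->; exists x; auto.
Qed.

End Decoding.

Create HintDb abs discriminated.

(** * Absoluteness of limit levels *)

Section Absoluteness.

Context {V : Type} {mem : V -> V -> Prop} {hZFC : ZFC mem}.
Local Notation "x ∈ y" := (mem x y) (at level 70, no associativity).
Local Notation fo := (@fo V mem).
Local Notation tm := (@tm V mem).

Context (lam : V) (Ll : limit mem lam) (Hom : om ∈ lam).
Let Ol : ord mem lam := proj1 Ll.
Local Notation W := (carrier (mem := mem) (Vl lam)).
Local Notation cm := (@cmem V mem (Vl lam)).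
Local Notation "! x" := (proj1_sig x) (at level 1).

Lemma carrier_in (x : W) : !x ∈ Vl lam.
Proof. apply proj2_sig. Qed.
Lemma carrier_eq (x y : W) : x = y <-> !x = !y.
Proof.
  split; [congruence|]; intros H; apply eq_sig_hprop; auto; intros; apply proof_irrelevance.
Qed.
(** An unbounded quantifier is absolute as soon as possible counterexamples, or witnesses in the
    case of ∃, are forced into the level. This covers quantifiers over subsets and functions, beyond
    bounded formulas. *)
Lemma abs_all (P : W -> Prop) (Q : V -> Prop) :
  (forall z : W, P z <-> Q !z) -> (forall z, ~ Q z -> z ∈ Vl lam) ->
  ((forall z, P z) <-> (forall z, Q z)).
Proof.
  intros H HQ; split; intros E z; [|apply H, E].
  apply NNPP; intros N; apply N; apply (H (exist _ z (HQ z N))), E.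
Qed.
Lemma abs_ex (P : W -> Prop) (Q : V -> Prop) :
  (forall z : W, P z <-> Q !z) -> (forall z, Q z -> z ∈ Vl lam) ->
  ((exists z, P z) <-> (exists z, Q z)).
Proof.
  intros H HQ; split; intros [z Hz]; [exists !z; apply H, Hz|].
  exists (exist _ z (HQ z Hz)); apply H, Hz.
Qed.
(** The second equivalence may assume A': [abs_sat], for example, holds only for formulas and
    assignments. *)
Lemma and_cong (A A' B B' : Prop) : (A <-> A') -> (A' -> (B <-> B')) -> (A /\ B <-> A' /\ B').
Proof. tauto. Qed.
Lemma imp_cong (A A' B B' : Prop) : (A <-> A') -> (A' -> (B <-> B')) -> ((A -> B) <-> (A' -> B')).
Proof. tauto. Qed.
Lemma or_cong (A A' B B' : Prop) : (A <-> A') -> (B <-> B') -> (A \/ B <-> A' \/ B').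
Proof. tauto. Qed.
Lemma iff_cong (A A' B B' : Prop) : (A <-> A') -> (B <-> B') -> ((A <-> B) <-> (A' <-> B')).
Proof. tauto. Qed.
Lemma not_cong (A A' : Prop) : (A <-> A') -> (~ A <-> ~ A').
Proof. tauto. Qed.

Lemma om_in_level : om ∈ Vl lam.
Proof. apply ord_in_Vl; auto; apply ord_om. Qed.
Lemma Vom_in_level : Vl om ∈ Vl lam.
Proof. apply Vl_in; auto. Qed.
Lemma nat_in_level n : n ∈ om -> n ∈ Vl lam.
Proof. intros H; exact (Vl_el Ll om_in_level H). Qed.
Lemma num_in_level n : num n ∈ Vl lam.
Proof. apply nat_in_level, num_nat. Qed.
Lemma fml_in_level p : is_fml mem None p -> p ∈ Vl lam.
Proof. intros H; exact (Vl_el Ll Vom_in_level (fml_Vom H)). Qed.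
Lemma cart_in_level a b : a ∈ Vl lam -> b ∈ Vl lam -> cart a b ∈ Vl lam.
Proof. intros Ha Hb; apply (Vl_rel Ll Ha Hb); intros p; apply mem_cart. Qed.
Lemma pfun_in_level f a b : is_pfun mem f a b -> a ∈ Vl lam -> b ∈ Vl lam -> f ∈ Vl lam.
Proof.
  intros H Ha Hb; apply is_pfun_iff in H; exact (Vl_sub Ll (cart_in_level Ha Hb) (proj1 H)).
Qed.
Lemma fun_in_level f a b : is_fun mem f a b -> a ∈ Vl lam -> b ∈ Vl lam -> f ∈ Vl lam.
Proof. intros H; apply (@pfun_in_level f a b), H. Qed.
Lemma inj_in_level f a b : is_inj mem f a b -> a ∈ Vl lam -> b ∈ Vl lam -> f ∈ Vl lam.
Proof. intros H; apply (@fun_in_level f a b), H. Qed.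
Lemma assign_in_level M s : assign mem M s -> M ∈ Vl lam -> s ∈ Vl lam.
Proof. intros H HM; apply assign_iff in H; exact (fun_in_level H om_in_level HM). Qed.
Lemma Vl_in_level a : a ∈ Vl lam -> ord mem a -> Vl a ∈ Vl lam.
Proof. intros Ha Oa; apply (Vl_in Ol), (ord_in_Vl Ol Oa), Ha. Qed.

(** Hypotheses become equations between terms and memberships, from which [inW] derives by closure
    properties that a set lies in the level. *)
Ltac norm :=
  repeat match goal with
  | H : _ /\ _ |- _ => destruct H
  | H : exists _, _ |- _ => destruct H
  | H : _ \/ _ |- _ => destruct H
  | H : ole _ _ _ |- _ => destruct H
  | H : is_empty mem _ |- _ => apply is_empty_iff in H
  | H : is_upair mem _ _ _ |- _ => apply is_upair_iff in H
  | H : is_pair mem _ _ _ |- _ => apply is_pair_iff in H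
  | H : gr mem _ _ _ |- _ => apply gr_iff in H
  | H : is_succ mem _ _ |- _ => apply is_succ_iff in H
  | H : is_pow mem _ _ |- _ => apply is_pow_iff in H
  | H : is_omega mem _ |- _ => apply is_omega_iff in H
  | H : is_nat mem _ |- _ => apply is_nat_iff in H
  | H : is_num mem _ _ |- _ => apply is_num_iff in H
  | H : code1 mem _ _ _ |- _ => apply code1_iff in H
  | H : code2 mem _ _ _ _ |- _ => apply code2_iff in H
  | H : is_cMem mem _ _ _ |- _ => apply code2_iff in H
  | H : is_cEq mem _ _ _ |- _ => apply code2_iff in H
  | H : is_cNeg mem _ _ |- _ => apply code1_iff in H
  | H : is_cAnd mem _ _ _ |- _ => apply code2_iff in H
  | H : is_cEx mem _ _ |- _ => apply code1_iff in H
  | H : is_Vlevel mem _ _ |- _ => apply is_Vlevel_iff in H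
  | H : injects mem _ _ |- _ => destruct H
  end; subst;
  repeat match goal with
  | H : !?x = pr ?a ?b |- _ =>
      assert (pr a b ∈ Vl lam) by (rewrite <- H; apply carrier_in); clear H
  | H : pr _ _ ∈ Vl lam |- _ => apply (Vl_pr_inv Ll) in H; destruct H
  end.
Ltac inW :=
  match goal with
  | |- !_ ∈ _ => apply carrier_in
  | |- emp ∈ _ => exact (Vl_emp Ll)
  | |- om ∈ _ => exact om_in_level
  | |- num _ ∈ _ => apply num_in_level
  | H : ?x ∈ Vl lam |- ?x ∈ Vl lam => exact H
  | |- up _ _ ∈ _ => apply (Vl_up Ll); inW
  | |- pr _ _ ∈ _ => apply (Vl_pr Ll); inW
  | |- sc _ ∈ _ => apply (Vl_sc Ll); inW
  | |- pw _ ∈ _ => apply (Vl_pw Ll); inW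
  | |- Vl _ ∈ _ => apply Vl_in_level; [inW|assumption]
  | H : ?x ∈ ?y |- ?x ∈ Vl lam => apply (Vl_el Ll (x := y)); [inW|exact H]
  | H : pr ?x _ ∈ ?f |- ?x ∈ Vl lam => refine (proj1 (Vl_gr Ll _ H)); inW
  | H : pr _ ?x ∈ ?f |- ?x ∈ Vl lam => refine (proj2 (Vl_gr Ll _ H)); inW
  | H : sub mem ?x ?y |- ?x ∈ Vl lam => apply (Vl_sub Ll (x := y)); [inW|exact H]
  | H : is_fun mem ?x _ _ |- ?x ∈ Vl lam => apply (fun_in_level H); inW
  | H : is_inj mem ?x _ _ |- ?x ∈ Vl lam => apply (inj_in_level H); inW
  | H : is_pfun mem ?x _ _ |- ?x ∈ Vl lam => apply (pfun_in_level H); inW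
  | H : assign mem _ ?x |- ?x ∈ Vl lam => apply (assign_in_level H); inW
  | H : is_fml mem None ?x |- ?x ∈ Vl lam => apply (fml_in_level H)
  end.
(** Suppose z is a counterexample outside the level; the premises of the failing statement are
    collected as hypotheses, and they put z into the level. *)
Ltac side_all :=
  let z := fresh "z" in let N := fresh in let NZ := fresh in
  intros z N; apply NNPP; intros NZ; apply N; clear N;
  repeat lazymatch goal with
    | |- _ /\ _ => split
    | |- _ <-> _ => split
    | |- forall _, _ => intro
    | |- ~ _ => intro
    end; exfalso; apply NZ; clear NZ; norm; inW.
Ltac side_ex := intros; norm; inW.
Ltac abs_tac := cbv beta;
  lazymatch goal with
  | |- (_ /\ _) <-> (_ /\ _) => apply and_cong; [abs_tac|intro; abs_tac]
  | |- (_ \/ _) <-> (_ \/ _) => apply or_cong; abs_tac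
  | |- (_ <-> _) <-> (_ <-> _) => apply iff_cong; abs_tac
  | |- (~ _) <-> (~ _) => apply not_cong; abs_tac
  | |- True <-> True => tauto
  | |- (forall x : carrier _, @?P x) <-> (forall z, @?Q z) =>
      apply (@abs_all P Q); [intro; abs_tac|try solve [side_all]]
  | |- (exists x : carrier _, @?P x) <-> (exists z, @?Q z) =>
      apply (@abs_ex P Q); [intro; abs_tac|try solve [side_ex]]
  | |- (_ -> _) <-> (_ -> _) => apply imp_cong; [abs_tac|intro; abs_tac]
  | |- ?x = ?y <-> _ => apply (carrier_eq x y)
  | |- cmem _ _ <-> mem _ _ => apply iff_refl
  | |- _ => first [solve [auto 1 with abs nocore] | idtac]
  end.

Lemma abs_sub x y : sub cm x y <-> sub mem !x !y.
Proof. unfold sub; abs_tac. Qed.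
#[local] Hint Resolve abs_sub : abs.
Lemma abs_is_empty x : is_empty cm x <-> is_empty mem !x.
Proof. unfold is_empty; abs_tac. Qed.
Lemma abs_is_upair p x y : is_upair cm p x y <-> is_upair mem !p !x !y.
Proof. unfold is_upair; abs_tac. Qed.
Lemma abs_is_pow x y : is_pow cm x y <-> is_pow mem !x !y.
Proof. unfold is_pow; abs_tac. Qed.
Lemma abs_is_succ x y : is_succ cm x y <-> is_succ mem !x !y.
Proof. unfold is_succ; abs_tac. Qed.
#[local] Hint Resolve abs_is_empty abs_is_upair abs_is_pow abs_is_succ : abs.
Lemma abs_is_pair p x y : is_pair cm p x y <-> is_pair mem !p !x !y.
Proof. unfold is_pair; abs_tac. Qed.
#[local] Hint Resolve abs_is_pair : abs.
Lemma abs_gr p x y : gr cm p x y <-> gr mem !p !x !y.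
Proof. unfold gr; abs_tac. Qed.
#[local] Hint Resolve abs_gr : abs.
Lemma abs_is_pfun p x y : is_pfun cm p x y <-> is_pfun mem !p !x !y.
Proof. unfold is_pfun; abs_tac. Qed.
#[local] Hint Resolve abs_is_pfun : abs.
Lemma abs_is_fun p x y : is_fun cm p x y <-> is_fun mem !p !x !y.
Proof. unfold is_fun; abs_tac. Qed.
#[local] Hint Resolve abs_is_fun : abs.
Lemma abs_is_inj p x y : is_inj cm p x y <-> is_inj mem !p !x !y.
Proof. unfold is_inj; abs_tac. Qed.
#[local] Hint Resolve abs_is_inj : abs.
Lemma abs_injects x y : injects cm x y <-> injects mem !x !y.
Proof. unfold injects; abs_tac. Qed.
Lemma abs_transitive x : transitive cm x <-> transitive mem !x.
Proof. unfold transitive; abs_tac. Qed.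
#[local] Hint Resolve abs_injects abs_transitive : abs.
Lemma abs_ord x : ord cm x <-> ord mem !x.
Proof. unfold ord; abs_tac. Qed.
Lemma abs_ole x y : ole cm x y <-> ole mem !x !y.
Proof. unfold ole; abs_tac. Qed.
#[local] Hint Resolve abs_ord abs_ole : abs.
Lemma abs_limit x : limit cm x <-> limit mem !x.
Proof. unfold limit; abs_tac. Qed.
#[local] Hint Resolve abs_limit : abs.
Lemma abs_is_omega x : is_omega cm x <-> is_omega mem !x.
Proof. unfold is_omega; abs_tac. Qed.
#[local] Hint Resolve abs_is_omega : abs.
Lemma abs_is_nat x : is_nat cm x <-> is_nat mem !x.
Proof. unfold is_nat; abs_tac. Qed.
Lemma abs_card_lt x y : card_lt cm x y <-> card_lt mem !x !y.
Proof. unfold card_lt; abs_tac. Qed.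
#[local] Hint Resolve abs_is_nat abs_card_lt : abs.
Lemma abs_cardinal x : cardinal cm x <-> cardinal mem !x.
Proof. unfold cardinal; abs_tac. Qed.
Lemma abs_regular x : regular cm x <-> regular mem !x.
Proof. unfold regular; abs_tac. Qed.
Lemma abs_strong_limit x : strong_limit cm x <-> strong_limit mem !x.
Proof. unfold strong_limit; abs_tac. Qed.
#[local] Hint Resolve abs_cardinal abs_regular abs_strong_limit : abs.
Lemma abs_inaccessible x : inaccessible cm x <-> inaccessible mem !x.
Proof. unfold inaccessible; abs_tac. Qed.
Lemma abs_Vfun f v a : Vfun cm f v a <-> Vfun mem !f !v !a.
Proof. unfold Vfun; abs_tac. Qed.
#[local] Hint Resolve abs_inaccessible abs_Vfun : abs.
Lemma abs_is_num n x : is_num cm n x <-> is_num mem n !x.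
Proof.
  revert x; induction n as [|n IH]; intros x; cbn [is_num]; [apply abs_is_empty|].
  apply (@abs_ex (fun y => is_num cm n y /\ is_succ cm x y)
    (fun y => is_num mem n y /\ is_succ mem !x y)); [|side_ex].
  intros y; apply and_cong; [apply IH|intros; apply abs_is_succ].
Qed.
#[local] Hint Resolve abs_is_num : abs.
Lemma abs_code1 n x y : code1 cm n x y <-> code1 mem n !x !y.
Proof. unfold code1; abs_tac. Qed.
#[local] Hint Resolve abs_code1 : abs.
Lemma abs_code2 n x y z : code2 cm n x y z <-> code2 mem n !x !y !z.
Proof. unfold code2; abs_tac. Qed.
#[local] Hint Resolve abs_code2 : abs.
Lemma abs_is_Vlevel v a : is_Vlevel cm v a <-> is_Vlevel mem !v !a.
Proof.
  split.
  - intros [Oa [f Hf]]; split; [apply abs_ord, Oa|].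
    exists !f; exact (proj1 (abs_Vfun f v a) Hf).
  - intros H; apply is_Vlevel_iff in H; destruct H as [Oa E]; split; [apply abs_ord, Oa|].
    (* All values of f are subsets of V_a, so f is a subset of (a + 1) × P(V_a) and belongs to the
       level. *)
    set (f := img (sc !a) (fun b => pr b (Vl b))).
    assert (Hf : f ∈ Vl lam).
    { assert (Hva := carrier_in v).
      apply (Vl_sub Ll (cart_in_level (Vl_sc Ll (carrier_in a)) (Vl_pw Ll Hva))).
      intros p Hp; apply (img_iff _ tm_pr_Vl) in Hp; destruct Hp as [b [Hb ->]].
      apply pr_in_cart; split; auto; apply mem_pw; rewrite E; apply mem_sc in Hb.
      destruct Hb as [Hb| ->]; [apply Vl_mono; auto|apply sub_refl]. }
    exists (exist _ f Hf); apply (proj2 (abs_Vfun (exist _ f Hf) v a)).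
    simpl; rewrite E; apply Vfun_Vl, Oa.
Qed.
Lemma abs_assign M s : assign cm M s <-> assign mem !M !s.
Proof. unfold assign; abs_tac. Qed.
Lemma abs_is_scons t a s : is_scons cm t a s <-> is_scons mem !t !a !s.
Proof. unfold is_scons; abs_tac. Qed.
Lemma abs_fml_closed X : fml_closed cm None X <-> fml_closed mem None !X.
Proof.
  unfold fml_closed, is_cMem, is_cEq, is_cFun, is_cNeg, is_cAnd, is_cEx; abs_tac.
Qed.
#[local] Hint Resolve abs_is_Vlevel abs_assign abs_is_scons abs_fml_closed : abs.
Lemma abs_is_fml p : is_fml cm None p <-> is_fml mem None !p.
Proof.
  split; intros H X HX.
  - set (Y := cmp (Vl om) (fun q => q ∈ X)).
    assert (fX : fo (fun e => e 0 ∈ X)) by fo_tac.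
    assert (HY : Y ∈ Vl lam).
    { apply (Vl_sub Ll Vom_in_level); intros q Hq; apply (cmp_iff (Vl om) fX) in Hq; tauto. }
    assert (C : fml_closed mem None Y).
    { assert (HV := Vom_closed None); rewrite fml_closed_iff in HX, HV |- *.
      destruct HX as [H1 [H2 H3]], HV as [K1 [K2 K3]].
      assert (E : forall q, q ∈ Y <-> q ∈ Vl om /\ q ∈ X) by (apply (cmp_iff (Vl om) fX)).
      split; [|split].
      - intros i j Hi Hj; rewrite !E; destruct (H1 i j Hi Hj) as [A [B _]],
          (K1 i j Hi Hj) as [A' [B' _]]; split; auto; split; auto; tauto.
      - intros f Hf; rewrite !E in *; destruct Hf as [Hf Hf'].
        destruct (H2 f Hf') as [A B], (K2 f Hf) as [A' B']; exact (conj (conj A' A) (conj B' B)).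
      - intros f g Hf Hg; rewrite !E in *; destruct Hf, Hg; auto. }
    assert (HpY : cm p (exist _ Y HY)) by (apply H, abs_fml_closed, C).
    apply (cmp_iff (Vl om) fX) in HpY; tauto.
  - apply H, abs_fml_closed, HX.
Qed.
#[local] Hint Resolve abs_is_fml : abs.
Lemma abs_is_truth M S : is_truth cm M None S <-> is_truth mem !M None !S.
Proof.
  unfold is_truth, is_cMem, is_cEq, is_cFun, is_cNeg, is_cAnd, is_cEx; abs_tac.
Qed.
Lemma abs_sat M p s : is_fml mem None !p -> assign mem !M !s ->
  (sat cm M None p s <-> sat mem !M None !p !s).
Proof.
  intros Hp Hs; split.
  - intros [S [HS H]]; exists !S; rewrite <- abs_is_truth, <- abs_gr; auto.
  (* Any truth set computes [sat], so the bounded one, which lies in the level, can serve as the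
     witness. *)
  - destruct (truth_exists_bounded !M None) as [S [Hb HS]].
    rewrite (sat_iff HS Hp Hs); intros H.
    assert (HSl : S ∈ Vl lam).
    { refine (Vl_sub Ll _ Hb); apply cart_in_level; [apply Vom_in_level|].
      apply (Vl_pw Ll), cart_in_level; [apply om_in_level|apply carrier_in]. }
    exists (exist _ S HSl); rewrite abs_is_truth, abs_gr, gr_iff; auto.
Qed.
Lemma abs_elem_sub M N : elem_sub cm M None N None <-> elem_sub mem !M None !N None.
Proof.
  unfold elem_sub; abs_tac; apply abs_sat; auto; eapply assign_sub; eauto.
Qed.
#[local] Hint Resolve abs_elem_sub : abs.

Lemma abs_inC d g : inC cm d g <-> inC mem !d !g.
Proof. unfold inC; abs_tac. Qed.
#[local] Hint Resolve abs_inC : abs.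
Lemma abs_inC0 d g : inC0 cm d g <-> inC0 mem !d !g.
Proof. unfold inC0; abs_tac. Qed.

Lemma abs_is_cod c : is_cod cm c <-> is_cod mem !c.
Proof.
  set (body := fun (X : Type) (m : X -> X -> Prop) (c t : X) =>
    m c t /\ forall y, m y t -> ord m y \/ exists y1 y2, m y1 t /\ m y2 t /\ is_pair m y y1 y2).
  assert (B : forall t, body _ cm c t <-> body _ mem !c !t) by (intros t; unfold body; abs_tac).
  split; [intros [t Ht]; exists !t; apply (B t), Ht|].
  intros [t [Hc Ht]].
  (* The given witness t is cut down to ranks at most that of c; components have smaller rank, so
     the rest is still a witness. *)
  set (P := fun y => y ∈ Vl (sc (rk !c))).
  assert (HP : fo (fun e => P (e 0))) by (unfold P; fo_tac).
  assert (Or := ord_sc (ord_rk !c)).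
  assert (Hu : cmp t P ∈ Vl lam).
  { assert (Hc' := carrier_in c); apply (mem_Vl_rk _ Ol) in Hc'.
    apply (Vl_sub Ll (Vl_in Ol (limit_sc Ll Hc'))).
    intros y Hy; apply (cmp_iff t HP) in Hy; apply Hy. }
  exists (exist _ (cmp t P) Hu); apply (B (exist _ (cmp t P) Hu)); split; simpl.
  - apply (cmp_iff t HP); split; auto; apply mem_Vl_rk; auto; apply mem_sc; auto.
  - intros y Hy; apply (cmp_iff t HP) in Hy; destruct Hy as [Hy Py].
    destruct (Ht y Hy) as [O|[y1 [y2 [H1 [H2 E]]]]]; auto; right.
    exists y1, y2; apply is_pair_iff in E; subst y.
    unfold P in Py; rewrite mem_Vl_rk in Py by auto; destruct (pr_rk y1 y2) as [R1 R2].
    split; [|split]; [| |apply is_pair_iff; auto]; apply (cmp_iff t HP); split; auto;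
      apply mem_Vl_rk; auto; eapply ord_trans; eauto.
Qed.
Lemma abs_rank_lt x y : rank_lt cm x y <-> rank_lt mem !x !y.
Proof.
  split.
  - intros [v [a [Hv [Hx Hy]]]]; exists !v, !a; rewrite <- abs_is_Vlevel; auto.
  - rewrite rank_lt_iff; intros H.
    assert (Hy := carrier_in y); apply (mem_Vl_rk _ Ol) in Hy.
    assert (Ha : rk !y ∈ Vl lam) by (apply ord_in_Vl; auto using ord_rk).
    assert (Hv := Vl_in_level Ha (ord_rk _)).
    set (v := exist _ (Vl (rk !y)) Hv : W); set (a := exist _ (rk !y) Ha : W).
    exists v, a; split; [exact (proj2 (abs_is_Vlevel v a) (proj2 (is_Vlevel_iff _ _) (conj (ord_rk !y) eq_refl)))|].
    unfold cmem, v; cbn [proj1_sig].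
    rewrite !mem_Vl_rk by apply ord_rk; split; auto; apply mem_irrefl.
Qed.
#[local] Hint Resolve abs_inC0 abs_is_cod abs_rank_lt : abs.
Lemma abs_lt_clause A x y : lt_clause cm A x y <-> lt_clause mem !A !x !y.
Proof. unfold lt_clause; abs_tac. Qed.
#[local] Hint Resolve abs_lt_clause : abs.
Lemma abs_good_order A v : good_order cm A v <-> good_order mem !A !v.
Proof. unfold good_order; abs_tac. Qed.
Lemma abs_cod_lt x y : cod_lt cm x y <-> cod_lt mem !x !y.
Proof.
  split.
  - intros [A [v [a [Hv [Hx [Hy [HA H]]]]]]]; exists !A, !v, !a.
    rewrite <- abs_is_Vlevel, <- abs_good_order, <- abs_gr; auto 6.
  - intros H.
    (* As the level is a limit, x and y already lie in some V_a with a below it, and the order on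
       V_a is an element of the level. *)
    destruct (proj1 (mem_Vl _ Ol) (Vl_up Ll (carrier_in x) (carrier_in y))) as [a [Ha Hxy]].
    assert (Oa := ord_mem Ol Ha).
    assert (Hx : !x ∈ Vl a) by (apply Hxy, up_l).
    assert (Hy : !y ∈ Vl a) by (apply Hxy, up_r).
    destruct (good_order_exists Oa) as [A [HAs HA]].
    apply (cod_lt_good Oa HA Hx Hy) in H.
    assert (Ha' : a ∈ Vl lam) by (apply ord_in_Vl; auto).
    assert (Hv := Vl_in_level Ha' Oa).
    assert (HAl : A ∈ Vl lam) by (apply (Vl_sub Ll (cart_in_level Hv Hv) HAs)).
    set (A' := exist _ A HAl : W); set (v := exist _ (Vl a) Hv : W); set (a' := exist _ a Ha' : W).
    exists A', v, a'; split; [exact (proj2 (abs_is_Vlevel v a') (proj2 (is_Vlevel_iff _ _) (conj Oa eq_refl)))|].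
    split; [exact Hx|]; split; [exact Hy|]; split; [apply abs_good_order, HA|].
    apply abs_gr, gr_iff, H.
Qed.
#[local] Hint Resolve abs_good_order abs_cod_lt : abs.
Lemma abs_pick f g c : pick cm f g c <-> pick mem !f !g !c.
Proof. unfold pick, unused; abs_tac. Qed.
#[local] Hint Resolve abs_pick : abs.
Lemma abs_is_tails s c g n : is_tails cm s c g n <-> is_tails mem !s !c !g !n.
Proof. unfold is_tails; abs_tac. Qed.
Lemma abs_list_of s c : list_of cm s c <-> list_of mem !s !c.
Proof.
  split.
  - intros [g [n H]]; exists !g, !n; apply abs_is_tails, H.
  - intros H; apply list_of_iff in H; destruct H as [g [n [Hn [G1 [G2 [G3 [G4 G5]]]]]]].
    assert (On := ord_mem ord_om Hn).
    set (r := Vl (sc (rk !c))); assert (Or := ord_sc (ord_rk !c)).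
    (* g may contain irrelevant pairs from outside the level. Each tail is a component of the
       preceding one, so the part h of rank at most that of c still lists all tails. *)
    destruct (@graph_exists _ _ _ om r (fun i x => pr i x ∈ g)) as [h [Hh Hpr]]; [fo_tac|].
    assert (Hr : r ∈ Vl lam).
    { assert (Hc' := carrier_in c); apply (mem_Vl_rk _ Ol) in Hc'.
      exact (Vl_in Ol (limit_sc Ll Hc')). }
    assert (Hhl : h ∈ Vl lam) by (exact (Vl_sub Ll (cart_in_level om_in_level Hr) Hh)).
    assert (In : forall i, i ∈ om -> i ∈ sc n -> forall x, pr i x ∈ g -> x ∈ r).
    { apply (@om_ind _ _ _ (fun i => i ∈ sc n -> forall x, pr i x ∈ g -> x ∈ r)); [fo_tac| |].
      - intros _ x Hx; rewrite (G1 _ _ _ Hx G2); apply mem_Vl_rk; auto; apply mem_sc; auto.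
      - intros i Hi IH Hin x Hx; rewrite (sc_mem_iff _ On) in Hin.
        destruct (G3 i Hin) as [y [z [_ [Hz Hyz]]]]; rewrite (G1 _ _ _ Hx Hz).
        assert (Hq : pr y z ∈ r) by (eapply IH; eauto; apply mem_sc; auto).
        unfold r in *; rewrite mem_Vl_rk in * by auto; destruct (pr_rk y z) as [_ R].
        exact (ord_trans Or R Hq). }
    assert (Hnl : n ∈ Vl lam) by (apply nat_in_level, Hn).
    exists (exist _ h Hhl), (exist _ n Hnl); apply abs_is_tails, is_tails_iff; simpl.
    split; auto; split; [|split; [|split; [|split]]].
    + intros i x x' H H'; apply Hpr in H, H'; apply (G1 i); tauto.
    + apply Hpr; split; [apply limit_emp, limit_om|split; auto].
      apply mem_Vl_rk; auto; apply mem_sc; auto.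
    + intros i Hi; destruct (G3 i Hi) as [y [z [A [B C]]]]; exists y, z; split; auto.
      assert (Ho : i ∈ om) by (exact (ord_trans ord_om Hi Hn)); assert (Hso := sc_om Ho).
      split; apply Hpr; (split; [auto|split; [|auto]]).
      * apply (In (sc i)); auto; apply (sc_mem_iff _ On), Hi.
      * apply (In i); auto; apply mem_sc; auto.
    + apply Hpr; split; auto; split; auto; apply (In n); auto; apply mem_sc; auto.
    + exact G5.
Qed.
#[local] Hint Resolve abs_list_of : abs.
Lemma abs_decode c x : decode cm c x <-> decode mem !c !x.
Proof.
  unfold decode; abs_tac; apply abs_sat; auto.
Qed.

End Absoluteness.

(** * The greedy enumeration of codes *)

Section Enumeration.

Context {V : Type} {mem : V -> V -> Prop} {hZFC : ZFC mem}.
Local Notation "x ∈ y" := (mem x y) (at level 70, no associativity).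
Local Notation fo := (@fo V mem).
Local Notation tm := (@tm V mem).

Lemma inC_ord d g : inC mem d g -> ord mem g.
Proof. intros [Ig _]; exact (inacc_ord Ig). Qed.
Lemma inC0_ord d g : inC0 mem d g -> ord mem g.
Proof. intros [H _]; exact (inC_ord H). Qed.

Lemma pick_iff f g c : pick mem f g c <-> ord mem g /\ c ∈ Vl g /\ is_cod mem c /\
  (forall g', g' ∈ g -> ~ pr g' c ∈ f) /\
  forall c', c' ∈ Vl g -> is_cod mem c' -> (forall g', g' ∈ g -> ~ pr g' c' ∈ f) ->
    c' = c \/ cod_lt mem c c'.
Proof.
  assert (U : forall c, unused mem f g c <-> forall g', g' ∈ g -> ~ pr g' c ∈ f).
  { intros b; unfold unused; split.
    - intros N g' Hg H; apply N; exists g'; rewrite gr_iff; auto.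
    - intros H [g' [Hg H']]; apply gr_iff in H'; exact (H g' Hg H'). }
  unfold pick; split.
  - intros [v [Hv [Hc [Cc [Uc H]]]]]; apply is_Vlevel_iff in Hv; destruct Hv as [Og ->].
    rewrite U in Uc; repeat (split; auto); intros c' H1 H2 H3; apply H; auto; apply U, H3.
  - intros [Og [Hc [Cc [Uc H]]]]; exists (Vl g); rewrite is_Vlevel_iff, U.
    repeat (split; auto); intros c' H1 H2 H3; apply H; auto; apply U, H3.
Qed.

(** The choice at g depends on f only below g; hence the greedy assignment is a recursion. *)
Lemma pick_cong f f' g c : (forall g' b, g' ∈ g -> (pr g' b ∈ f <-> pr g' b ∈ f')) ->
  (pick mem f g c <-> pick mem f' g c).
Proof.
  intros H; rewrite !pick_iff.
  assert (U : forall b, (forall g', g' ∈ g -> ~ pr g' b ∈ f) <-> (forall g', g' ∈ g -> ~ pr g' b ∈ f')).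
  { intros b; split; intros N g' Hg Hb; apply (N g' Hg), H; auto. }
  rewrite U; split; intros [H1 [H2 [H3 [H4 H5]]]]; repeat (split; auto);
    intros c' A B C; apply H5; auto; apply U, C.
Qed.

Lemma pick_unique f g c c' : pick mem f g c -> pick mem f g c' -> c = c'.
Proof.
  rewrite !pick_iff; intros [_ [H1 [H2 [H3 H4]]]] [_ [K1 [K2 [K3 K4]]]].
  destruct (H4 c' K1 K2 K3) as [E|L]; auto; destruct (K4 c H1 H2 H3) as [E|L']; auto.
  destruct (cod_lt_asym L L').
Qed.

Definition greedy_below (d th f : V) : Prop :=
  forall g c, pr g c ∈ f <-> g ∈ th /\ inC0 mem d g /\ pick mem f g c.

Lemma greedy_below_exists d th : ord mem th ->
  exists f, sub mem f (cart th (Vl th)) /\ greedy_below d th f.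
Proof.
  intros Oth; set (Phi := fun U z => exists g c, z = pr g c /\ inC0 mem d g /\ pick mem U g c).
  (* The measure is the stage itself. A code assigned at g lies in V_g, so the product contains all
     pairs of the enumeration below th. *)
  destruct (@set_recursion _ _ _ (cart th (Vl th)) proj_fst Phi) as [A [HA HR]].
  - fo_tac.
  - unfold Phi; fo_tac.
  - intros x Hx; apply mem_cart in Hx; destruct Hx as [g [c [Hg [_ ->]]]]; rewrite fst_pr.
    exact (ord_mem Oth Hg).
  - exists A; split; auto; intros g c.
    assert (Step : g ∈ th -> c ∈ Vl th -> (pr g c ∈ A <-> inC0 mem d g /\ pick mem A g c)).
    { intros Hg Hc; destruct (HR (pr g c)) as [U [HU E]]; [apply pr_in_cart; auto|].
      rewrite E, (@pick_cong A U g c).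
      - unfold Phi; split; [|eauto].
        intros [g' [c' [E' H]]]; apply pr_inj in E'; destruct E'; subst; auto.
      - intros g' b Hg'; rewrite HU, !fst_pr; tauto. }
    split.
    + intros H; assert (H' := H); apply HA, pr_in_cart in H'; destruct H' as [Hg Hc].
      split; auto; apply Step; auto.
    + intros [Hg H]; apply Step; auto; destruct H as [_ H]; apply pick_iff in H.
      destruct H as [Og [Hc _]]; exact (Vl_mono Oth Hg Hc).
Qed.

(** D is an initial segment of stages: the common part of two bounds when approximations are
    compared, and V_k for the enumeration as V_k sees it. *)
Lemma greedy_agree d f f' (D : V -> Prop) : fo (fun e => D (e 0)) ->
  (forall g g', g' ∈ g -> D g -> D g') ->
  (forall g c, D g -> (pr g c ∈ f <-> inC0 mem d g /\ pick mem f g c)) ->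
  (forall g c, D g -> (pr g c ∈ f' <-> inC0 mem d g /\ pick mem f' g c)) ->
  forall g c, D g -> (pr g c ∈ f <-> pr g c ∈ f').
Proof.
  intros fD HD Hf Hf'.
  assert (H : forall g, ord mem g -> D g -> forall c, pr g c ∈ f <-> pr g c ∈ f').
  { apply (@ord_ind _ _ _ (fun g => D g -> forall c, pr g c ∈ f <-> pr g c ∈ f')); [fo_tac|].
    intros g Og IH Dg c; rewrite Hf, Hf' by auto; apply and_iff_compat_l, pick_cong.
    intros g' b Hg'; apply IH; eauto. }
  intros g c Dg; split; intros Hc.
  - apply H; auto; apply Hf in Hc; auto; exact (inC0_ord (proj1 Hc)).
  - apply H; auto; apply Hf' in Hc; auto; exact (inC0_ord (proj1 Hc)).
Qed.

Lemma greedy_below_agree d th th' f f' : ord mem th -> ord mem th' ->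
  greedy_below d th f -> greedy_below d th' f' ->
  forall g c, g ∈ th -> g ∈ th' -> (pr g c ∈ f <-> pr g c ∈ f').
Proof.
  intros O O' Hf Hf' g c Hg Hg'.
  apply (@greedy_agree d f f' (fun g => g ∈ th /\ g ∈ th')); auto; [fo_tac| | |].
  - intros x y Hy [H H']; split; eapply ord_trans; eauto.
  - intros x y [H H']; rewrite (Hf x y); tauto.
  - intros x y [H H']; rewrite (Hf' x y); tauto.
Qed.

(** The enumeration glued together from set-sized approximations; ranging over a proper class of
    stages, it can only be a definable relation. *)
Definition enum (d g c : V) : Prop :=
  inC0 mem d g /\ exists f, greedy_below d g f /\ pick mem f g c.
Lemma fo_enum : fo (fun e => enum (e 0) (e 1) (e 2)).
Proof. unfold enum, greedy_below; fo_tac. Qed.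
#[local] Hint Resolve fo_enum : tm.

Lemma greedy_below_enum d th f : ord mem th -> greedy_below d th f ->
  forall g c, pr g c ∈ f <-> g ∈ th /\ enum d g c.
Proof.
  intros Oth Hf g c; rewrite (Hf g c); apply and_cong; [tauto|intros Hg].
  assert (Og := ord_mem Oth Hg); unfold enum; apply and_iff_compat_l.
  destruct (greedy_below_exists d Og) as [h [_ Hh]].
  assert (A : forall f', greedy_below d g f' -> (pick mem f g c <-> pick mem f' g c)).
  { intros f' Hf'; apply pick_cong; intros g' b Hg'.
    apply (greedy_below_agree Oth Og Hf Hf'); auto; exact (ord_trans Oth Hg' Hg). }
  split; [intros H; exists h; split; auto; apply (A h Hh), H|].
  intros [f' [Hf' H]]; apply (A f' Hf'), H.
Qed.

Lemma enum_unique d g c c' : enum d g c -> enum d g c' -> c = c'.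
Proof.
  intros [Hg [f [Hf H]]] [_ [f' [Hf' H']]]; assert (Og := inC0_ord Hg).
  apply (@pick_unique f g); auto; revert H'; apply pick_cong; intros g' b Hg'.
  apply (greedy_below_agree Og Og Hf Hf'); auto.
Qed.
Lemma enum_inj d g g' c : enum d g c -> enum d g' c -> g = g'.
Proof.
  assert (H : forall g g', enum d g c -> enum d g' c -> ~ g ∈ g').
  { clear g g'; intros g g' H [Hg' [f [Hf Hp]]] Hin; apply pick_iff in Hp.
    destruct Hp as [_ [_ [_ [N _]]]]; apply (N g Hin), (greedy_below_enum (inC0_ord Hg') Hf); auto. }
  intros E E'; destruct (ord_trich (inC0_ord (proj1 E)) (inC0_ord (proj1 E'))) as [L|[L|L]]; auto;
    [destruct (H g g')|destruct (H g' g)]; auto.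
Qed.

(** * Every code is assigned, and codes of one set are assigned unboundedly often *)

Section Unbounded.

Context (d : V) (Hunb : forall th, ord mem th -> exists g, inC0 mem d g /\ th ∈ g).

(** If c were never assigned, every late stage would pick a code preceding c. These codes have rank
    at most that of c and so form a set, whereas the stages are unbounded and pick distinct
    codes. *)
Lemma enum_hits c : is_cod mem c -> exists g, enum d g c.
Proof.
  intros Cc; apply NNPP; intros N.
  destruct (in_Vl_exists c) as [a [Oa Hca]].
  (* At stages beyond a the code c is a candidate, so the least candidate has rank at most that of c
     and lies in V_a. *)
  assert (Hlow : forall g, inC0 mem d g -> a ∈ g -> exists b, b ∈ Vl a /\ enum d g b).
  { intros g Hg Hag; assert (Og := inC0_ord Hg).
    destruct (greedy_below_exists d Og) as [f [_ Hf]].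
    set (P := fun b => is_cod mem b /\ forall g', g' ∈ g -> ~ pr g' b ∈ f).
    assert (HP : fo (fun e => P (e 0))) by (unfold P; fo_tac).
    assert (HcP : c ∈ cmp (Vl g) P).
    { apply (cmp_iff (Vl g) HP); split; [exact (Vl_mono Og Hag Hca)|].
      split; auto; intros g' Hg' H; apply (greedy_below_enum Og Hf) in H; apply N; exists g'; tauto. }
    destruct (@cod_least _ _ _ (cmp (Vl g) P)) as [b [Hb Hmin]].
    { intros b Hb; apply (cmp_iff (Vl g) HP) in Hb; apply Hb. }
    { eauto. }
    assert (Eb : enum d g b).
    { split; auto; exists f; split; auto; apply pick_iff.
      apply (cmp_iff (Vl g) HP) in Hb; destruct Hb as [Hb [Cb Ub]].
      repeat (split; auto); intros b' H1 H2 H3; apply Hmin, (cmp_iff (Vl g) HP); split; auto.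
      split; auto. }
    exists b; split; auto; destruct (Hmin c HcP) as [->|L]; [destruct N; eauto|].
    rewrite mem_Vl_rk in Hca |- * by auto; apply cod_lt_iff in L; destruct L as [L|[L _]].
    - exact (ord_trans Oa L Hca).
    - destruct (ord_mem_or_le (ord_rk c) (ord_rk b)) as [L'|L']; [tauto|].
      exact (ole_mem_trans Oa L' Hca). }
  (* By [enum_inj] a code determines its stage, so the stages beyond a form a set; a stage above all
     of these yields the contradiction. *)
  destruct (@replacement _ _ _ (fun b g => enum d g b) (Vl a)) as [B HB].
  - fo_tac.
  - intros b g g' _; apply enum_inj.
  - destruct (@ord_bound _ _ _ (cup B (up a a))) as [th [Oth Hth]].
    + intros x Hx; rewrite mem_cup, mem_up in Hx; destruct Hx as [Hx|[-> | ->]]; auto.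
      apply HB in Hx; destruct Hx as [b [_ [Hx _]]]; exact (inC0_ord Hx).
    + destruct (Hunb Oth) as [g [Hg Htg]]; assert (Og := inC0_ord Hg).
      assert (Hag : a ∈ g).
      { refine (ord_trans Og _ Htg); apply Hth; rewrite mem_cup, mem_up; auto. }
      destruct (Hlow g Hg Hag) as [b [Hb Eb]].
      assert (Hgt : g ∈ th) by (apply Hth, mem_cup; left; apply HB; eauto).
      exact (mem_asym Hgt Htg).
Qed.

(** The codes assigned before th form a set, so some eta does not occur in them, and the code with
    this eta must be assigned at th or later. *)
Lemma enum_unbounded r th : ord mem th ->
  (forall eta, ord mem eta -> is_cod mem (pr r eta)) ->
  exists eta g, ord mem eta /\ ole mem th g /\ enum d g (pr r eta).
Proof.
  intros Oth Hr; apply NNPP; intros N.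
  destruct (@replacement _ _ _ (fun g c => enum d g c) th) as [B HB].
  - fo_tac.
  - intros g c c' _; apply enum_unique.
  (* The double union of B contains the second components of all pairs in B. *)
  - destruct (ord_not_set (un (un B))) as [eta [Oeta Neta]].
    destruct (enum_hits (Hr eta Oeta)) as [g Eg]; assert (Og := inC0_ord (proj1 Eg)).
    destruct (ord_mem_or_le Og Oth) as [L|L]; [|apply N; eauto].
    apply Neta; refine (proj2 (pr_in_un (x := r) _)); apply HB; eauto.
Qed.

End Unbounded.

(** The least member of C_k above th is in C0_k, because all smaller members are at most th and so
    are bounded by th + 1. *)
Lemma uplifting_unbounded k : uplifting mem k ->
  forall th, ord mem th -> exists g, inC0 mem k g /\ th ∈ g.
Proof.
  intros [Ik Hk] th Oth; assert (Ok := inacc_ord Ik).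
  destruct (Hk (sc th) (ord_sc Oth)) as [g [vk [vg [Ig [Hg [Hvk [Hvg [He Hne]]]]]]]].
  assert (Og := inacc_ord Ig).
  assert (Htg : th ∈ g).
  { refine (mem_ole_trans Og (b := sc th) _ Hg); apply mem_sc; auto. }
  assert (HC : inC mem k g).
  { split; auto; split; [|exists vk, vg; auto].
    apply is_Vlevel_iff in Hvk, Hvg; destruct Hvk as [_ ->], Hvg as [_ ->].
    destruct (ord_trich Ok Og) as [L|[L|L]]; auto; [destruct Hne; subst; auto|].
    (* If g were below k, then V_g would belong to V_k and hence, by inclusion, to itself. *)
    exfalso; apply (@mem_irrefl _ _ _ (Vl g)); apply He, Vl_in; auto. }
  destruct (@ord_least _ _ _ (fun g => inC mem k g /\ th ∈ g) g) as [g0 [Og0 [_ [[HC0 Ht0] Hmin]]]];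
    auto; [fo_tac|].
  exists g0; split; auto; split; auto.
  exists (sc th); split.
  - apply limit_sc; auto; apply inacc_limit, HC0.
  - intros g' Hg' HC'; apply mem_sc.
    destruct (ord_mem_or_le Oth (inC_ord HC')) as [L|L]; [destruct (Hmin g'); auto|].
    exact L.
Qed.

End Enumeration.

(** * The Laver function in an inaccessible level *)

Section LaverFunction.

Context {V : Type} {mem : V -> V -> Prop} {hZFC : ZFC mem}.
Local Notation "x ∈ y" := (mem x y) (at level 70, no associativity).
Local Notation fo := (@fo V mem).
Local Notation tm := (@tm V mem).

Local Notation "! x" := (proj1_sig x) (at level 1).

Lemma assign_pair M d x : d ∈ M -> x ∈ M ->
  exists s, assign mem M s /\ pr (num 0) d ∈ s /\ pr (num 1) x ∈ s.
Proof.
  intros Hd Hx.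
  destruct (@fun_exists _ _ _ om M (fun _ y => y = x)) as [s [Hs Hpr]].
  - fo_tac.
  - eauto.
  - congruence.
  - apply assign_iff in Hs; destruct (scons_exists Hs Hd) as [t [Ht Hts]].
    exists t; split; auto; apply is_scons_iff in Hts; split; [apply Hts|].
    apply (proj2 Hts), Hpr; split; auto; apply limit_emp, limit_om.
Qed.

(* Q restricts the values: to ordinals for the ordinal-anticipating function. *)
Context (Q : forall W, (W -> W -> Prop) -> W -> Prop).
Context (ufoQ : forall i, ufo (fun W m e => Q m (e i))).

Section Level.

Context (k : V) (Ik : inaccessible mem k).
Let Lk : limit mem k := inacc_limit Ik.
Let Hom : om ∈ k := inacc_om Ik.
Let Ok : ord mem k := inacc_ord Ik.
Local Notation W := (carrier (mem := mem) (Vl k)).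
Local Notation cm := (@cmem V mem (Vl k)).

Lemma greedy_level (d f : W) : greedy cm d f <->
  forall g c, g ∈ Vl k -> c ∈ Vl k ->
    (pr g c ∈ !f <-> inC0 mem !d g /\ pick mem !f g c).
Proof.
  split.
  - intros H g c Hg Hc; assert (E := H (exist _ g Hg) (exist _ c Hc)).
    rewrite (abs_gr Lk), (abs_inC0 Lk Hom), (abs_pick Lk), gr_iff in E; exact E.
  - intros H g c; rewrite (abs_gr Lk), (abs_inC0 Lk Hom), (abs_pick Lk), gr_iff.
    apply H; apply carrier_in.
Qed.

Lemma next_code_level (f c : W) : next_code cm f c <->
  is_cod mem !c /\ (forall g, ~ pr g !c ∈ !f) /\
  forall c', c' ∈ Vl k -> is_cod mem c' -> (forall g, ~ pr g c' ∈ !f) ->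
    c' = !c \/ cod_lt mem !c c'.
Proof.
  assert (U : forall c : W, ~ (exists g, gr cm f g c) <-> forall g, ~ pr g !c ∈ !f).
  { intros b; split.
    - intros N g H; apply N.
      exists (exist _ g (proj1 (Vl_gr Lk (carrier_in f) H))); apply (abs_gr Lk), gr_iff, H.
    - intros H [g Hg]; apply (abs_gr Lk), gr_iff in Hg; exact (H _ Hg). }
  unfold next_code; rewrite (abs_is_cod Lk), U.
  apply and_iff_compat_l, and_iff_compat_l; split.
  - intros H c' Hc' Cc' Uc'; destruct (H (exist _ c' Hc')) as [E|E].
    + apply (abs_is_cod Lk), Cc'.
    + apply U, Uc'.
    + left; rewrite <- E; reflexivity.
    + right; apply (abs_cod_lt Lk) in E; exact E.
  - intros H c' Cc' Uc'; rewrite (abs_cod_lt Lk), carrier_eq.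
    apply H; [apply carrier_in|apply (abs_is_cod Lk), Cc'|apply U, Uc'].
Qed.

Lemma guess_unique (d x y : W) : guess cm (Q cm) d x -> guess cm (Q cm) d y -> x = y.
Proof.
  intros [f [c [Gf [Nc [Dc _]]]]] [f' [c' [Gf' [Nc' [Dc' _]]]]].
  rewrite greedy_level in Gf, Gf'; rewrite next_code_level in Nc, Nc'.
  apply (abs_decode Lk Hom) in Dc, Dc'.
  assert (Hg : forall f : W, (forall g c, g ∈ Vl k -> c ∈ Vl k ->
    (pr g c ∈ !f <-> inC0 mem !d g /\ pick mem !f g c)) ->
    forall g c, g ∈ Vl k -> (pr g c ∈ !f <-> inC0 mem !d g /\ pick mem !f g c)).
  { intros h Hh g b Hg; split.
    - intros H; apply Hh; auto; exact (proj2 (Vl_gr Lk (carrier_in h) H)).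
    - intros H; apply Hh; auto; destruct H as [_ H]; apply pick_iff in H.
      destruct H as [Og [Hb _]]; apply (ord_in_Vl Ok Og) in Hg; exact (Vl_mono Ok Hg Hb). }
  assert (A : forall g b, pr g b ∈ !f <-> pr g b ∈ !f').
  { assert (A : forall g b, g ∈ Vl k -> (pr g b ∈ !f <-> pr g b ∈ !f')).
    { apply (@greedy_agree _ _ _ !d !f !f' (fun g => g ∈ Vl k)); [fo_tac| |apply Hg, Gf|apply Hg, Gf'].
      intros g g' H' H; exact (Vl_el Lk H H'). }
    intros g b; split; intros H; apply A; auto;
      [exact (proj1 (Vl_gr Lk (carrier_in f) H))|exact (proj1 (Vl_gr Lk (carrier_in f') H))]. }
  assert (E : !c = !c').
  { destruct Nc as [Cc [Uc Lc]], Nc' as [Cc' [Uc' Lc']].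
    assert (L1 : !c' = !c \/ cod_lt mem !c !c').
    { apply Lc; [apply carrier_in|exact Cc'|intros g H; apply (Uc' g), A, H]. }
    assert (L2 : !c = !c' \/ cod_lt mem !c' !c).
    { apply Lc'; [apply carrier_in|exact Cc|intros g H; apply (Uc g), A, H]. }
    destruct L1 as [E|L]; auto; destruct L2 as [E|L']; auto.
    destruct (cod_lt_asym L L'). }
  rewrite <- E in Dc'; apply carrier_eq; exact (decode_unique Dc Dc').
Qed.

Lemma laver_unique (d x y : W) : laver cm (Q cm) d x -> laver cm (Q cm) d y -> x = y.
Proof.
  intros [_ [G|[N E]]] [_ [G'|[N' E']]].
  - exact (guess_unique G G').
  - destruct N'; eauto.
  - destruct N; eauto.
  - apply (abs_is_empty Lk) in E, E'; apply is_empty_iff in E, E'; apply carrier_eq; congruence.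
Qed.
Lemma laver_total (d : W) : ord mem !d -> exists x, laver cm (Q cm) d x.
Proof.
  intros Od; assert (Od' : ord cm d) by (apply (abs_ord Lk), Od).
  destruct (classic (exists x, guess cm (Q cm) d x)) as [[x Hx]|N].
  - exists x; split; auto.
  - exists (exist _ emp (Vl_emp Lk)); split; auto; right; split; auto.
    apply (abs_is_empty Lk), emp_spec.
Qed.

Lemma laver_graph p : (forall X (m : X -> X -> Prop) e,
    fsat m e p <-> laver m (Q m) (e 0) (e 1)) ->
  exists l, sub mem l (cart k (Vl k)) /\ defines (Vl k) l (code p) /\
    forall d x, pr d x ∈ l <-> exists Hd Hx, laver cm (Q cm) (exist _ d Hd) (exist _ x Hx).
Proof.
  intros Hp.
  assert (S : forall s, assign mem (Vl k) s -> forall d x,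
    pr (num 0) d ∈ s -> pr (num 1) x ∈ s -> (sat mem (Vl k) None (code p) s <->
    exists Hd Hx, laver cm (Q cm) (exist _ d Hd) (exist _ x Hx))).
  { intros s Hs d x H0 H1; destruct (sat_code None p Hs) as [e [He E]]; rewrite E, Hp.
    assert (E0 : !(e 0) = d) by (eapply assign_fun; eauto).
    assert (E1 : !(e 1) = x) by (eapply assign_fun; eauto).
    destruct (e 0) as [d' Hd], (e 1) as [x' Hx]; simpl in E0, E1; subst d' x'; split; [eauto|].
    intros [Hd' [Hx' H]].
    rewrite (proof_irrelevance _ Hd Hd'), (proof_irrelevance _ Hx Hx'); exact H. }
  (* Separation needs a formula over the model, so l is carved out by internal satisfaction of
     [code p] and not by a statement about the type [W]. *)
  destruct (@graph_exists _ _ _ k (Vl k) (fun d x => exists s, assign mem (Vl k) s /\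
    pr (num 0) d ∈ s /\ pr (num 1) x ∈ s /\ sat mem (Vl k) None (code p) s)) as [l [Hl Hpr]].
  { fo_tac. }
  assert (G : forall d x, pr d x ∈ l <-> exists Hd Hx, laver cm (Q cm) (exist _ d Hd) (exist _ x Hx)).
  { intros d x; rewrite Hpr; split.
    - intros [_ [_ [s [Hs [H0 [H1 H]]]]]]; apply (S s Hs d x H0 H1), H.
    - intros [Hd [Hx H]]; assert (Od : ord mem d).
      { destruct H as [H _]; apply (abs_ord Lk) in H; exact H. }
      split; [apply (ord_in_Vl Ok Od), Hd|]; split; auto.
      destruct (assign_pair Hd Hx) as [s [Hs [H0 H1]]]; exists s; split; auto; split; auto.
      split; auto; apply (S s Hs d x H0 H1); eauto. }
  exists l; split; auto; split; auto.
  intros s Hs a b H0 H1; rewrite G; exact (S s Hs a b H0 H1).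
Qed.

End Level.

Context (absQ : forall k, inaccessible mem k -> forall x : carrier (mem := mem) (Vl k),
  Q (@cmem V mem (Vl k)) x <-> Q mem !x).

(* At a stage g of the enumeration, V_g computes the enumeration below g, since
   the stages below g are bounded in g. *)
Lemma guess_stage d g c x (Hd : d ∈ Vl g) (Hx : x ∈ Vl g) : inaccessible mem g ->
  enum d g c -> decode mem c x -> Q mem x ->
  guess (@cmem V mem (Vl g)) (Q (@cmem V mem (Vl g))) (exist _ d Hd) (exist _ x Hx).
Proof.
  intros Ig [HC [f0 [Hf0 Hp0]]] Dx Qx; assert (Lg := inacc_limit Ig); assert (Og := inacc_ord Ig).
  assert (Hg := inacc_om Ig).
  destruct (greedy_below_exists d Og) as [f [Hfs Hf]].
  assert (Hp : pick mem f g c).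
  { revert Hp0; apply pick_cong; intros g' b Hg'.
    apply (greedy_below_agree Og Og Hf Hf0); auto. }
  assert (Hfl : f ∈ Vl g).
  (* The bound b on the stages also bounds the codes, as the one assigned at g' lies in V at level
     g'; thus f is a subset of b × V_b. *)
  { destruct HC as [_ [b [Hb Hbd]]]; assert (Ob := ord_mem Og Hb).
    assert (Hb' : b ∈ Vl g) by (apply ord_in_Vl; auto).
    apply (Vl_sub Lg (x := cart b (Vl b))).
    - apply cart_in_level; auto; exact (Vl_in Og Hb).
    - intros p Hpf; assert (Hpf' := Hpf).
      apply Hfs, mem_cart in Hpf'; destruct Hpf' as [g' [b' [Hg' [_ ->]]]].
      apply Hf in Hpf; destruct Hpf as [_ [[HC' _] Hp']]; apply pick_iff in Hp'.
      assert (Hgb : g' ∈ b) by (apply Hbd; auto).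
      apply pr_in_cart; split; auto; exact (Vl_mono Ob Hgb (proj1 (proj2 Hp'))). }
  assert (Hp' := Hp); apply pick_iff in Hp'; destruct Hp' as [_ [Hc [Cc [Uc Lc]]]].
  exists (exist _ f Hfl), (exist _ c Hc).
  rewrite (greedy_level Ig), (next_code_level Ig), (abs_decode Lg Hg), (absQ Ig); simpl.
  assert (Hin : forall g' b, pr g' b ∈ f -> g' ∈ g) by (intros g' b H; apply Hf in H; apply H).
  split; [|split; [|split]]; auto.
  - intros g' b Hg' Hb; rewrite (Hf g' b); split; [tauto|]; intros [H H']; split; auto.
    apply (ord_in_Vl Og (inC0_ord H)), Hg'.
  - split; auto; split.
    + intros g' H; exact (Uc g' (Hin g' c H) H).
    + intros c' Hc' Cc' Uc'; apply Lc; auto.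
Qed.

(** This serves twice: at the uplifting cardinal it produces l, and at a stage of the enumeration,
    with d the uplifting cardinal in the last clause, it produces l' with the anticipated value. *)
Lemma laver_level k p : inaccessible mem k ->
  (forall X (m : X -> X -> Prop) e, fsat m e p <-> laver m (Q m) (e 0) (e 1)) ->
  exists l, is_fun mem l k (Vl k) /\ (forall d x, pr d x ∈ l -> Q mem x \/ x = emp) /\
    defines (Vl k) l (code p) /\
    forall d c x, inC mem d k -> enum d k c -> decode mem c x -> Q mem x -> pr d x ∈ l.
Proof.
  intros Ik Hp; assert (Lk := inacc_limit Ik); assert (Ok := inacc_ord Ik).
  assert (Hom := inacc_om Ik).
  destruct (laver_graph Ik Hp) as [l [Hl [Hdef Hpr]]]; exists l; split; [|split; [|split]]; auto.
  - apply is_fun_iff; split; auto; split.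
    + intros d x y H H'; apply Hpr in H, H'; destruct H as [Hd [Hx H]], H' as [Hd' [Hx' H']].
      rewrite (proof_irrelevance _ Hd' Hd) in H'.
      assert (E := laver_unique Ik H H'); apply carrier_eq in E; exact E.
    + intros d Hd; assert (Od := ord_mem Ok Hd).
      assert (HdV : d ∈ Vl k) by (apply ord_in_Vl; auto).
      destruct (laver_total Ik (d := exist _ d HdV) Od) as [[x Hx] H].
      exists x; split; auto; apply Hpr; eauto.
  - intros d x H; apply Hpr in H; destruct H as [Hd [Hx [_ [G|[_ E]]]]].
    + destruct G as [f [c [_ [_ [_ H]]]]]; left; apply (absQ Ik) in H; exact H.
    + right; apply (abs_is_empty Lk) in E; apply is_empty_iff in E; exact E.
  - intros d c x HC He HD HQ; apply Hpr.
    assert (Hd : d ∈ Vl k).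
    { destruct HC as [_ [Hd _]]; apply ord_in_Vl; auto; exact (ord_mem Ok Hd). }
    assert (Hc : c ∈ Vl k).
    { destruct He as [_ [f [_ H]]]; apply pick_iff in H; apply H. }
    (* The ordinal a of the level in which x is defined is a component of c, so it lies below k. *)
    assert (Hx : x ∈ Vl k).
    { apply decode_iff in HD; destruct HD as [a [q [r [eta [s [-> [_ [Oa [Hx _]]]]]]]]].
      apply (Vl_pr_inv Lk) in Hc; destruct Hc as [Hc _]; apply (Vl_pr_inv Lk) in Hc.
      destruct Hc as [Ha _]; apply (ord_in_Vl Ok Oa) in Ha; exact (Vl_mono Ok Ha Hx). }
    exists Hd, Hx; split; [|left; apply (guess_stage Hd Hx Ik He HD HQ)].
    apply (abs_ord Lk); exact (ord_mem Ok (proj1 (proj2 HC))).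
Qed.

Lemma laver_exists k : uplifting mem k ->
  exists l, is_fun mem l k (Vl k) /\ (forall d x, pr d x ∈ l -> Q mem x \/ x = emp) /\
    definable_in mem (Vl k) l /\
    forall x, OD mem x -> Q mem x -> forall th, ord mem th ->
    exists g l', inaccessible mem g /\ ole mem th g /\ is_fun mem l' g (Vl g) /\
      (forall d x, pr d x ∈ l' -> Q mem x \/ x = emp) /\
      elem_sub mem (Vl k) (Some l) (Vl g) (Some l') /\ gr mem l' k x.
Proof.
  intros Uk; assert (Ik := proj1 Uk); destruct (ufo_laver ufoQ 0 1) as [p Hp].
  destruct (laver_level Ik Hp) as [l [Fl [Vall [Dl _]]]].
  exists l; split; auto; split; auto; split.
  - exists (code p); split; [apply fml_code|]; intros s Hs.
    destruct (assign_val Hs (num_nat 0)) as [a [Ha H0]], (assign_val Hs (num_nat 1)) as [b [Hb H1]].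
    rewrite (Dl s Hs a b H0 H1); split.
    + intros H; exists (num 0), (num 1), a, b; rewrite !is_num_iff, !gr_iff; auto 6.
    + intros [i [j [a' [b' [Hi [Hj [Ha' [Hb' H]]]]]]]]; rewrite is_num_iff in Hi, Hj.
      rewrite gr_iff in Ha', Hb', H; subst i j.
      rewrite (assign_fun Hs H0 Ha'), (assign_fun Hs H1 Hb'); exact H.
  - intros x Ox Qx th Oth; destruct (OD_decode Ox) as [a [q [r Hr]]].
    destruct (enum_unbounded (uplifting_unbounded Uk) (r := pr a (pr q r)) Oth)
      as [eta [g [Oeta [Hg Eg]]]].
    { intros eta Oeta; apply (Hr eta Oeta). }
    assert (HC := proj1 (proj1 Eg)); assert (Ig := proj1 HC).
    destruct (laver_level Ig Hp) as [l' [Fl' [Vall' [Dl' Hl']]]].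
    exists g, l'; split; auto; split; auto; split; auto; split; auto; split.
    + apply (elem_sub_expand (fml_code p) Dl Dl').
      destruct HC as [_ [_ [vk [vg [Hvk [Hvg H]]]]]]; apply is_Vlevel_iff in Hvk, Hvg.
      destruct Hvk as [_ ->], Hvg as [_ ->]; exact H.
    + apply gr_iff, (Hl' k _ x HC Eg); auto; apply (Hr eta Oeta).
Qed.

End LaverFunction.

(** * Ordinal-anticipating and HOD-anticipating functions *)

Section Existence.

Context {V : Type} {mem : V -> V -> Prop} {hZFC : ZFC mem}.
Local Notation "x ∈ y" := (mem x y) (at level 70, no associativity).
Local Notation fo := (@fo V mem).
Local Notation tm := (@tm V mem).

Lemma ord_laver_exists k : uplifting mem k ->
  exists h l, is_H mem h k /\ is_fun mem l k k /\
    ord_anticipating_laver mem k l /\ definable_in mem h l.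
Proof.
  intros Uk; assert (Ik := proj1 Uk).
  (* With Q the class of ordinals every value is an ordinal in V_g, hence an element of g, so the
     codomain shrinks from V_g to g. *)
  assert (F : forall g l, inaccessible mem g -> is_fun mem l g (Vl g) ->
    (forall d x, pr d x ∈ l -> ord mem x \/ x = emp) -> is_fun mem l g g).
  { intros g l Ig Fl Hl; assert (Og := inacc_ord Ig).
    assert (Hx : forall d x, pr d x ∈ l -> x ∈ Vl g -> x ∈ g).
    { intros d x H Hx; apply (ord_in_Vl Og); auto; destruct (Hl d x H) as [O| ->]; auto.
      apply ord_emp. }
    apply is_fun_iff in Fl; destruct Fl as [F1 [F2 F3]]; apply is_fun_iff; split; [|split; auto].
    - intros p Hp; assert (Hp' := Hp); apply F1, mem_cart in Hp'.
      destruct Hp' as [d [x [Hd [Hxg ->]]]]; apply pr_in_cart; eauto.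
    - intros d Hd; destruct (F3 d Hd) as [x [Hxg H]]; eauto. }
  destruct (@laver_exists V mem hZFC (fun W m x => ord m x) ufo_ord) with (k := k)
    as [l [Fl [Vl' [Dl H]]]]; auto.
  { intros g Ig x; apply (abs_ord (inacc_limit Ig)). }
  exists (Vl k), l; split; [apply (is_H_Vl Ik)|]; split; auto; split; auto.
  exists (Vl k), k; split; [apply (is_H_Vl Ik)|]; split; auto; split; [apply (F k l); auto|].
  intros x Ox th Oth; destruct (H x (ord_OD Ox) Ox th Oth) as [g [l' [Ig [Hg [Fl' [Vl'' [He Hx]]]]]]].
  exists g, (Vl g), g, l'; split; auto; split; auto; split; [apply (is_H_Vl Ig)|].
  split; auto; split; auto; apply (F g l'); auto.
Qed.

Lemma HOD_laver_exists k : uplifting mem k ->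
  exists h l, is_H mem h k /\ is_fun mem l k h /\
    HOD_anticipating_laver mem k l /\ definable_in mem h l.
Proof.
  intros Uk; assert (Ik := proj1 Uk).
  destruct (@laver_exists V mem hZFC (fun W m x => True) (fun _ => ufo_true)) with (k := k)
    as [l [Fl [_ [Dl H]]]]; auto; [tauto|].
  exists (Vl k), l; split; [apply (is_H_Vl Ik)|]; split; auto; split; auto.
  exists (Vl k), (Vl k); split; [apply (is_H_Vl Ik)|]; split; [apply (is_H_Vl Ik)|].
  split; [apply Fl|].
  intros x Hx th Oth; destruct (H x (HOD_OD Hx) I th Oth) as [g [l' [Ig [Hg [Fl' [_ [He Hkx]]]]]]].
  exists g, (Vl g), (Vl g), l'; split; auto; split; auto; split; [apply (is_H_Vl Ig)|].
  split; [apply (is_H_Vl Ig)|]; split; [apply Fl'|]; auto.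
Qed.

End Existence.

Theorem theorem4p5 (V : Type) (mem : V -> V -> Prop) (hZFC : ZFC mem) :
  (forall k : V, uplifting mem k ->
     exists h l : V, is_H mem h k /\ is_fun mem l k k /\
       ord_anticipating_laver mem k l /\ definable_in mem h l) /\
  (forall k : V, uplifting mem k ->
     exists h l : V, is_H mem h k /\ is_fun mem l k h /\
       HOD_anticipating_laver mem k l /\ definable_in mem h l) /\
  ((forall x : V, HOD mem x) ->
   forall k : V, uplifting mem k ->
     exists h l : V, is_H mem h k /\ is_fun mem l k h /\
       uplifting_laver mem k l /\ definable_in mem h l).
Proof.
  split; [exact ord_laver_exists|split; [exact HOD_laver_exists|]].
  intros HV k Uk; destruct (HOD_laver_exists Uk) as [h [l [Hh [Fl [[hk [c [H1 [H2 [H3 H]]]]] Dl]]]]].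
  exists h, l; split; auto; split; auto; split; auto.
  exists hk, c; auto 6.
Qed.
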